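(* Let $D$ be a domain in $\mathbb C^n$. Any locally $\mathbb C$-strictly convex point $p\in\partial D$ is a $k$-point for $D$. As a consequence, any pair $p\ne q$ of distinct locally $\mathbb C$-strictly convex points of $\partial D$ satisfies the log-estimate $$\limsup_{(x,y)\to(p,q)}\left(\frac12\log\frac1{\delta_D(x)}+\frac12\log\frac1{\delta_D(y)}-k_D(x,y)\right)<\infty ,$$ where $x,y\in D$.
   Context: For a domain $D\subset\mathbb C^n$, $k_D$ denotes the Kobayashi (pseudo)distance (the integrated form of the Kobayashi–Royden metric), and $\delta_D(z)=\inf\{\|z-w\|:w\in\mathbb C^n\setminus D\}$. $p\in\partial D$ is a $k$-point for $D$ if for every neighborhood $W$ of $p$, $\liminf_{z\to p}\left[k_D(z,W^c)+\frac12\log\delta_D(z)\right]>-\infty$, where $k_D(z,W^c):=\inf_{w\in D\setminus W}k_D(z,w)$. Multifaces: a complex face of a convex domain $G$ is a set $L\cap\partial G$, where $L$ is an affine complex line with $L\cap G=\emptyset$ and $L\cap\partial G\neq\emptyset$. For $x\in\partial G$, the multiface $F_x$ is the union of all complex faces of $G$ containing $x$. A point $p\in\partial D$ is locally $\mathbb C$-strictly convex if there is a biholomorphism $\Psi$ from a bounded open neighborhood $U$ of $p$ onto $\Psi(U)$ such that $\Psi(D\cap U)$ is convex and $F_{\Psi(p)}=\{\Psi(p)\}$, the multiface being taken with respect to $\Psi(D\cap U)$. *)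

(* Defs.v *)
From mathcomp Require Import all_boot all_order all_algebra.
From mathcomp Require Import complex.
From mathcomp Require Import all_classical all_reals all_analysis.

Set Implicit Arguments.
Unset Strict Implicit.
Unset Printing Implicit Defensive.

Import Order.TTheory GRing.Theory Num.Theory.
Import numFieldNormedType.Exports.

Local Open Scope classical_set_scope.
Local Open Scope ring_scope.

(* [R[i]] seen through its [numFieldType] structure, so that it inherits the
   topology and the normed module structure attached to every [numFieldType]. *)
Definition Cplx (R : realType) : numFieldType := R[i].

(* C^n.  The library norm on matrices is the sup norm: it provides the topology
   and the differential, while distances are measured with [enorm] below. *)
Notation Cn R n := 'rV[Cplx R]_n.

Definition cmod (R : realType) (a : Cplx R) : R :=
  Num.sqrt (complex.Re a ^+ 2 + complex.Im a ^+ 2).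

Definition enorm (R : realType) (n : nat) (z : Cn R n) : R :=
  Num.sqrt (\sum_(j < n) cmod (z ord0 j) ^+ 2).

Definition domain (R : realType) (n : nat) (D : set (Cn R n)) : Prop :=
  [/\ D !=set0, open D & connected D].

Definition frontier (R : realType) (n : nat) (A : set (Cn R n)) : set (Cn R n) :=
  closure A `\` interior A.

(* As the infimum of the empty set of reals is 0, this is meaningful only for
   [D <> setT], which always holds in the presence of a boundary point. *)
Definition bdist (R : realType) (n : nat) (D : set (Cn R n)) (z : Cn R n) : R :=
  inf [set enorm (z - w) | w in ~` D].

Definition unit_disc (R : realType) : set (Cplx R) :=
  [set z : Cplx R | cmod z < 1].

(* Normalised so that the metric of the unit disc is |dz|/(1 - |z|^2), which
   matches the factor 1/2 in front of the logarithms below. *)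
Definition kobayashi_royden (R : realType) (n : nat) (D : set (Cn R n))
    (z v : Cn R n) : \bar R :=
  ereal_inf [set x : \bar R | exists (alpha : Cplx R) (phi : Cplx R -> Cn R n),
    [/\ forall w : Cplx R, unit_disc w -> differentiable phi w,
        forall w : Cplx R, unit_disc w -> D (phi w),
        phi 0 = z,
        alpha *: derive1 phi 0 = v &
        x = (cmod alpha)%:E]].

(* C^n is only a normed module over C in the library, hence this explicit
   difference quotient in a real variable. *)
Definition diff_quotient (R : realType) (n : nat) (c : R -> Cn R n) (t : R) :
    R -> Cn R n :=
  fun h => ((h^-1)%:C%C : Cplx R) *: (c (t + h) - c t).

Definition velocity (R : realType) (n : nat) (c : R -> Cn R n) (t : R) : Cn R n :=
  lim (diff_quotient c t @ 0^').

Definition C1_curve (R : realType) (n : nat) (c : R -> Cn R n) : Prop :=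
  (forall t : R, cvg (diff_quotient c t @ 0^')) /\ continuous (velocity c).

(* Being C^1 on a compact interval (with one-sided derivatives at the endpoints)
   is being the restriction of a C^1 curve defined on the whole line. *)
Definition piecewise_C1 (R : realType) (n : nat) (c : R -> Cn R n) : Prop :=
  exists (m : nat) (s : nat -> R),
    [/\ s 0%N = 0, s m = 1 &
        forall i : nat, (i < m)%N -> s i < s i.+1 /\
          exists2 e : R -> Cn R n, C1_curve e &
            forall t : R, s i <= t <= s i.+1 -> c t = e t].

(* The velocity is unspecified at the finitely many breakpoints, which do not
   contribute to the integral. *)
Definition kob_length (R : realType) (n : nat) (D : set (Cn R n))
    (c : R -> Cn R n) : \bar R :=
  (\int[@lebesgue_measure R]_(t in `[0%R, 1%R])
     kobayashi_royden D (c t) (velocity c t))%E.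

Definition kobayashi (R : realType) (n : nat) (D : set (Cn R n))
    (x y : Cn R n) : \bar R :=
  ereal_inf [set kob_length D c | c in
    [set c : R -> Cn R n | [/\ piecewise_C1 c, c 0 = x, c 1 = y &
       forall t : R, 0 <= t <= 1 -> D (c t)]]].

(* [k_D(z, W^c)]; equal to [+oo] when [D] is contained in [W]. *)
Definition kobayashi_compl (R : realType) (n : nat) (D : set (Cn R n))
    (z : Cn R n) (W : set (Cn R n)) : \bar R :=
  ereal_inf [set kobayashi D z w | w in D `\` W].

Definition k_point (R : realType) (n : nat) (D : set (Cn R n))
    (p : Cn R n) : Prop :=
  frontier D p /\
  forall W : set (Cn R n), nbhs p W ->
    (-oo < limf_einf
             (fun z => kobayashi_compl D z W + (2^-1 * ln (bdist D z))%:E)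
             (within D (nbhs p)))%E.

Definition complex_line (R : realType) (n : nat) (L : set (Cn R n)) : Prop :=
  exists a b : Cn R n,
    b != 0 /\ L = [set a + zeta *: b | zeta in [set: Cplx R]].

Definition complex_face (R : realType) (n : nat) (G F : set (Cn R n)) : Prop :=
  exists L : set (Cn R n),
    [/\ complex_line L, L `&` G = set0, L `&` frontier G !=set0 &
        F = L `&` frontier G].

(* In C^1 no complex line misses a nonempty [G], so [multiface G x] is empty. *)
Definition multiface (R : realType) (n : nat) (G : set (Cn R n))
    (x : Cn R n) : set (Cn R n) :=
  \bigcup_(F in [set F | complex_face G F /\ F x]) F.

Definition holomorphic_on (R : realType) (n m : nat) (U : set (Cn R n))
    (f : Cn R n -> Cn R m) : Prop :=
  forall z : Cn R n, U z -> differentiable f z.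

Definition biholomorphic_on (R : realType) (n : nat) (U : set (Cn R n))
    (Psi : Cn R n -> Cn R n) : Prop :=
  [/\ holomorphic_on U Psi, open (Psi @` U) &
      exists2 Phi : Cn R n -> Cn R n, holomorphic_on (Psi @` U) Phi &
        forall z : Cn R n, U z -> Phi (Psi z) = z].

(* [convex_set] quantifies over scalars [0 <= t <= 1] of [Cplx R]; in the partial
   order of C these are exactly the real numbers of the unit interval. *)
Definition locally_C_strictly_convex (R : realType) (n : nat)
    (D : set (Cn R n)) (p : Cn R n) : Prop :=
  frontier D p /\
  exists (U : set (Cn R n)) (Psi : Cn R n -> Cn R n),
    [/\ open U /\ U p,
        bounded_set U,
        biholomorphic_on U Psi,
        convex_set (Psi @` (D `&` U) : set (convex_lmodType (Cn R n))) &
        multiface (Psi @` (D `&` U)) (Psi p) = [set Psi p]].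

Definition log_estimate (R : realType) (n : nat) (D : set (Cn R n))
    (p q : Cn R n) : Prop :=
  (limf_esup
     (fun xy : Cn R n * Cn R n =>
        (2^-1 * ln ((bdist D xy.1)^-1) + 2^-1 * ln ((bdist D xy.2)^-1))%:E
        - kobayashi D xy.1 xy.2)
     (within (D `*` D) (nbhs (p, q))) < +oo)%E.

(* Main.v *)
(** Let [D] look, near [p], like a convex set [G] in a chart [Psi] sending [p] to
    [q]. For [z] close to [p], the nearest point of the complement of [G] to
    [Psi z] gives a holomorphic function [f] on the chart with positive real part
    and [|f z|] comparable to the distance from [z] to the complement of [D].
    Strict C-convexity and compactness bound [|f|] below by a constant [c] away
    from [p], uniformly in [z]. The maximum principle then keeps holomorphic
    discs of [D] centred near [p] inside the chart on a disc of fixed radius, and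
    the Harnack inequality for [f], integrated along radii, improves this radius
    to [1 - O((|f|/c)^(1/m))]. By the Schwarz lemma in the half plane the
    Kobayashi-Royden metric is at least
    [(1 - 2 (|f|/c)^(1/m)) |df| / (2 |f|)], which integrates to a C^1 function [H]
    on all of [D] that is constant away from [p], with [H z <= ln (delta z) / 2 + A]
    and [|dH|] bounded by the metric. Hence [k(z, w) >= H w - H z], which is the
    k-point property; applied to the difference of two such functions, attached
    to [p] and to another point, it gives the log-estimate. *)

Require Import Defs.
From mathcomp Require Import all_boot all_order all_algebra.
From mathcomp Require Import complex ring lra.
From mathcomp Require Import all_classical all_reals all_analysis measurable_realfun.

Set Implicit Arguments.
Unset Strict Implicit.
Unset Printing Implicit Defensive.

Import Order.TTheory GRing.Theory Num.Theory.
Import numFieldNormedType.Exports.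

Local Open Scope classical_set_scope.
Local Open Scope ring_scope.

(** The sharp coefficient 1/2 is what forces two localisations. Knowing only that discs stay in the
    chart on a fixed radius [R0] would put a factor [R0] in front of the logarithm. Recentring by
    disc automorphisms turns this weak fact into [|d ln |f|| <= 2 m / (1 - s^2)] along radii, where
    [m R0 >= 1], so [|f|] grows at most like [((1 + s) / (1 - s))^m]. It cannot reach [c] before the
    radius [T] with [((1 + T) / (1 - T))^m = c / |f|], and [T >= 1 - 2 (|f| / c)^(1/m)]. The loss is
    harmless: in the variable [l = ln |f|] its primitive is [2 m e^((l - ln c) / m)], which stays
    bounded as [l] tends to minus infinity. Two features of the definitions shape the rest.
    Holomorphy is mere pointwise complex differentiability, so the maximum principle, the Schwarz
    lemma and the continuity of differentials are derived from Goursat's bisection. The metric is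
    not known to be measurable, so lengths are bounded below through measurable minorants, which a
    function [H] with continuous derivative along curves supplies. *)

Lemma dist_segment (R : realType) (a b s x : R) :
  a <= s <= b -> a <= x <= b -> `|s - x| <= b - a.
Proof. by rewrite ler_norml; lra. Qed.

Lemma nested_segments (R : realType) (a b : nat -> R) :
  (forall k, a k <= a k.+1) -> (forall k, b k.+1 <= b k) ->
  (forall k, a k <= b k) -> exists x, forall k, a k <= x <= b k.
Proof.
move=> aS bS ab.
have aM k l : (k <= l)%N -> a k <= a l by move: k l; apply/nondecreasing_seqP.
have bM k l : (k <= l)%N -> b l <= b k by move: k l; apply/nonincreasing_seqP.
have aub k l : a k <= b l.
  case: (leqP k l) => kl; first exact: le_trans (aM _ _ kl) (ab _).
  exact: le_trans (ab k) (bM _ _ (ltnW kl)).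
have ne : has_sup (range a).
  split; first by exists (a 0%N); exists 0%N.
  by exists (b 0%N) => _ [k _ <-].
exists (sup (range a)) => k; apply/andP; split.
  by apply: (ub_le_sup ne.2); exists k.
by apply: ge_sup; [exact: ne.1|move=> _ [l _ <-]].
Qed.

(** * Integrals of continuous real functions over segments *)

Section ContinuousIntegral.
Context {R : realType}.
Notation mu := (@lebesgue_measure R).
Implicit Types (f g : R -> R) (a b c : R).

Lemma continuous_integrable_segment f a b : continuous f ->
  mu.-integrable `[a, b] (EFin \o f).
Proof.
by move=> fc; apply: continuous_compact_integrable;
  [exact: segment_compact|exact: continuous_subspaceT].
Qed.

Lemma Rintegral_split f a b c : continuous f -> a <= b -> b <= c ->
  \int[mu]_(t in `[a, c]) f t =
  \int[mu]_(t in `[a, b]) f t + \int[mu]_(t in `[b, c]) f t.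
Proof.
move=> fc ab bc.
have := @Rintegral_itvB R f (BLeft a) (BRight c) b
  (continuous_integrable_segment _ _ fc).
rewrite !bnd_simp => /(_ ab bc).
rewrite Rintegral_itv_obnd_cbnd; first by move<-; rewrite addrC subrK.
apply: integrableS (continuous_integrable_segment b c fc) => //.
exact: subset_itv_oc_cc.
Qed.

Lemma Rintegral_cst_segment a b k : a <= b ->
  \int[mu]_(t in `[a, b]) k = k * (b - a).
Proof.
move=> ab; rewrite Rintegral_cst //=; congr (_ * _).
by rewrite lebesgue_measure_itv /= lte_fin; case: ltgtP ab => // <-; rewrite subrr.
Qed.

Lemma Rintegral_approx f a b k M : continuous f -> a <= b ->
  (forall t, a <= t <= b -> `|f t - k| <= M) ->
  `|\int[mu]_(t in `[a, b]) f t - k * (b - a)| <= M * (b - a).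
Proof.
move=> fc ab fM.
have i1 := continuous_integrable_segment a b fc.
have i2 k' := continuous_integrable_segment a b (@cst_continuous R R k').
have H1 : \int[mu]_(t in `[a, b]) f t <= \int[mu]_(t in `[a, b]) (k + M).
  apply: le_Rintegral => // t; rewrite /= in_itv /= => /fM.
  by rewrite ler_norml; lra.
have H2 : \int[mu]_(t in `[a, b]) (k - M) <= \int[mu]_(t in `[a, b]) f t.
  apply: le_Rintegral => // t; rewrite /= in_itv /= => /fM.
  by rewrite ler_norml; lra.
move: H1 H2; rewrite !Rintegral_cst_segment // ler_norml; lra.
Qed.

Lemma Rintegral_diff f g a b : continuous f -> continuous g ->
  \int[mu]_(t in `[a, b]) (f t - g t) =
  \int[mu]_(t in `[a, b]) f t - \int[mu]_(t in `[a, b]) g t.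
Proof.
by move=> fc gc; rewrite RintegralB //; exact: continuous_integrable_segment.
Qed.

(** Positivity at [a] would persist on a short interval to its right and make the integral positive.
    The left endpoint suffices: in the maximum principle it is the angle 0. *)
Lemma Rintegral_continuous_eq0 f a b : continuous f -> a < b ->
  (forall t, 0 <= f t) -> \int[mu]_(t in `[a, b]) f t = 0 -> f a = 0.
Proof.
move=> fc ab f0 If; apply/eqP; apply: contraT => fa.
have {}fa : 0 < f a by rewrite lt_neqAle eq_sym fa f0.
have /nbhs_ballP [d /= d0 dP] : nbhs a [set t | f a / 2 < f t].
  by apply: (cvgr_gt (f a) (fc a)); lra.
pose c := Num.min b (a + d / 2).
have ac : a < c by rewrite lt_min ab /=; lra.
have cb : c <= b by rewrite ge_min lexx.
have cd : c <= a + d / 2 by rewrite ge_min lexx orbT.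
have H1 : f a / 2 * (c - a) <= \int[mu]_(t in `[a, c]) f t.
  rewrite -Rintegral_cst_segment; last exact: ltW.
  apply: le_Rintegral => //; try exact: continuous_integrable_segment.
    by apply: continuous_integrable_segment => x; exact: cst_continuous.
  move=> t; rewrite /= in_itv /= => /andP[at_ tc]; apply/ltW.
  by apply: dP; rewrite /ball /= ltr_norml; lra.
have H2 : 0 <= \int[mu]_(t in `[c, b]) f t by apply: Rintegral_ge0.
move: If; rewrite (Rintegral_split fc (ltW ac) cb) => If.
have pos : 0 < f a / 2 * (c - a) by rewrite mulr_gt0 ?divr_gt0 ?subr_gt0.
by have := ltr_pwDl (lt_le_trans pos H1) H2; rewrite -If ltxx.
Qed.

End ContinuousIntegral.

(** * Goursat's bisection on rectangles, in real form *)

Section Goursat.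
Context {R : realType}.
Notation mu := (@lebesgue_measure R).
Variables u v : R -> R -> R.

(** Imaginary part of the counterclockwise contour integral of [u + i v] around the rectangle with
    sides [[a, b]] (horizontal) and [[c, d]]. *)
Let flux (a b c d : R) := \int[mu]_(t in `[c, d]) u b t -
  \int[mu]_(t in `[c, d]) u a t - (\int[mu]_(s in `[a, b]) v s d -
  \int[mu]_(s in `[a, b]) v s c).

Hypothesis uc : forall s, continuous (u s).
Hypothesis vc : forall t, continuous (v ^~ t).

Let small (e : R) (r : (R * R) * (R * R)) :=
  `|flux r.1.1 r.1.2 r.2.1 r.2.2| <= e * (r.1.2 - r.1.1) * (r.2.2 - r.2.1).

(** Selects a half on which smallness fails. Flux and area are both additive, so a rectangle that is
    not small always has such a half. *)
Let halfx e (r : (R * R) * (R * R)) :=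
  let m := (r.1.1 + r.1.2) / 2 in
  if `[< small e ((r.1.1, m), r.2) >] then ((m, r.1.2), r.2)
  else ((r.1.1, m), r.2).

Let halfy e (r : (R * R) * (R * R)) :=
  let m := (r.2.1 + r.2.2) / 2 in
  if `[< small e (r.1, (r.2.1, m)) >] then (r.1, (m, r.2.2))
  else (r.1, (r.2.1, m)).

Let not_small_halfx e r : r.1.1 <= r.1.2 -> ~ small e r -> ~ small e (halfx e r).
Proof.
case: r => [[a b] [c d]] /= ab ns; rewrite /halfx /=.
set m := _ / 2; case: asboolP => // sl sr; apply: ns.
move: sl sr; rewrite /small /= => sl sr.
have am : a <= m by rewrite /m; lra.
have mb : m <= b by rewrite /m; lra.
have -> : flux a b c d = flux a m c d + flux m b c d.
  rewrite /flux (Rintegral_split (@vc d) am mb) (Rintegral_split (@vc c) am mb).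
  by ring.
apply: le_trans (ler_normD _ _) _; apply: le_trans (lerD sl sr) _.
by rewrite -mulrDl -mulrDr addrC addrA subrK.
Qed.

Let not_small_halfy e r : r.2.1 <= r.2.2 -> ~ small e r -> ~ small e (halfy e r).
Proof.
case: r => [[a b] [c d]] /= cd ns; rewrite /halfy /=.
set m := _ / 2; case: asboolP => // sl sr; apply: ns.
move: sl sr; rewrite /small /= => sl sr.
have cm : c <= m by rewrite /m; lra.
have md : m <= d by rewrite /m; lra.
have -> : flux a b c d = flux a b c m + flux a b m d.
  rewrite /flux (Rintegral_split (@uc b) cm md) (Rintegral_split (@uc a) cm md).
  by ring.
apply: le_trans (ler_normD _ _) _; apply: le_trans (lerD sl sr) _.
by rewrite -mulrDr [_ - c + _]addrC addrA subrK.
Qed.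

(** The affine parts share the coefficient [al], contribute [al] times the area to both differences
    and cancel. Only the remainders are left, and their cost is quadratic in the size of the
    rectangle. *)
Let flux_le (a b c d x y al be ga e : R) : a <= x <= b -> c <= y <= d ->
  0 <= e ->
  (forall s t, a <= s <= b -> c <= t <= d ->
     `|u s t - u x y - al * (s - x) - be * (t - y)| <= e * (b - a + (d - c)) /\
     `|v s t - v x y - ga * (s - x) - al * (t - y)| <= e * (b - a + (d - c))) ->
  `|flux a b c d| <= 2 * e * (b - a + (d - c)) ^+ 2.
Proof.
move=> xab ycd e0 H.
have ab : a <= b by lra.
have cd : c <= d by lra.
set L := b - a + (d - c) in H *.
have Hu : `|\int[mu]_(t in `[c, d]) (u b t - u a t) - al * (b - a) * (d - c)|
    <= 2 * e * L * (d - c).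
  apply: Rintegral_approx => // [t|t tcd].
    by apply: cvgB; exact: uc.
  have [|Hb _] := H b t _ tcd; first by lra.
  have [|Ha _] := H a t _ tcd; first by lra.
  by move: Ha Hb; rewrite !ler_norml; lra.
have Hv : `|\int[mu]_(s in `[a, b]) (v s d - v s c) - al * (d - c) * (b - a)|
    <= 2 * e * L * (b - a).
  apply: (@Rintegral_approx _ (fun s => v s d - v s c)) => // [t|t tcd].
    by apply: cvgB; exact: vc.
  have [|_ Hb] := H t d tcd; first by lra.
  have [|_ Ha] := H t c tcd; first by lra.
  by move: Ha Hb; rewrite !ler_norml; lra.
move: Hu Hv; rewrite !Rintegral_diff // -/(flux a b c d) /flux.
set p := \int[_]_(_ in _) _; set q := \int[_]_(_ in _) _.
set r := \int[_]_(_ in _) _; set w := \int[_]_(_ in _) _.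
have -> : 2 * e * L ^+ 2 = 2 * e * L * (d - c) + 2 * e * L * (b - a).
  by rewrite /L; ring.
by rewrite !ler_norml; lra.
Qed.

(* Pointwise differentiability together with the single equation
   [u_s = v_t] suffices: continuity of the partial derivatives is not assumed. *)
Lemma goursat (a b c d : R) : a < b -> c < d ->
  (forall x y, a <= x <= b -> c <= y <= d -> exists al be ga : R,
     forall e, 0 < e -> exists2 del : R, 0 < del & forall s t,
       a <= s <= b -> c <= t <= d -> `|s - x| < del -> `|t - y| < del ->
       `|u s t - u x y - al * (s - x) - be * (t - y)| <= e * (`|s - x| + `|t - y|)
       /\
       `|v s t - v x y - ga * (s - x) - al * (t - y)| <= e * (`|s - x| + `|t - y|)) ->
  \int[mu]_(t in `[c, d]) u b t - \int[mu]_(t in `[c, d]) u a t =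
  \int[mu]_(s in `[a, b]) v s d - \int[mu]_(s in `[a, b]) v s c.
Proof.
move=> ab cd H; apply/eqP; rewrite -subr_eq0 -/(flux a b c d) -normr_eq0.
rewrite eq_le normr_ge0 andbT; apply/ler_addgt0Pr => e0 e0p; rewrite add0r.
suff : small (e0 / ((b - a) * (d - c))) ((a, b), (c, d)).
  rewrite /small /= -mulrA divfK //.
  by rewrite mulf_neq0 // subr_eq0 gt_eqF.
set e := e0 / _.
have ep : 0 < e by rewrite divr_gt0 // mulr_gt0 // subr_gt0.
apply: contrapT => ns.
have [r [r0 rS]] : exists r, r 0%N = ((a, b), (c, d)) /\
    forall k, r k.+1 = halfy e (halfx e (r k)).
  by exists (fun k => iter k (fun r => halfy e (halfx e r)) ((a, b), (c, d))).
have inv k : [/\ (r k).1.2 - (r k).1.1 = (b - a) / 2 ^+ k,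
                 (r k).2.2 - (r k).2.1 = (d - c) / 2 ^+ k & ~ small e (r k)].
  elim: k => [|k [IH1 IH2 IH3]]; first by rewrite r0 expr0 !divr1.
  have p2 : 0 < (2 : R) ^+ k by apply: exprn_gt0.
  have h1 : (r k).1.1 <= (r k).1.2.
    by rewrite -subr_ge0 IH1 divr_ge0 ?subr_ge0 ?ltW.
  have h2 : (r k).2.1 <= (r k).2.2.
    by rewrite -subr_ge0 IH2 divr_ge0 ?subr_ge0 ?ltW.
  split.
  - rewrite rS /halfy; set m := halfx _ _.
    have -> z1 z2 (B : bool) : ((if B then (m.1, z1) else (m.1, z2)).1 : R * R) = m.1 by case: B.
    rewrite /m /halfx exprS invfM mulrCA -IH1; by case: ifP => _ /=; field.
  - rewrite rS /halfy.
    have -> : (halfx e (r k)).2 = (r k).2 by rewrite /halfx; case: ifP.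
    rewrite exprS invfM mulrCA -IH2; by case: ifP => _ /=; field.
  - rewrite rS; apply: not_small_halfy; last exact: not_small_halfx.
    by rewrite /halfx; case: ifP.
have len_le k : [/\ (r k).1.1 <= (r k).1.2 & (r k).2.1 <= (r k).2.2].
  have [i1 i2 _] := inv k; have p2 : 0 < (2 : R) ^+ k by apply: exprn_gt0.
  by split; rewrite -subr_ge0 ?i1 ?i2 divr_ge0 ?subr_ge0 ?ltW.
have mon k : [/\ (r k).1.1 <= (r k.+1).1.1, (r k.+1).1.2 <= (r k).1.2,
   (r k).2.1 <= (r k.+1).2.1 & (r k.+1).2.2 <= (r k).2.2].
  have [l1 l2] := len_le k.
  have [x1 x2] := midf_le l1; have [y1 y2] := midf_le l2.
  by rewrite rS /halfy /halfx; case: ifP => _; case: ifP => _ /=; split.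
have [x xP] := nested_segments (fun k => let: And4 p _ _ _ := mon k in p)
  (fun k => let: And4 _ p _ _ := mon k in p) (fun k => (len_le k).1).
have [y yP] := nested_segments (fun k => let: And4 _ _ p _ := mon k in p)
  (fun k => let: And4 _ _ _ p := mon k in p) (fun k => (len_le k).2).
have mono k : [/\ a <= (r k).1.1, (r k).1.2 <= b, c <= (r k).2.1 & (r k).2.2 <= d].
  elim: k => [|k [? ? ? ?]]; first by rewrite r0.
  have [? ? ? ?] := mon k.
  by split; [apply: le_trans; eassumption|apply: le_trans; eassumption|
    apply: le_trans; eassumption|apply: le_trans; eassumption].
have [||al [be [ga D]]] := H x y; first by have := xP 0%N; rewrite r0.
  by have := yP 0%N; rewrite r0.
pose L := b - a + (d - c).
have L0 : 0 < L by rewrite /L; lra.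
(* Every stage halves both sides, so the area and the square of the half-perimeter shrink by the
   same factor 4. One [e1] thus makes the bound of [flux_le] equal to [e] times the area at all
   stages. *)
pose e1 := e * (b - a) * (d - c) / (2 * L ^+ 2).
have e1p : 0 < e1.
  rewrite divr_gt0 //; last by rewrite mulr_gt0 // exprn_gt0.
  by apply: mulr_gt0; [apply: mulr_gt0|]; rewrite ?subr_gt0.
have [del del0 dP] := D _ e1p.
have [k kP] : exists k, L / 2 ^+ k < del.
  have [k kP] : exists k, L / del < k.+1%:R.
    exists (Num.bound (L / del)).
    by apply: lt_trans (archi_boundP (ltW (divr_gt0 L0 del0))) _; rewrite ltr_nat.
  exists k.+1; rewrite ltr_pdivrMr ?exprn_gt0 // mulrC -ltr_pdivrMr //.
  by apply: lt_le_trans kP _; rewrite -natrX ler_nat ltnW // ltn_expl.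
have [i1 i2 i3] := inv k; apply: i3; rewrite /small.
have [m1 m2 m3 m4] := mono k.
have p2 : 0 < (2 : R) ^+ k by apply: exprn_gt0.
have dba : 0 <= (b - a) / 2 ^+ k by rewrite divr_ge0 ?subr_ge0 ?ltW.
have ddc : 0 <= (d - c) / 2 ^+ k by rewrite divr_ge0 ?subr_ge0 ?ltW.
have dL : (b - a) / 2 ^+ k + (d - c) / 2 ^+ k < del by rewrite -mulrDl.
have xk := xP k; have yk := yP k.
apply: le_trans (@flux_le _ _ _ _ x y al be ga e1 xk yk (ltW e1p) _) _.
  move=> s t hs ht.
  have nsx := dist_segment hs xk.
  have nty := dist_segment ht yk.
  have hs' : a <= s <= b.
    by case/andP: hs => h1 h2; rewrite (le_trans m1 h1) (le_trans h2 m2).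
  have ht' : c <= t <= d.
    by case/andP: ht => h1 h2; rewrite (le_trans m3 h1) (le_trans h2 m4).
  have dba' : (r k).1.2 - (r k).1.1 < del.
    by apply: le_lt_trans dL; rewrite i1 lerDl.
  have ddc' : (r k).2.2 - (r k).2.1 < del.
    by apply: le_lt_trans dL; rewrite i2 lerDr.
  have [A B] := dP s t hs' ht' (le_lt_trans nsx dba') (le_lt_trans nty ddc').
  by split; [apply: le_trans A _|apply: le_trans B _];
    rewrite ler_pM2l // lerD.
rewrite i1 i2 -mulrDl -/L /e1 le_eqVlt; apply/orP; left; apply/eqP.
by field; rewrite !gt_eqF.
Qed.

End Goursat.

(** * Real-valued modulus on C, and complex derivatives as first-order expansions *)

Section Modulus.
Context {R : realType}.
Notation C := (Cplx R).
Implicit Types (z w : C) (r : R).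

Definition rc (r : R) : C := (r%:C)%C.

Lemma normE z : `|z| = rc (cmod z).
Proof. exact: normc_def. Qed.

Lemma rcD r s : rc (r + s) = rc r + rc s.
Proof. exact: (rmorphD (real_complex R)). Qed.
Lemma rcM r s : rc (r * s) = rc r * rc s.
Proof. exact: (rmorphM (real_complex R)). Qed.
Lemma rc_inj : injective rc. Proof. exact: complexI. Qed.
Lemma rc_le r s : (rc r <= rc s) = (r <= s). Proof. exact: lecR. Qed.
Lemma rc_lt r s : (rc r < rc s) = (r < s). Proof. exact: ltcR. Qed.
Lemma rc0 : rc 0 = 0. Proof. by []. Qed.
Lemma rc1 : rc 1 = 1. Proof. by []. Qed.

Lemma rc_pos z : 0 < z -> exists2 r : R, 0 < r & z = rc r.
Proof.
move=> z0; have /complex_realP [r zr] := gtr0_real z0.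
by exists r => //; rewrite -rc_lt /rc -zr.
Qed.

Lemma cmod_ge0 z : 0 <= cmod z. Proof. exact: sqrtr_ge0. Qed.
Lemma cmodM z w : cmod (z * w) = cmod z * cmod w.
Proof. by apply: rc_inj; rewrite rcM -!normE normrM. Qed.
Lemma cmodD z w : cmod (z + w) <= cmod z + cmod w.
Proof. by rewrite -rc_le rcD -!normE ler_normD. Qed.
Lemma cmodN z : cmod (- z) = cmod z.
Proof. by apply: rc_inj; rewrite -!normE normrN. Qed.
Lemma cmodBC z w : cmod (z - w) = cmod (w - z).
Proof. by rewrite -cmodN opprB. Qed.
Lemma cmodB z w : cmod (z - w) <= cmod z + cmod w.
Proof. by rewrite -(cmodN w) cmodD. Qed.
Lemma cmod0 : cmod (0 : C) = 0.
Proof. by apply: rc_inj; rewrite -normE normr0. Qed.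
Lemma cmod1 : cmod (1 : C) = 1.
Proof. by apply: rc_inj; rewrite -normE normr1. Qed.
Lemma cmod_eq0 z : (cmod z == 0) = (z == 0).
Proof. by rewrite -(inj_eq rc_inj) -normE normr_eq0. Qed.
Lemma cmod_gt0 z : (0 < cmod z) = (z != 0).
Proof. by rewrite lt_neqAle cmod_ge0 andbT eq_sym cmod_eq0. Qed.
Lemma cmodX z k : cmod (z ^+ k) = cmod z ^+ k.
Proof. by elim: k => [|k IH]; rewrite ?expr0 ?cmod1 // !exprS cmodM IH. Qed.
Lemma cmodV z : cmod z^-1 = (cmod z)^-1.
Proof.
have [->|z0] := eqVneq z 0; first by rewrite invr0 cmod0 invr0.
apply: (mulfI (x := cmod z)); first by rewrite cmod_eq0.
by rewrite -cmodM !divff ?cmod1 ?cmod_eq0.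
Qed.
Lemma cmod_rc r : cmod (rc r) = `|r|.
Proof. by rewrite /cmod /= expr0n addr0 sqrtr_sqr. Qed.
Lemma cmod_sqr z : cmod z ^+ 2 = complex.Re z ^+ 2 + complex.Im z ^+ 2.
Proof. by rewrite sqr_sqrtr // addr_ge0 // sqr_ge0. Qed.
Lemma Re_le_cmod z : `|complex.Re z| <= cmod z.
Proof. by rewrite -rc_le -normE; exact: normc_ge_Re. Qed.
Lemma Im_le_cmod z : `|complex.Im z| <= cmod z.
Proof.
by rewrite -sqrtr_sqr ler_sqrt ?lerDr ?sqr_ge0 // addr_ge0 // sqr_ge0.
Qed.
Lemma ReD z w : complex.Re (z + w) = complex.Re z + complex.Re w.
Proof. by case: z; case: w. Qed.
Lemma ImD z w : complex.Im (z + w) = complex.Im z + complex.Im w.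
Proof. by case: z; case: w. Qed.
Lemma ReN z : complex.Re (- z) = - complex.Re z. Proof. by case: z. Qed.
Lemma ImN z : complex.Im (- z) = - complex.Im z. Proof. by case: z. Qed.
Lemma ReB z w : complex.Re (z - w) = complex.Re z - complex.Re w.
Proof. by rewrite ReD ReN. Qed.
Lemma ImB z w : complex.Im (z - w) = complex.Im z - complex.Im w.
Proof. by rewrite ImD ImN. Qed.
Lemma ReM z w : complex.Re (z * w) =
  complex.Re z * complex.Re w - complex.Im z * complex.Im w.
Proof. by case: z; case: w. Qed.
Lemma ImM z w : complex.Im (z * w) =
  complex.Re z * complex.Im w + complex.Im z * complex.Re w.
Proof. by case: z; case: w => *. Qed.
Lemma Re_rc r : complex.Re (rc r) = r. Proof. by []. Qed.
Lemma Im_rc r : complex.Im (rc r) = 0. Proof. by []. Qed.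
Lemma cplx_eq z w :
  complex.Re z = complex.Re w -> complex.Im z = complex.Im w -> z = w.
Proof. by case: z => a b; case: w => c d /= -> ->. Qed.
Lemma cmod_leD z : cmod z <= `|complex.Re z| + `|complex.Im z|.
Proof.
rewrite -(@ler_pXn2r _ 2) ?nnegrE ?cmod_ge0 ?addr_ge0 //.
rewrite cmod_sqr sqrrD !real_normK ?num_real // addrAC lerDl.
by rewrite mulrn_wge0 // mulr_ge0.
Qed.
Lemma cmodBB z w : cmod z - cmod w <= cmod (z - w).
Proof. by rewrite lerBlDr -{1}(subrK w z) cmodD. Qed.

Definition cj z : C := (z^*)%C.
Lemma cmodJ z : cmod (cj z) = cmod z.
Proof. by rewrite /cmod; case: z => a b /=; rewrite sqrrN. Qed.
Lemma mulcj z : z * cj z = rc (cmod z ^+ 2).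
Proof.
apply: cplx_eq; rewrite ?ReM ?ImM cmod_sqr; case: z => a b /=.
  by ring.
by ring.
Qed.
Lemma cjB z w : cj (z - w) = cj z - cj w.
Proof. by case: z => a b; case: w => c d; apply: cplx_eq => //=; ring. Qed.
Lemma cjrc r : cj (rc r) = rc r. Proof. exact: conjc_real. Qed.
Lemma cjM z w : cj (z * w) = cj z * cj w.
Proof. by case: z => a b; case: w => c d; apply: cplx_eq => /=; ring. Qed.

Lemma nbhs_cplx z (A : set C) :
  nbhs z A <-> exists2 r : R, 0 < r & forall w, cmod (w - z) < r -> A w.
Proof.
split=> [/nbhs_ballP [e /= /rc_pos [r r0 ->] H]|[r r0 H]].
  by exists r => // w wz; apply: H; rewrite /ball /= normE rc_lt cmodBC.
apply/nbhs_ballP; exists (rc r); first by rewrite /= -rc0 rc_lt.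
by move=> w; rewrite /ball /= normE rc_lt cmodBC; exact: H.
Qed.

Lemma cont_cplx (T : topologicalType) (F : T -> C) (x : T) :
  {for x, continuous F} <->
  forall e, 0 < e -> \forall y \near x, cmod (F y - F x) < e.
Proof.
split=> [Fc e e0|H].
  by apply: (Fc [set w | cmod (w - F x) < e]); apply/nbhs_cplx; exists e.
move=> A /nbhs_cplx [e e0 eA]; apply: filterS (H e e0) => y; exact: eA.
Qed.

Lemma cont_real (T : topologicalType) (F : T -> R) (x : T) :
  {for x, continuous F} <->
  forall e, 0 < e -> \forall y \near x, `|F y - F x| < e.
Proof.
split=> [Fc e e0|H].
  apply: (Fc [set w | `|w - F x| < e]); apply/nbhs_ballP; exists e => //.
  by move=> w; rewrite /ball /= distrC.
move=> A /nbhs_ballP [e /= e0 eA]; apply: filterS (H e e0) => y yx; apply: eA.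
by rewrite /ball /= distrC.
Qed.

Lemma near_real (x : R) (A : set R) :
  nbhs x A <-> exists2 r : R, 0 < r & forall y, `|y - x| < r -> A y.
Proof.
split=> [/nbhs_ballP [e /= e0 H]|[r r0 H]].
  by exists e => // w wz; apply: H; rewrite /ball /= distrC.
by apply/nbhs_ballP; exists r => // w; rewrite /ball /= distrC; exact: H.
Qed.

Lemma cmod_continuous : continuous (@cmod R).
Proof.
move=> z; apply/cont_real => e e0; apply/nbhs_cplx; exists e => // w wz.
apply: le_lt_trans wz; rewrite ler_norml cmodBB andbT lerNl opprB.
by rewrite cmodBC cmodBB.
Qed.

Lemma Re_continuous : continuous (@complex.Re R : C -> R).
Proof.
move=> z; apply/cont_real => e e0; apply/nbhs_cplx; exists e => // w.
by rewrite -ReB; exact/le_lt_trans/Re_le_cmod.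
Qed.

(** Derivative in expansion form: with no quotient, the point [w = z] needs no separate treatment in
    chain rules and estimates. *)
Definition cdiff (F : C -> C) z (d : C) := forall e, 0 < e ->
  exists2 del : R, 0 < del & forall w, cmod (w - z) < del ->
    cmod (F w - F z - d * (w - z)) <= e * cmod (w - z).

Lemma is_derive_cdiff (F : C -> C) z d : is_derive z 1 F d <-> cdiff F z d.
Proof.
split=> [Fd e e0|H].
  have /cvg_ex [l Fl] := @ex_derive _ _ _ _ _ _ _ Fd.
  have {l Fl} : (fun h : C => h^-1 *: (F (h *: 1 + z) - F z)) @ 0^' --> d.
    by rewrite -(@derive_val _ _ _ _ _ _ _ Fd); exact: (@ex_derive _ _ _ _ _ _ _ Fd).
  move=> /(_ [set y | cmod (y - d) < e]) Q.
  have : nbhs d [set y | cmod (y - d) < e] by apply/nbhs_cplx; exists e.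
  move=> /Q; rewrite /nbhs /= /dnbhs /within /= => /nbhs_cplx [r r0 rP].
  exists r => // w wz; have [->|nwz] := eqVneq w z.
    by rewrite !subrr mulr0 subrr cmod0 mulr0.
  have wz0 : w - z != 0 by rewrite subr_eq0.
  have := rP (w - z); rewrite subr0 => /(_ wz wz0) /ltW.
  rewrite [(w - z) *: 1]mulr1 subrK => H.
  have -> : F w - F z - d * (w - z) =
     ((w - z)^-1 *: (F w - F z) - d) * (w - z).
    by rewrite mulrBl -[_ *: _]/(_ * _) mulrAC mulVf // mul1r.
  by rewrite cmodM ler_wpM2r // cmod_ge0.
have L : (fun h : C => h^-1 *: (F (h *: 1 + z) - F z)) @ 0^' --> d.
  move=> A /nbhs_cplx [e e0 eA].
  have [del del0 dP] := H (e / 2) (divr_gt0 e0 (ltr0n _ 2)).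
  rewrite /nbhs /= /dnbhs /within /=; apply/nbhs_cplx; exists del => // h.
  rewrite subr0 => hd h0; apply: eA.
  have := dP (h *: 1 + z); rewrite addrK [h *: 1]mulr1 => /(_ hd) {}dP.
  have -> : h^-1 *: (F (h + z) - F z) - d = h^-1 * (F (h + z) - F z - d * h).
    by rewrite [RHS]mulrBr [h^-1 * (d * h)]mulrC -mulrA divff ?mulr1.
  rewrite cmodM cmodV mulrC ltr_pdivrMr ?cmod_gt0 //.
  apply: le_lt_trans dP _; rewrite ltr_pM2r ?cmod_gt0 //; lra.
apply: DeriveDef; first by apply/cvg_ex; exists d.
exact: cvg_lim L.
Qed.

End Modulus.

(** * Logarithmic polar coordinates *)

Section Polar.
Context {R : realType}.
Notation C := (Cplx R).
Implicit Types (z w c : C) (s t x y r : R).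

Lemma is_derive_approx (f : R -> R) x d : is_derive x 1 f d ->
  forall e, 0 < e -> exists2 del : R, 0 < del & forall y, `|y - x| < del ->
    `|f y - f x - d * (y - x)| <= e * `|y - x|.
Proof.
move=> fd e e0.
have {fd} fl : (fun h : R => h^-1 *: (f (h *: 1 + x) - f x)) @ 0^' --> d.
  by rewrite -(@derive_val _ _ _ _ _ _ _ fd); exact: (@ex_derive _ _ _ _ _ _ _ fd).
have := fl [set y | `|y - d| < e].
have : nbhs d [set y | `|y - d| < e] by apply/near_real; exists e.
move=> nd /(_ nd); rewrite /nbhs /= /dnbhs /within /= => /near_real [r r0 rP].
exists r => // w wz; have [->|nwz] := eqVneq w x.
  by rewrite !subrr mulr0 subrr normr0 mulr0.
have wz0 : w - x != 0 by rewrite subr_eq0.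
have := rP (w - x); rewrite subr0 => /(_ wz wz0) /ltW.
rewrite [(w - x) *: 1]mulr1 subrK => H.
have -> : f w - f x - d * (w - x) =
    ((w - x)^-1 *: (f w - f x) - d) * (w - x).
  by rewrite mulrBl -[_ *: _]/(_ * _) mulrAC mulVf // mul1r.
by rewrite normrM ler_wpM2r.
Qed.

Lemma cdiff_continuous (F : C -> C) z d : cdiff F z d -> {for z, continuous F}.
Proof.
move=> Fd; apply/cont_cplx => e e0.
have [del del0 dP] := Fd 1 ltr01.
have k0 : 0 < cmod d + 1 + 1 by have := cmod_ge0 d; lra.
apply/nbhs_cplx; exists (Num.min del (e / (cmod d + 1 + 1))).
  by rewrite lt_min del0 divr_gt0.
move=> w; rewrite lt_min => /andP[/dP]; rewrite ltr_pdivlMr // mul1r.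
move=> h1; apply: le_lt_trans.
rewrite -[F w - F z](subrK (d * (w - z))); apply: le_trans (cmodD _ _) _.
apply: le_trans (lerD h1 (lexx _)) _; rewrite cmodM.
have := cmod_ge0 (w - z); lra.
Qed.

(** The complex exponential of [s + i t]. It turns an annulus into a rectangle, and the mean over a
    circle into an integral along a vertical side. *)
Definition polar s t : C := rc (expR s) * Complex (cos t) (sin t).

Lemma cmod_polar s t : cmod (polar s t) = expR s.
Proof.
rewrite cmodM cmod_rc gtr0_norm ?expR_gt0 //.
by rewrite /cmod /= cos2Dsin2 sqrtr1 mulr1.
Qed.

Lemma polarD x y s t : polar (x + s) (y + t) = polar x y * polar s t.
Proof.
rewrite /polar expRD rcM mulrACA; congr (_ * _).
by rewrite cosD sinD; apply: cplx_eq => /=; ring.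
Qed.

Lemma polar_small e : 0 < e -> exists2 del : R, 0 < del & forall h k,
  `|h| < del -> `|k| < del ->
  cmod (polar h k - 1 - Complex h k) <= e * (`|h| + `|k|).
Proof.
(* The three error terms cost [e1 |h|], [4 e1 |k|] and [e1 |k|]; hence the 5. *)
move=> e0; pose e1 := e / 5.
have e10 : 0 < e1 by rewrite /e1; lra.
have [d1 d10 d1P] := is_derive_approx (@is_derive_expR R 0) e10.
have [d2 d20 d2P] := is_derive_approx (@is_derive_cos R 0) e10.
have [d3 d30 d3P] := is_derive_approx (@is_derive_sin R 0) e10.
exists (Num.min (Num.min d1 d2) (Num.min d3 (Num.min e1 1))).
  by rewrite !lt_min d10 d20 d30 e10 ltr01.
move=> h k; rewrite !lt_min -!andbA => /and5P[h1 _ _ h4 h5].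
move=> /and5P[_ k2 k3 _ _].
move: (d1P h) (d2P k) (d3P k); rewrite !subr0 => /(_ h1) A /(_ k2) B /(_ k3) D.
move: A B D; rewrite expR0 cos0 sin0 oppr0 mul0r mul1r !subr0 mul1r addr0 => A B D.
have -> : polar h k - 1 - Complex h k =
  rc (expR h - 1 - h) * Complex (cos k) (sin k) +
  (rc (1 + h) * Complex (cos k - 1) (sin k - k) + Complex 0 (h * k)).
  by apply: cplx_eq; rewrite /polar /=; ring.
have c1 : cmod (rc (expR h - 1 - h) * Complex (cos k) (sin k)) <= e1 * `|h|.
  by rewrite cmodM cmod_rc /cmod /= cos2Dsin2 sqrtr1 mulr1.
have c2 : cmod (Complex 0 (h * k)) <= e1 * `|k|.
  rewrite /cmod /= expr0n add0r sqrtr_sqr normrM ler_wpM2r //; exact: ltW.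
have c3 : cmod (rc (1 + h) * Complex (cos k - 1) (sin k - k)) <=
    4 * e1 * `|k|.
  rewrite cmodM cmod_rc.
  have -> : 4 * e1 * `|k| = 2 * (e1 * `|k| + e1 * `|k|) by ring.
  apply: ler_pM => //; first exact: cmod_ge0.
    by apply: le_trans (ler_normD _ _) _; rewrite normr1; lra.
  apply: le_trans (cmod_leD _) _; exact: lerD.
apply: le_trans (cmodD _ _) _.
have := cmodD (rc (1 + h) * Complex (cos k - 1) (sin k - k)) (Complex 0 (h * k)).
have eh : 0 <= e * `|h| by rewrite mulr_ge0 // ltW.
have ek : 0 <= e * `|k| by rewrite mulr_ge0 // ltW.
by clear -c1 c2 c3 eh ek; rewrite /e1 in c1 c2 c3 *; lra.
Qed.

Lemma polar_diff x y e : 0 < e -> exists2 del : R, 0 < del & forall s t,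
  `|s - x| < del -> `|t - y| < del ->
  cmod (polar s t - polar x y - polar x y * Complex (s - x) (t - y)) <=
    e * (`|s - x| + `|t - y|).
Proof.
move=> e0; have x0 : 0 < expR x := expR_gt0 x.
have [del del0 dP] := polar_small (divr_gt0 e0 x0).
exists del => // s t hs ht; have H := dP _ _ hs ht.
have E : polar s t = polar x y * polar (s - x) (t - y).
  by rewrite -polarD ![_ + (_ - _)]addrC !subrK.
have -> : polar s t - polar x y - polar x y * Complex (s - x) (t - y) =
  polar x y * (polar (s - x) (t - y) - 1 - Complex (s - x) (t - y)).
  by rewrite E; ring.
rewrite cmodM cmod_polar; apply: le_trans (ler_wpM2l (ltW x0) H) _.
by rewrite mulrA mulrCA divff ?mulr1 // gt_eqF.
Qed.

Lemma polar_continuous x y e : 0 < e -> exists2 del : R, 0 < del & forall s t,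
  `|s - x| < del -> `|t - y| < del -> cmod (polar s t - polar x y) < e.
Proof.
move=> e0; have x0 : 0 < expR x := expR_gt0 x.
have [del del0 dP] := polar_diff x y ltr01.
pose K := 2 * (expR x + 1); have K0 : 0 < K by rewrite /K; lra.
exists (Num.min del (e / K)); first by rewrite lt_min del0 divr_gt0.
move=> s t; rewrite !lt_min !ltr_pdivlMr // => /andP[s1 s2] /andP[t1 t2].
have := dP _ _ s1 t1; set A := polar s t - polar x y.
set B := polar x y * _ => H.
rewrite -[A](subrK B); apply: le_lt_trans (cmodD _ _) _.
have : cmod B <= expR x * (`|s - x| + `|t - y|).
  by rewrite cmodM cmod_polar ler_wpM2l ?(ltW x0) // cmod_leD.
rewrite /K in s2 t2; lra.
Qed.

End Polar.

(** * Means over concentric circles *)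

Section Circle.
Context {R : realType}.
Notation C := (Cplx R).
Notation mu := (@lebesgue_measure R).
Variables (F : C -> C) (c : C) (r : R).
Hypothesis r0 : 0 < r.
Hypothesis Fd : forall z, z != c -> cmod (z - c) <= r -> exists d, cdiff F z d.
Hypothesis Fc : {for c, continuous F}.

(** Freezing [s] beyond [ln r] makes [H] continuous on the whole plane, as [goursat] demands,
    although [F] is controlled only on the disc; differentiability is used only for [s <= ln r]. *)
Let H s t := F (c + polar (Num.min s (ln r)) t).

Let ptP s t : c + polar (Num.min s (ln r)) t != c /\
  cmod (c + polar (Num.min s (ln r)) t - c) <= r.
Proof.
rewrite -subr_eq0 addrC addKr -cmod_eq0 cmod_polar gt_eqF ?expR_gt0 //.
by split=> //; rewrite -{2}(lnK r0) ler_expR ge_min lexx orbT.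
Qed.

Let H_cont s t e : 0 < e -> exists2 del : R, 0 < del & forall s' t',
  `|s' - s| < del -> `|t' - t| < del -> cmod (H s' t' - H s t) < e.
Proof.
move=> e0; have [n0 nr] := ptP s t; have [d /cdiff_continuous /cont_cplx] := Fd n0 nr.
move=> /(_ e e0) /nbhs_cplx [r1 r10 r1P].
have [del del0 dP] := polar_continuous (Num.min s (ln r)) t r10.
exists del => // s' t' hs ht; apply: r1P.
rewrite opprD addrACA subrr add0r; apply: dP => //; apply: le_lt_trans hs.
rewrite /Num.min; case: ltP => a; case: ltP => b; rewrite ?ler_norml;
  have := ler_norm (s' - s); have := ler_norm (- (s' - s)); rewrite normrN;
  rewrite ?subrr; lra.
Qed.

Let H_diff s t : s <= ln r -> exists w : C, forall e, 0 < e ->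
  exists2 del : R, 0 < del & forall s' t', s' <= ln r ->
  `|s' - s| < del -> `|t' - t| < del ->
  cmod (H s' t' - H s t - w * Complex (s' - s) (t' - t)) <=
    e * (`|s' - s| + `|t' - t|).
Proof.
move=> sr; have [n0 nr] := ptP s t; have [d] := Fd n0 nr.
rewrite min_l // => dP; exists (d * polar s t) => e e0.
pose P := polar s t.
pose e1 := e / (2 * (cmod P + 1)).
have P0 := cmod_ge0 P; have D0 := cmod_ge0 d.
have e10 : 0 < e1 by rewrite divr_gt0 // mulr_gt0 // ltr_wpDl.
have [d1 d10 d1P] := dP _ e10.
pose e2 := Num.min 1 (e / (2 * (cmod d + 1))).
have e20 : 0 < e2 by rewrite lt_min ltr01 divr_gt0 // mulr_gt0 // ltr_wpDl.
have [d2 d20 d2P] := polar_diff s t e20.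
have [d3 d30 d3P] := polar_continuous s t d10.
exists (Num.min d2 d3); first by rewrite lt_min d20.
move=> s' t' s'r; rewrite !lt_min => /andP[s2 s3] /andP[t2 t3].
rewrite /H !min_l //.
have := d1P (c + polar s' t'); rewrite opprD addrACA subrr add0r.
move=> /(_ (d3P _ _ s3 t3)); have := d2P _ _ s2 t2.
set N := `|s' - s| + `|t' - t|; set Q := polar s' t'; rewrite -/P.
set V := Complex _ _ => A B.
have N0 : 0 <= N by rewrite addr_ge0.
have VN : cmod V <= N by exact: cmod_leD.
have QP : cmod (Q - P) <= (cmod P + 1) * N.
  rewrite -[Q - P](subrK (P * V)); apply: le_trans (cmodD _ _) _.
  rewrite cmodM mulrDl mul1r addrC lerD ?ler_wpM2l //.
  apply: le_trans A _; rewrite ler_piMl // ge_min lexx //.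
have -> : F (c + Q) - F (c + P) - d * P * V =
  (F (c + Q) - F (c + P) - d * (Q - P)) + d * (Q - P - P * V) by ring.
apply: le_trans (cmodD _ _) _; rewrite cmodM.
have B' : cmod (F (c + Q) - F (c + P) - d * (Q - P)) <= e / 2 * N.
  apply: le_trans B _; apply: le_trans (ler_wpM2l (ltW e10) QP) _.
  rewrite mulrA ler_wpM2r // /e1 le_eqVlt; apply/orP; left; apply/eqP.
  by field; rewrite gt_eqF // ltr_wpDl.
have A' : cmod d * cmod (Q - P - P * V) <= e / 2 * N.
  have A2 : cmod (Q - P - P * V) <= e / (2 * (cmod d + 1)) * N.
    by apply: le_trans A _; rewrite ler_wpM2r // ge_min lexx orbT.
  apply: le_trans (ler_wpM2l D0 A2) _.
  rewrite mulrA ler_wpM2r //.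
  have d1p : 0 < cmod d + 1 by rewrite ltr_wpDl.
  have -> : cmod d * (e / (2 * (cmod d + 1))) = e / 2 * (cmod d / (cmod d + 1)).
    by field; rewrite gt_eqF.
  by rewrite ler_piMr ?divr_ge0 ?(ltW e0) // ler_pdivrMr // mul1r lerDl.
have -> : e * N = e / 2 * N + e / 2 * N by field.
exact: lerD.
Qed.

Let u s t := complex.Re (H s t).
Let v s t := complex.Im (H s t).

Let u_cont s : continuous (u s).
Proof.
move=> t; apply/cont_real => e e0; have [del del0 dP] := H_cont s t e0.
apply/near_real; exists del => // t' ht; rewrite -ReB.
by apply: le_lt_trans (Re_le_cmod _) _; apply: dP; rewrite // subrr normr0.
Qed.

Let v_cont t : continuous (v ^~ t).
Proof.
move=> s; apply/cont_real => e e0; have [del del0 dP] := H_cont s t e0.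
apply/near_real; exists del => // s' hs; rewrite -ImB.
by apply: le_lt_trans (Im_le_cmod _) _; apply: dP; rewrite // subrr normr0.
Qed.

Let mean_const a : a < ln r ->
  \int[mu]_(t in `[0, pi *+ 2]) u (ln r) t = \int[mu]_(t in `[0, pi *+ 2]) u a t.
Proof.
move=> ar; apply/eqP; rewrite -subr_eq0; apply/eqP.
rewrite (@goursat _ u v u_cont v_cont a (ln r) 0 (pi *+ 2)) //; last 2 first.
- by rewrite mulrn_wgt0 // pi_gt0.
- move=> x y /andP[ax xr] _; have [w wP] := H_diff y xr.
  exists (complex.Re w), (- complex.Im w), (complex.Im w) => e e0.
  have [del del0 dP] := wP _ e0; exists del => // s t /andP[_ sr] _ hs ht.
  have := dP _ _ sr hs ht; rewrite /u /v; set Q := _ - _ * _ => QP.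
  split; [have := Re_le_cmod Q|have := Im_le_cmod Q] => h;
    apply: le_trans (le_trans h QP); rewrite /Q.
    by rewrite ReB ReB ReM /= opprB addrA [X in _ <= `|X|]addrAC mulNr opprK.
  by rewrite ImB ImB ImM /= opprD addrA [X in _ <= `|X|]addrAC.
(* By periodicity in the angle the two horizontal sides cancel, leaving equality of the means. *)
rewrite (_ : v ^~ (pi *+ 2) = v ^~ 0) ?subrr //; apply/funext => s.
by rewrite /v /H /polar cos2pi sin2pi cos0 sin0.
Qed.

(* On the punctured disc the mean over circles does not depend on the radius;
   only continuity is needed at the centre, which makes the singularity there
   removable for the maximum principle. *)
Lemma circle_max :
  (forall z, cmod (z - c) = r -> complex.Re (F z) <= complex.Re (F c)) ->
  complex.Re (F (c + rc r)) = complex.Re (F c).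
Proof.
move=> Fle; pose m := complex.Re (F c).
have pi2 : 0 < (pi *+ 2 : R) by rewrite mulrn_wgt0 // pi_gt0.
have mean : \int[mu]_(t in `[0, pi *+ 2]) u (ln r) t = m * (pi *+ 2).
  apply/eqP; rewrite -subr_eq0 -normr_eq0 eq_le normr_ge0 andbT.
  apply/ler_addgt0Pr => e e0; rewrite add0r.
  have ep : 0 < e / (pi *+ 2) by rewrite divr_gt0.
  have /cont_cplx /(_ _ ep) /nbhs_cplx [d d0 dP] := Fc.
  (* The inner circle, of radius [expR a], lies in the disc where continuity at [c] keeps [F] within
     [e / (2 pi)] of [F c]. *)
  pose a := Num.min (ln r - 1) (ln d - 1).
  have ar : a < ln r by rewrite gt_min; apply/orP; left; rewrite gtrBl.
  have ad : expR a < d.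
    rewrite -[X in _ < X](lnK d0) ltr_expR gt_min; apply/orP; right; rewrite gtrBl //.
  rewrite (mean_const ar) -{2}[pi *+ 2]subr0.
  rewrite -[X in _ <= X](divfK (lt0r_neq0 pi2)) -{4}[pi *+ 2]subr0.
  apply: Rintegral_approx; rewrite ?(ltW pi2) // => t _.
  rewrite -ReB; apply: le_trans (Re_le_cmod _) _; apply/ltW/dP.
  by rewrite addrC addKr cmod_polar min_l // ltW.
have fc : continuous (fun t => m - u (ln r) t).
  by move=> t; apply: cvgB; [exact: cvg_cst|exact: u_cont].
have f0 t : 0 <= m - u (ln r) t.
  rewrite subr_ge0; apply: Fle.
  by rewrite addrC addKr cmod_polar min_l // lnK.
have := Rintegral_continuous_eq0 fc pi2 f0.
rewrite Rintegral_diff; [|exact: cst_continuous|exact: u_cont].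
rewrite mean Rintegral_cst_segment ?(ltW pi2) // subr0 subrr => /(_ erefl) /eqP.
rewrite subr_eq0 /u /H min_l // /polar cos0 sin0 lnK // => /eqP mE; rewrite -/m mE.
by congr (complex.Re (F (c + _))); rewrite -[Complex 1 0]/(1 : C) mulr1.
Qed.

End Circle.

(** * Maximum principle and Schwarz lemmas in one variable *)

Section MaximumModulus.
Context {R : realType}.
Notation C := (Cplx R).
Implicit Types (F G : C -> C) (z w c d a : C) (s t x y r : R) (K T : set C).

Lemma derivable_cdiff F z : derivable F z 1 <-> exists d, cdiff F z d.
Proof.
split=> [Fd|[d /is_derive_cdiff Fd]]; last exact: ex_derive.
by exists ('D_1 F z); apply/is_derive_cdiff; exact: derivableP.
Qed.

Lemma derivable_cont F z : derivable F z 1 -> {for z, continuous F}.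
Proof. by move=> /derivable_cdiff [d]; exact: cdiff_continuous. Qed.

Lemma derivableD_cst F z a : derivable F z 1 -> derivable (fun w => F w + a) z 1.
Proof. by move=> Fz; exact: (derivableD Fz (derivable_cst a z 1)). Qed.

Lemma derivableB_cst F z a : derivable F z 1 -> derivable (fun w => F w - a) z 1.
Proof. exact: derivableD_cst. Qed.

Lemma derivable_div F G z : derivable F z 1 -> derivable G z 1 -> G z != 0 ->
  derivable (fun w => F w / G w) z 1.
Proof. by move=> Fz Gz G0; exact: (derivableM Fz (derivableV G0 Gz)). Qed.

Arguments derivableD_cst {F z} a.
Arguments derivableB_cst {F z} a.

Lemma closed_disc_compact c r : compact [set z : C | cmod (z - c) <= r].
Proof.
pose f (p : R * R) : C := rc p.1 + Complex 0 p.2.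
have fc : continuous f.
  move=> p; apply/cont_cplx => e e0.
  have e20 : 0 < e / 2 by rewrite divr_gt0.
  apply/nbhs_ballP; exists (e / 2) => // q [] /=.
  rewrite /ball /= => h1 h2; rewrite /f.
  apply: le_lt_trans (cmod_leD _) _.
  rewrite ReB ImB !ReD !ImD /= !addr0 !add0r distrC [X in _ + X]distrC.
  by have := ltrD h1 h2; lra.
pose A := `[complex.Re c - r, complex.Re c + r]%classic `*`
          `[complex.Im c - r, complex.Im c + r]%classic.
have Ac : compact A by apply: compact_setX; exact: segment_compact.
have fAc : compact (f @` A).
  by apply: continuous_compact => //; exact: continuous_subspaceT.
apply: (subclosed_compact _ fAc).
  rewrite (_ : mkset _ = (fun z => cmod (z - c)) @^-1` [set x | x <= r]) //.
  apply: (continuous_closedP _).1 _ _ (@closed_le _ r) => z.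
  apply: continuous_comp; last exact: cmod_continuous.
  apply/cont_cplx => e e0; apply/nbhs_cplx; exists e => // w.
  by rewrite opprB addrA subrK.
move=> z /= zr; exists (complex.Re z, complex.Im z); last first.
  by apply: cplx_eq; rewrite /f ?ReD ?ImD /= ?addr0 ?add0r.
have := le_trans (Re_le_cmod _) zr; have := le_trans (Im_le_cmod _) zr.
by rewrite ReB ImB !ler_norml /A /= !in_itv /=; split; lra.
Qed.

(** Connectedness is avoided: among the points where [|F|] is maximal take [z2] with the largest
    real part. If [z2] were outside [T], [circle_max] would give another maximum point at
    [z2 + r / 2], further to the right. Differentiability may fail at the centre of each small disc,
    so divided differences are allowed. *)
Lemma max_modulus F K T z1 : compact K -> K z1 ->
  (forall z, K z -> {for z, continuous F}) ->
  (forall z, K z -> ~ T z -> exists2 r : R, 0 < r & forall w, cmod (w - z) < r ->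
     K w /\ (w != z -> derivable F w 1)) ->
  exists2 w, T w & cmod (F z1) <= cmod (F w).
Proof.
move=> Kc Kz1 Fc Fd.
have mc z : K z -> {for z, continuous (fun z => cmod (F z))}.
  by move=> /Fc Fcz; apply: continuous_comp Fcz _; exact: cmod_continuous.
have [m Km mP] : exists2 m, m \in K &
    forall w, w \in K -> cmod (F w) <= cmod (F m).
  apply: compact_EVT_max => //; first by exists z1.
  by apply: continuous_in_subspaceT => z /set_mem /mc.
pose E := [set z | K z /\ cmod (F m) <= cmod (F z)].
have Ec : compact E.
  apply: (subclosed_compact _ Kc); last by move=> z [].
  move=> z Ez.
  have Kz : K z.
    apply: (compact_closed _ Kc); first exact: norm_hausdorff.
    by move=> B /Ez [w [[Kw _] Bw]]; exists w.
  split=> //; rewrite leNgt; apply/negP => lt.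
  have /Ez [w [[_ h1]]] /= : nbhs z [set w | cmod (F w) < cmod (F m)].
    exact: (cvgr_lt _ (mc z Kz)).
  by rewrite ltNge h1.
have [z2 Ez2 z2P] : exists2 z, z \in E &
    forall w, w \in E -> complex.Re w <= complex.Re z.
  apply: compact_EVT_max => //.
    by exists m; split; [exact: set_mem|].
  by apply: continuous_subspaceT; exact: Re_continuous.
move: Ez2 => /set_mem [Kz2 mz2].
have [Tz2|nT] := pselect (T z2).
  by exists z2 => //; apply: le_trans (mP _ _) mz2; exact: mem_set.
have [r r0 rP] := Fd z2 Kz2 nT.
have r20 : 0 < r / 2 by rewrite divr_gt0.
(* This rotation turns a maximum of the modulus into a maximum of the real part, with
   [G z2 = |F z2|^2]. *)
pose G z := F z * cj (F z2).
have Gle w : cmod (w - z2) < r -> complex.Re (G w) <= cmod (F w) * cmod (F z2).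
  move=> wr; apply: le_trans (ler_norm _) _.
  by apply: le_trans (Re_le_cmod _) _; rewrite cmodM cmodJ.
have Gz2 : complex.Re (G z2) = cmod (F z2) * cmod (F z2).
  by rewrite /G mulcj Re_rc expr2.
have Kr : cmod (z2 + rc (r / 2) - z2) < r.
  by rewrite addrC addKr cmod_rc gtr0_norm //; lra.
have := @circle_max _ G z2 (r / 2) r20.
have Gd z : z != z2 -> cmod (z - z2) <= r / 2 -> exists d, cdiff G z d.
  move=> nz zr; apply/derivable_cdiff/derivableM; last exact: derivable_cst.
  by apply: (rP z _).2 => //; apply: le_lt_trans zr _; lra.
have Gc : {for z2, continuous G}.
  by apply: continuousM; [exact: Fc|exact: cst_continuous].
have Gm z : cmod (z - z2) = r / 2 -> complex.Re (G z) <= complex.Re (G z2).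
  move=> zr; have zr' : cmod (z - z2) < r by rewrite zr; lra.
  apply: le_trans (Gle _ zr') _; rewrite Gz2 ler_wpM2r ?cmod_ge0 //.
  by apply: le_trans (mP _ _) mz2; apply: mem_set; exact: (rP z zr').1.
move=> /(_ Gd Gc Gm) GE.
suff /mem_set /z2P : E (z2 + rc (r / 2)).
  by rewrite ReD Re_rc gerDl leNgt r20.
split; first exact: (rP _ Kr).1.
apply: le_trans mz2 _.
have [F0|F0] := eqVneq (cmod (F z2)) 0.
  by rewrite F0 cmod_ge0.
have := Gle _ Kr; rewrite GE Gz2 ler_pM2r //.
by rewrite lt_neqAle eq_sym F0 cmod_ge0.
Qed.

Definition slope F c d z := if z == c then d else (F z - F c) / (z - c).

Lemma slope_derivable F c d z : z != c -> derivable F z 1 ->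
  derivable (slope F c d) z 1.
Proof.
move=> zc Fz.
have E : \forall w \near z, (fun w => (F w - F c) * (w - c)^-1) w = slope F c d w.
  apply/nbhs_cplx; exists (cmod (z - c)); first by rewrite cmod_gt0 subr_eq0.
  move=> w wz; rewrite /slope; case: eqP => // wc; move: wz.
  by rewrite wc cmodBC ltxx.
have z0 : z - c != 0 by rewrite subr_eq0.
have D := derivable_div (derivableB_cst (F c) Fz)
  (derivableB_cst c (@derivable_id _ _ z 1)) z0.
exact: near_eq_derivable E D.
Qed.

Lemma slope_continuous F c d : cdiff F c d -> {for c, continuous (slope F c d)}.
Proof.
move=> Fd; apply/cont_cplx => e e0.
have [del del0 dP] := Fd _ (divr_gt0 e0 (ltr0n _ 2)).
apply/nbhs_cplx; exists del => // w wd; rewrite {2}/slope eqxx /slope.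
case: eqP => [_|/eqP wc]; first by rewrite subrr cmod0.
have wc0 : w - c != 0 by rewrite subr_eq0.
have -> : (F w - F c) / (w - c) - d = (F w - F c - d * (w - c)) / (w - c).
  by field.
rewrite cmodM cmodV ltr_pdivrMr ?cmod_gt0 //.
apply: le_lt_trans (dP w wd) _; rewrite ltr_pM2r ?cmod_gt0 //; lra.
Qed.

Lemma ler_open_limit (t r X Y : R) : t < r -> 0 <= X ->
  (forall s, t < s < r -> s * X <= Y) -> r * X <= Y.
Proof.
move=> tr X0 H; rewrite leNgt; apply/negP => YX.
have Xp : 0 < X.
  rewrite lt_neqAle X0 andbT; apply/eqP => X00; move: YX.
  have := H ((t + r) / 2); rewrite -X00 !mulr0 => h h'.
  by have := h _; rewrite leNgt h' => /(_ _)/negP; apply; lra.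
pose s := Num.max ((t + r) / 2) ((Y / X + r) / 2).
have Yr : Y / X < r by rewrite ltr_pdivrMr.
have ts : t < s < r by rewrite lt_max gt_max; apply/and3P; split; lra.
have := H _ ts; rewrite -ler_pdivlMr // leNgt lt_max; case/negP.
by apply/orP; right; lra.
Qed.

(** The divided difference at [c] is at most [B / s] on the circle of radius [s < r], hence inside
    it by the maximum principle; then [s] tends to [r]. *)
Lemma schwarz F c r B : 0 < r ->
  (forall z, cmod (z - c) < r -> derivable F z 1) ->
  (forall z, cmod (z - c) < r -> cmod (F z - F c) <= B) ->
  forall z, cmod (z - c) < r -> r * cmod (F z - F c) <= B * cmod (z - c).
Proof.
move=> r0 Fd FB z zr.
have [->|zc] := eqVneq z c; first by rewrite !subrr cmod0 !mulr0.
have cr : cmod (c - c) < r by rewrite subrr cmod0.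
have zc0 : 0 < cmod (z - c) by rewrite cmod_gt0 subr_eq0.
apply: (ler_open_limit zr (cmod_ge0 _)) => s /andP[zs sr].
have [d dP] := (derivable_cdiff F c).1 (Fd _ cr).
have s0 : 0 < s by apply: lt_trans zs.
have [|w Kw|w /= Kw /eqP Tw|w /= wT] := @max_modulus (slope F c d)
  [set w | cmod (w - c) <= s] [set w | cmod (w - c) = s] z
  (@closed_disc_compact c s).
- exact: ltW.
- have [->|wc] := eqVneq w c; first exact: slope_continuous.
  by apply/derivable_cont/slope_derivable => //; apply: Fd; exact: le_lt_trans sr.
- have ws : cmod (w - c) < s by rewrite lt_neqAle Tw.
  have [wc|wc] := eqVneq w c.
    exists s => // x; rewrite wc => xs; split; first exact: ltW.
    by move=> xc; apply: slope_derivable => //; apply: Fd; exact: lt_trans sr.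
  pose q := Num.min (s - cmod (w - c)) (cmod (w - c)).
  exists q; first by rewrite lt_min subr_gt0 ws cmod_gt0 subr_eq0.
  move=> x; rewrite lt_min => /andP[h1 h2].
  have xs : cmod (x - c) < s.
    have -> : x - c = (x - w) + (w - c) by rewrite addrA subrK.
    by apply: le_lt_trans (cmodD _ _) _; rewrite -ltrBrDr.
  split; first exact: ltW.
  move=> _; apply: slope_derivable; last by apply: Fd; exact: lt_trans sr.
  by apply/eqP => xc; move: h2; rewrite xc cmodBC ltxx.
rewrite /slope (negbTE zc) -(subr_eq0 w) -cmod_eq0 wT gt_eqF //.
rewrite !cmodM !cmodV wT ler_pdivrMr // mulrAC ler_pdivlMr // mulrC => h.
apply: le_trans h _; rewrite ler_wpM2r ?cmod_ge0 // FB //.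
by rewrite wT.
Qed.

Lemma cdiff_bound F c d L del : cdiff F c d -> 0 < del ->
  (forall z, cmod (z - c) < del -> cmod (F z - F c) <= L * cmod (z - c)) ->
  cmod d <= L.
Proof.
move=> Fd del0 H; apply/ler_addgt0Pr => e e0.
have [d1 d10 d1P] := Fd e e0.
pose h := Num.min del d1 / 2.
have m0 : 0 < Num.min del d1 by rewrite lt_min del0.
have h0 : 0 < h by rewrite divr_gt0.
have E : cmod (c + rc h - c) = h by rewrite addrC addKr cmod_rc gtr0_norm.
have hm : h < Num.min del d1 by rewrite /h; lra.
move: (hm); rewrite lt_min => /andP[hd hd1].
have := H (c + rc h); have := d1P (c + rc h); rewrite E => /(_ hd1) A /(_ hd) B.
rewrite -(ler_pM2r h0) mulrDl.
have -> : cmod d * h = cmod (F (c + rc h) - F c -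
    (F (c + rc h) - F c - d * (c + rc h - c))).
  by rewrite opprB addrCA subrr addr0 cmodM E.
exact: le_trans (cmodB _ _) (lerD B A).
Qed.

(** With [a = F c], the Cayley transform [(F - a) / (F + cj a)] maps into the unit disc and vanishes
    at [c]. Schwarz gives [r |F z - a| <= |F z + cj a| |z - c|], and the first factor on the right
    tends to [2 Re a] as [z] tends to [c]. *)
Lemma half_plane_schwarz F c r d : 0 < r ->
  (forall z, cmod (z - c) < r -> derivable F z 1) ->
  (forall z, cmod (z - c) < r -> 0 < complex.Re (F z)) ->
  cdiff F c d -> r * cmod d <= 2 * complex.Re (F c).
Proof.
move=> r0 Fd Fp dP; set a := F c.
have cr : cmod (c - c) < r by rewrite subrr cmod0.
have a0 : 0 < complex.Re a by exact: Fp.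
have n0 z : cmod (z - c) < r -> F z + cj a != 0.
  move=> /Fp Fz; apply/eqP => /(congr1 (@complex.Re R)); rewrite ReD.
  have -> : complex.Re (cj a) = complex.Re a by case: (a).
  by rewrite /=; lra.
pose G z := (F z - a) / (F z + cj a).
have Gd z : cmod (z - c) < r -> derivable G z 1.
  move=> zr; apply: derivable_div; last exact: n0.
    exact/derivableB_cst/Fd.
  exact/derivableD_cst/Fd.
have Gc : G c = 0 by rewrite /G subrr mul0r.
have GB z : cmod (z - c) < r -> cmod (G z - G c) <= 1.
  move=> zr; rewrite Gc subr0 cmodM cmodV ler_pdivrMr ?cmod_gt0 ?n0 // mul1r.
  rewrite -(@ler_pXn2r _ 2) ?nnegrE ?cmod_ge0 // !cmod_sqr.
  move: (Fp _ zr) a0; rewrite ReB ReD ImB ImD; case: (F z) => x y; case: (a) => u v.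
  rewrite /= => x0 u0; have : 0 < x * u by exact: mulr_gt0.
  lra.
have GS := schwarz r0 Gd GB.
apply/ler_addgt0Pr => e e0.
have Fc : {for c, continuous F} := cdiff_continuous dP.
have /nbhs_cplx [q q0 qP] := (cont_cplx F c).1 Fc e e0.
have -> : r * cmod d = cmod d * r by rewrite mulrC.
rewrite -ler_pdivlMr //.
apply: (@cdiff_bound F c d _ (Num.min q r) dP); first by rewrite lt_min q0.
move=> z; rewrite lt_min => /andP[zq zr].
rewrite mulrAC ler_pdivlMr // -/a.
have := GS z zr; rewrite Gc subr0 mul1r cmodM cmodV mulrA.
rewrite ler_pdivrMr ?cmod_gt0 ?n0 // mulrC => h; apply: le_trans h _.
rewrite mulrC ler_wpM2r ?cmod_ge0 //.
have -> : F z + cj a = (F z - a) + rc (2 * complex.Re a).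
  by case: (F z) => x y; case: (a) => u v; apply: cplx_eq => /=; ring.
apply: le_trans (cmodD _ _) _; rewrite cmod_rc ger0_norm ?mulr_ge0 ?(ltW a0) //.
by rewrite addrC lerD2l ltW // qP.
Qed.

End MaximumModulus.

(** * Hermitian product, Euclidean norm and topology of C^n *)

Section HermitianSpace.
Context {R : realType} {n : nat}.
Notation C := (Cplx R).
Notation V := (Cn R n).
Implicit Types (z w a b : V) (k : C) (r s t : R).

(** Linear in the first argument, so that a fixed normal [a] gives a holomorphic functional. *)
Definition hdot z a : C := \sum_(j < n) z ord0 j * cj (a ord0 j).

Lemma hdotD z w a : hdot (z + w) a = hdot z a + hdot w a.
Proof. by rewrite -big_split; apply: eq_bigr => j _; rewrite mxE mulrDl. Qed.

Lemma hdotZ k z a : hdot (k *: z) a = k * hdot z a.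
Proof. by rewrite /hdot mulr_sumr; apply: eq_bigr => j _; rewrite mxE mulrA. Qed.

Lemma hdotN z a : hdot (- z) a = - hdot z a.
Proof. by rewrite -scaleN1r hdotZ mulN1r. Qed.

Lemma hdotB z w a : hdot (z - w) a = hdot z a - hdot w a.
Proof. by rewrite hdotD hdotN. Qed.

Lemma hdot0 a : hdot 0 a = 0.
Proof. by rewrite -(scale0r 0) hdotZ mul0r. Qed.

Lemma hdot_cj z a : cj (hdot z a) = hdot a z.
Proof.
have cjD : {morph @cj R : x y / x + y} by case=> x y [u v]; rewrite /cj /= opprD.
have cj0 : cj (0 : C) = 0 by apply: cplx_eq => //=; rewrite oppr0.
rewrite /hdot (big_morph _ cjD cj0); apply: eq_bigr => j _.
by rewrite cjM mulrC /cj conjcK.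
Qed.

Lemma hdotZr k z a : hdot z (k *: a) = cj k * hdot z a.
Proof. by rewrite -hdot_cj hdotZ cjM hdot_cj. Qed.

Lemma hdotBr z a b : hdot z (a - b) = hdot z a - hdot z b.
Proof. by rewrite -hdot_cj hdotB cjB !hdot_cj. Qed.

Lemma enorm_ge0 z : 0 <= enorm z. Proof. exact: sqrtr_ge0. Qed.

Lemma enorm_sqr z : enorm z ^+ 2 = \sum_(j < n) cmod (z ord0 j) ^+ 2.
Proof. by rewrite sqr_sqrtr // sumr_ge0 // => j _; rewrite sqr_ge0. Qed.

Lemma hdotzz z : hdot z z = rc (enorm z ^+ 2).
Proof.
rewrite enorm_sqr /rc (rmorph_sum (real_complex R)).
by apply: eq_bigr => j _; rewrite mulcj.
Qed.

Lemma coord_le_enorm z j : cmod (z ord0 j) <= enorm z.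
Proof.
rewrite -(@ler_pXn2r _ 2) ?nnegrE ?cmod_ge0 ?enorm_ge0 // enorm_sqr.
by rewrite (bigD1 j) //= lerDl sumr_ge0 // => i _; rewrite sqr_ge0.
Qed.

Lemma enorm_eq0 z : (enorm z == 0) = (z == 0).
Proof.
apply/eqP/eqP => [z0|->].
  apply/rowP => j; rewrite mxE; apply/eqP; rewrite -cmod_eq0 eq_le cmod_ge0 andbT.
  by rewrite -z0 coord_le_enorm.
rewrite /enorm big1 ?sqrtr0 // => j _; by rewrite mxE cmod0 expr0n.
Qed.

Lemma enorm0 : enorm (0 : V) = 0. Proof. by apply/eqP; rewrite enorm_eq0. Qed.

Lemma enorm_gt0 z : (0 < enorm z) = (z != 0).
Proof. by rewrite lt_neqAle enorm_ge0 andbT eq_sym enorm_eq0. Qed.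

Lemma enormZ k z : enorm (k *: z) = cmod k * enorm z.
Proof.
apply/eqP; rewrite -(@eqrXn2 _ 2) ?mulr_ge0 ?cmod_ge0 ?enorm_ge0 //.
rewrite exprMn !enorm_sqr mulr_sumr; apply/eqP/eq_bigr => j _.
by rewrite mxE cmodM exprMn.
Qed.

Lemma enormN z : enorm (- z) = enorm z.
Proof. by rewrite -scaleN1r enormZ cmodN cmod1 mul1r. Qed.

Lemma enormBC z w : enorm (z - w) = enorm (w - z).
Proof. by rewrite -enormN opprB. Qed.

Lemma hdot_le z a : cmod (hdot z a) <= enorm z * enorm a.
Proof.
have [->|a0] := eqVneq a 0.
  by rewrite -hdot_cj hdot0 cmodJ cmod0 mulr_ge0 ?enorm_ge0.
(* Coefficient of the orthogonal projection onto [a]; Cauchy-Schwarz is the nonnegativity of the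
   squared norm of [z - k *: a]. *)
pose k := hdot z a / rc (enorm a ^+ 2).
have na0 : rc (enorm a ^+ 2) != 0.
  by rewrite -rc0 (inj_eq rc_inj) expf_neq0 // enorm_eq0.
have E : hdot (z - k *: a) (z - k *: a) =
    rc (enorm z ^+ 2) - hdot z a * cj (hdot z a) / rc (enorm a ^+ 2).
  rewrite hdotB !hdotBr !hdotZ !hdotZr !hdotzz -(hdot_cj z a).
  have -> : cj k = cj (hdot z a) / rc (enorm a ^+ 2).
    rewrite /k cjM; congr (_ * _); rewrite /cj conjc_inv.
    by rewrite -/(cj _) cjrc.
  by rewrite /k; move: (rc (enorm a ^+ 2)) na0 => N N0; field.
have := hdotzz (z - k *: a); rewrite E mulcj => /(congr1 (fun z : C => z * rc (enorm a ^+ 2))).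
rewrite mulrBl divfK // -!rcM => /(congr1 (@complex.Re R)); rewrite ReB !Re_rc => H.
rewrite -(@ler_pXn2r _ 2) ?nnegrE ?mulr_ge0 ?cmod_ge0 ?enorm_ge0 //.
by rewrite exprMn -subr_ge0 H mulr_ge0 // sqr_ge0.
Qed.

Lemma enormD_sqr z w :
  enorm (z + w) ^+ 2 = enorm z ^+ 2 + 2 * complex.Re (hdot z w) + enorm w ^+ 2.
Proof.
have := hdotzz (z + w); rewrite hdotD -(hdot_cj _ z) -(hdot_cj _ w) !hdotD.
rewrite -[hdot w z]hdot_cj !hdotzz => /(congr1 (@complex.Re R)).
rewrite [RHS]Re_rc => <-.
case: (hdot z w) => x y; rewrite ReD /=; ring.
Qed.

Lemma enormD z w : enorm (z + w) <= enorm z + enorm w.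
Proof.
rewrite -(@ler_pXn2r _ 2) ?nnegrE ?addr_ge0 ?enorm_ge0 //.
have := le_trans (ler_norm _) (le_trans (Re_le_cmod _) (hdot_le z w)).
by rewrite enormD_sqr; nra.
Qed.

Lemma enorm_triangle w z a : enorm (z - a) <= enorm (z - w) + enorm (w - a).
Proof. by rewrite -{1}(subrK w z) -addrA enormD. Qed.

Lemma enormBB z w : `|enorm z - enorm w| <= enorm (z - w).
Proof.
have h1 := enormD (z - w) w; have h2 := enormD (w - z) z.
by move: h1 h2; rewrite !subrK (enormBC w) ler_norml; lra.
Qed.

Lemma enorm_le_sum z : enorm z <= \sum_(j < n) cmod (z ord0 j).
Proof.
have S0 : 0 <= \sum_(j < n) cmod (z ord0 j).
  by apply: sumr_ge0 => j _; exact: cmod_ge0.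
rewrite -(@ler_pXn2r _ 2) ?nnegrE ?enorm_ge0 // enorm_sqr.
rewrite [X in _ <= X]expr2 mulr_suml; apply: ler_sum => j _.
rewrite expr2 ler_wpM2l ?cmod_ge0 // (bigD1 j) //= lerDl.
by apply: sumr_ge0 => i _; exact: cmod_ge0.
Qed.

Lemma nbhs_Cn z (A : set V) :
  nbhs z A <-> exists2 r : R, 0 < r & forall w, enorm (w - z) < r -> A w.
Proof.
split=> [/nbhs_ballP [e /= e0 H]|[r r0 H]].
  have [r r0 er] := rc_pos e0.
  exists r => // w wz; apply: H; split=> // i j.
  rewrite ord1 er /ball /= normE rc_lt; apply: le_lt_trans wz.
  by have := coord_le_enorm (w - z) j; rewrite !mxE cmodBC.
(* The successor covers [n = 0] and makes the sum of the [n] coordinate bounds strictly less than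
   [r]. *)
pose e := r / n.+1%:R; have e0 : 0 < e by rewrite divr_gt0.
apply/nbhs_ballP; exists (rc e); first by rewrite /= -rc0 rc_lt.
move=> w [_ H2]; apply: H; apply: le_lt_trans (enorm_le_sum _) _.
apply: (@le_lt_trans _ _ (\sum_(j < n) e)).
  apply: ler_sum => j _; have := H2 ord0 j; rewrite /ball /= normE rc_lt !mxE.
  by rewrite cmodBC => /ltW.
rewrite sumr_const card_ord -mulr_natr /e mulrAC ltr_pdivrMr //.
by rewrite ltr_pM2l // ltr_nat.
Qed.

Lemma cont_Cn (T : topologicalType) (F : T -> V) (x : T) :
  {for x, continuous F} <->
  forall e : R, 0 < e -> \forall y \near x, enorm (F y - F x) < e.
Proof.
split=> [Fc e e0|H].
  by apply: (Fc [set w | enorm (w - F x) < e]); apply/nbhs_Cn; exists e.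
move=> A /nbhs_Cn [e e0 eA]; apply: filterS (H e e0) => y; exact: eA.
Qed.

Lemma enorm_continuous : continuous (@enorm R n).
Proof.
move=> z; apply/cont_real => e e0; apply/nbhs_Cn; exists e => // w.
exact/le_lt_trans/enormBB.
Qed.

Lemma closed_ball_enorm_closed z r : closed [set w : V | enorm (w - z) <= r].
Proof.
rewrite (_ : mkset _ = (fun w => enorm (w - z)) @^-1` [set x | x <= r]) //.
apply: (continuous_closedP _).1 _ _ (@closed_le _ r) => w.
apply/cont_real => e e0; apply/nbhs_Cn; exists e => // v vw.
apply: le_lt_trans (enormBB _ _) _; by rewrite opprB addrA subrK.
Qed.

Lemma closed_ball_enorm_compact z r : compact [set w : V | enorm (w - z) <= r].
Proof.
have Kc : compact [set w : V | forall j, cmod (w ord0 j - z ord0 j) <= r].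
  apply: (@rV_compact C n (fun j => [set x : C | cmod (x - z ord0 j) <= r])).
  by move=> j; exact: closed_disc_compact.
apply: (subclosed_compact _ Kc); first exact: closed_ball_enorm_closed.
move=> w /= wr j; apply: le_trans wr.
by have := coord_le_enorm (w - z) j; rewrite !mxE.
Qed.

Lemma differentiable_hdot (T : normedModType C) (F : T -> V) (x : T) b a :
  differentiable F x -> differentiable (fun y => hdot (F y - b) a) x.
Proof.
move=> Fx.
have -> : (fun y => hdot (F y - b) a) = \sum_(j < n)
    (fun y => (F y - b) ord0 j * cj (a ord0 j)).
  by apply/funext => y; rewrite fct_sumE.
apply: differentiable_sum => j.
apply: differentiableM; last exact: differentiable_cst.
have Fb : differentiable (fun y => F y - b) x.
  by apply: differentiableB => //; exact: differentiable_cst.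
exact: (differentiable_comp Fb (differentiable_coord _ _ _)).
Qed.

End HermitianSpace.

(** * Complex differentials measured in the Euclidean norm *)

Section Differential.
Context {R : realType} {n : nat}.
Notation C := (Cplx R).
Notation V := (Cn R n).
Implicit Types (y v w : V) (f : V -> C).

Lemma mx_norm_le_enorm v : `|v| <= rc (enorm v) :> C.
Proof.
rewrite -[`|v|]/(mx_norm v); have [->|v0] := eqVneq (mx_norm v) 0.
  by rewrite -rc0 rc_le enorm_ge0.
have [[i j] ->] := mx_norm_neq0 v0.
by rewrite /= ord1 normE rc_le coord_le_enorm.
Qed.

Lemma differentiable_approx f y : differentiable f y ->
  forall e : R, 0 < e -> exists2 del : R, 0 < del & forall w,
    enorm (w - y) < del ->
    cmod (f w - f y - 'd f y (w - y)) <= e * enorm (w - y).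
Proof.
move=> df e e0; have [_ /eqaddoP H] := (diff_locallyP _ _).1 df.
have ec : (0 : C) < rc e by rewrite -rc0 rc_lt.
have /nbhs_Cn [del del0 dP] := H _ ec.
exists del => // w wy; have := dP (w - y); rewrite subr0 => /(_ wy) {}dP.
rewrite -rc_le -normE.
have -> : f w - f y - 'd f y (w - y) =
    (f \o shift y - (cst (f y) + 'd f y)) (w - y).
  by rewrite !fctE /= subrK opprD addrA.
apply: le_trans dP _; rewrite rcM ler_wpM2l ?mx_norm_le_enorm //.
exact: ltW.
Qed.

Lemma diffvB f y v w : 'd f y (v - w) = 'd f y v - 'd f y w.
Proof. exact: raddfB. Qed.

Lemma diffvZ f y (k : C) v : 'd f y (k *: v) = k * 'd f y v.
Proof. exact: linearZ. Qed.

Lemma diffv0 f y : 'd f y 0 = 0.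
Proof. exact: raddf0. Qed.

(** Restriction to a complex line; it reduces bounds on differentials to one-variable Schwarz
    estimates. *)
Lemma diff_line f y v : differentiable f y ->
  cdiff (fun z : C => f (y + z *: v)) 0 ('d f y v).
Proof.
move=> df e e0; have e1 : 0 < e / (enorm v + 1).
  by rewrite divr_gt0 // ltr_wpDl // enorm_ge0.
have [del del0 dP] := differentiable_approx df e1.
have v1 : 0 < enorm v + 1 by rewrite ltr_wpDl // enorm_ge0.
exists (del / (enorm v + 1)); first by rewrite divr_gt0.
move=> w; rewrite subr0 ltr_pdivlMr // => wd.
rewrite scale0r addr0.
have wv : cmod w * enorm v <= cmod w * (enorm v + 1).
  by rewrite ler_wpM2l ?cmod_ge0 // lerDl.
have := dP (y + w *: v); rewrite addrC addKr enormZ => /(_ (le_lt_trans wv wd)).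
have -> : 'd f y (w *: v) = 'd f y v * w by rewrite diffvZ mulrC.
move=> h; apply: le_trans h _.
by rewrite -mulrA ler_wpM2l ?(ltW e0) // mulrC ler_pdivrMr.
Qed.

End Differential.

(** * Cauchy-type estimates and continuity of the differential *)

Section CauchyEstimates.
Context {R : realType} {n : nat}.
Notation C := (Cplx R).
Notation V := (Cn R n).
Implicit Types (y v w : V) (f : V -> C).

Lemma line_derivable f y v (z : C) : differentiable f (y + z *: v) ->
  derivable (fun z : C => f (y + z *: v)) z 1.
Proof.
move=> df; apply/derivable1_diffP.
have dl : differentiable (fun z : C => y + z *: v) z.
  apply: differentiableD; first exact: differentiable_cst.
  by apply: (@differentiableZl _ C V (id : C -> C) v z).
exact: (differentiable_comp dl df).
Qed.

(** Schwarz on the complex line through [y] and [w]: the oscillation is at most [2 B] on a disc of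
    radius [r / 2], whence the constant [4 B / r]. *)
Lemma bounded_lipschitz f y0 (r B : R) : 0 < r ->
  (forall y, enorm (y - y0) < r -> differentiable f y) ->
  (forall y, enorm (y - y0) < r -> cmod (f y) <= B) ->
  forall y w, enorm (y - y0) < r / 2 -> enorm (w - y) < r / 2 ->
  cmod (f w - f y) <= 4 * B / r * enorm (w - y).
Proof.
move=> r0 df fB y w yr wr.
have [->|wy] := eqVneq w y; first by rewrite !subrr enorm0 cmod0 mulr0.
have N0 : 0 < enorm (w - y) by rewrite enorm_gt0 subr_eq0.
set N := enorm (w - y) in N0 wr *.
pose e := rc N^-1 *: (w - y).
have e1 : enorm e = 1.
  by rewrite enormZ cmod_rc gtr0_norm ?invr_gt0 // mulVf // gt_eqF.
have in_ball (z : C) : cmod z < r / 2 -> enorm (y + z *: e - y0) < r.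
  move=> zr; rewrite addrAC; apply: le_lt_trans (enormD _ _) _.
  by rewrite enormZ e1; lra.
have := @schwarz R (fun z : C => f (y + z *: e)) 0 (r / 2) (B + B).
rewrite divr_gt0 // => /(_ isT).
have d1 (z : C) : cmod (z - 0) < r / 2 -> derivable (fun z : C => f (y + z *: e)) z 1.
  by rewrite subr0 => zr; apply/line_derivable/df/in_ball.
have d2 (z : C) : cmod (z - 0) < r / 2 -> cmod (f (y + z *: e) - f (y + 0 *: e)) <= B + B.
  rewrite subr0 => zr; apply: le_trans (cmodB _ _) _.
  by rewrite lerD // fB // in_ball // cmod0 divr_gt0.
move=> /(_ d1 d2 (rc N)); rewrite subr0 cmod_rc gtr0_norm // => /(_ wr).
rewrite scale0r addr0 /e scalerA -rcM divff ?gt_eqF // rc1 scale1r [y + _]addrC subrK.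
move=> h; have -> : 4 * B / r * N = (r / 2)^-1 * ((B + B) * N).
  by field; rewrite gt_eqF.
by rewrite -ler_pdivrMl ?invr_gt0 ?divr_gt0 // invrK.
Qed.

(** The bound [L] on the differential handles the change of [v]. For the change of [y], the
    difference of the restrictions of [f] to the parallel lines through [y] and [y0] in direction
    [v0] is at most [L |y - y0|], so Schwarz bounds its derivative at 0 by a multiple of
    [|y - y0|]. *)
Lemma differential_continuous f y0 v0 :
  (\forall y \near y0, differentiable f y) ->
  forall e : R, 0 < e -> exists2 del : R, 0 < del & forall y v,
    enorm (y - y0) < del -> enorm (v - v0) < del ->
    cmod ('d f y v - 'd f y0 v0) < e.
Proof.
move=> /nbhs_Cn [r1 r10 df] e e0.
have df0 : differentiable f y0 by apply: df; rewrite subrr enorm0.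
have /cont_cplx /(_ 1 ltr01) /nbhs_Cn [r2 r20 r2P] :=
  differentiable_continuous df0.
pose r := Num.min r1 r2; pose B := cmod (f y0) + 1.
have r0 : 0 < r by rewrite lt_min r10.
have B0 : 0 <= B by rewrite /B addr_ge0 // cmod_ge0.
have dfr y : enorm (y - y0) < r -> differentiable f y.
  by rewrite lt_min => /andP[+ _]; exact: df.
have fB y : enorm (y - y0) < r -> cmod (f y) <= B.
  rewrite lt_min => /andP[_ /r2P] h; rewrite -(subrK (f y0) (f y)).
  by apply: le_trans (cmodD _ _) _; rewrite /B addrC lerD2l ltW.
have lip := bounded_lipschitz r0 dfr fB.
set L := 4 * B / r in lip.
have L0 : 0 <= L by rewrite /L divr_ge0 ?mulr_ge0 // ltW.
have r20' : 0 < r / 2 by rewrite divr_gt0.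
have dL y v : enorm (y - y0) < r / 2 -> cmod ('d f y v) <= L * enorm v.
  move=> yr; have dfy : differentiable f y by apply: dfr; lra.
  have v1 : 0 < enorm v + 1 by have := enorm_ge0 v; lra.
  apply: (cdiff_bound (diff_line v dfy) (divr_gt0 r20' v1)) => z.
  rewrite subr0 scale0r addr0 ltr_pdivlMr // => zv.
  have := lip y (y + z *: v) yr; rewrite addrC addKr enormZ => H.
  apply: le_trans (H _) _; last by rewrite mulrA mulrAC.
  by have := cmod_ge0 z; lra.
have v01 : 0 < enorm v0 + 1 by have := enorm_ge0 v0; lra.
pose q := r / 4 / (enorm v0 + 1).
have q0 : 0 < q by rewrite !divr_gt0.
have dy y : enorm (y - y0) < r / 4 ->
    q * cmod ('d f y v0 - 'd f y0 v0) <= 2 * L * enorm (y - y0).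
  move=> yr; rewrite mulrC -ler_pdivlMr //.
  have dfy : differentiable f y by apply: dfr; lra.
  pose G (z : C) := f (y + z *: v0) - f (y0 + z *: v0).
  have Gd : cdiff G 0 ('d f y v0 - 'd f y0 v0).
    by apply/is_derive_cdiff/is_deriveB; apply/is_derive_cdiff/diff_line.
  have zv (z : C) : cmod (z - 0) < q -> enorm (z *: v0) < r / 4.
    rewrite subr0 /q ltr_pdivlMr // enormZ => zq.
    by have := cmod_ge0 z; lra.
  have Gder (z : C) : cmod (z - 0) < q -> derivable G z 1.
    move=> /zv zr; apply: derivableB; apply/line_derivable/dfr.
      rewrite addrAC; apply: le_lt_trans (enormD _ _) _; lra.
    by rewrite addrAC subrr add0r; lra.
  have GB (z : C) : cmod (z - 0) < q -> cmod (G z - G 0) <= L * enorm (y - y0) + L * enorm (y - y0).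
    move=> /zv zr; apply: le_trans (cmodB _ _) _.
    rewrite /G !scale0r !addr0.
    have yy0 : y - y0 = y + z *: v0 - (y0 + z *: v0) by rewrite opprD addrACA subrr addr0.
    have h1 := lip y0 y; rewrite subrr enorm0 in h1.
    have h2 := lip (y0 + z *: v0) (y + z *: v0).
    rewrite -yy0 addrAC subrr add0r in h2.
    by apply: lerD; [apply: h2|apply: h1] => //; lra.
  apply: (cdiff_bound Gd q0) => z zq.
  have := schwarz q0 Gder GB zq; rewrite -ler_pdivlMl // => h; apply: le_trans h _.
  rewrite le_eqVlt; apply/orP; left; apply/eqP; field.
  by rewrite gt_eqF.
pose K := L + 2 * L / q + 1.
have LQ : 0 <= 2 * L / q by apply: divr_ge0; [exact: mulr_ge0|exact: ltW].
have K0 : 0 < K by rewrite /K; lra.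
exists (Num.min (r / 4) (e / K)); first by rewrite lt_min !divr_gt0.
move=> y v; rewrite !lt_min => /andP[y1 y2] /andP[_ v2].
rewrite ltr_pdivlMr // in y2; rewrite ltr_pdivlMr // in v2.
have -> : 'd f y v - 'd f y0 v0 = 'd f y (v - v0) + ('d f y v0 - 'd f y0 v0).
  have tri (a b c : C) : a - c = (a - b) + (b - c) by ring.
  exact: (etrans (tri _ _ _) (congr1 (fun k : C => k + ('d f y v0 - 'd f y0 v0))
    (esym (diffvB f y v v0)))).
apply: le_lt_trans (cmodD _ _) _.
have h1 : cmod ('d f y (v - v0)) <= L * enorm (v - v0) by apply: dL; lra.
have h2 : cmod ('d f y v0 - 'd f y0 v0) <= 2 * L / q * enorm (y - y0).
  by have := dy y y1; rewrite -ler_pdivlMl // => h; apply: le_trans h _; rewrite mulrC mulrAC.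
have E0 := enorm_ge0 (y - y0); have E1 := enorm_ge0 (v - v0).
have [vy|vy] := leP (enorm (v - v0)) (enorm (y - y0)).
  apply: le_lt_trans y2; rewrite /K !mulrDr mulr1.
  apply: le_trans (lerD h1 h2) _; rewrite ![enorm (y - y0) * _]mulrC.
  by have := ler_wpM2l L0 vy; lra.
apply: le_lt_trans v2; rewrite /K !mulrDr mulr1.
apply: le_trans (lerD h1 h2) _; rewrite ![enorm (v - v0) * _]mulrC.
by have := ler_wpM2l LQ (ltW vy); lra.
Qed.

End CauchyEstimates.

(** * Holomorphic functions along curves with a real parameter *)

Section Curves.
Context {R : realType} {n : nat}.
Notation C := (Cplx R).
Notation V := (Cn R n).
Implicit Types (e c : R -> V) (v : V) (f : V -> C) (t : R).

Lemma approx_is_derive (g : R -> R) x d :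
  (forall e : R, 0 < e -> exists2 del : R, 0 < del & forall y, `|y - x| < del ->
    `|g y - g x - d * (y - x)| <= e * `|y - x|) -> is_derive x 1 g d.
Proof.
move=> H.
have L : (fun h : R => h^-1 *: (g (h *: 1 + x) - g x)) @ 0^' --> d.
  move=> A /near_real [e e0 eA].
  have [del del0 dP] := H (e / 2) (divr_gt0 e0 (ltr0n _ 2)).
  rewrite /nbhs /= /dnbhs /within /=; apply/near_real; exists del => // h.
  rewrite subr0 => hd h0; apply: eA.
  have := dP (h *: 1 + x); rewrite addrK [h *: 1]mulr1 => /(_ hd) {}dP.
  have -> : h^-1 *: (g (h + x) - g x) - d = h^-1 * (g (h + x) - g x - d * h).
    by rewrite [RHS]mulrBr [h^-1 * (d * h)]mulrC -mulrA divff ?mulr1.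
  rewrite normrM normfV mulrC ltr_pdivrMr ?normr_gt0 //.
  apply: le_lt_trans dP _; rewrite ltr_pM2r ?normr_gt0 //; lra.
apply: DeriveDef; first by apply/cvg_ex; exists d.
exact: cvg_lim L.
Qed.

Lemma diff_quotient_approx e t v : diff_quotient e t @ 0^' --> v ->
  forall eps : R, 0 < eps -> exists2 del : R, 0 < del & forall s, `|s - t| < del ->
    enorm (e s - e t - rc (s - t) *: v) <= eps * `|s - t|.
Proof.
move=> ev eps eps0; have := ev [set w | enorm (w - v) < eps].
have nv : nbhs v [set w | enorm (w - v) < eps] by apply/nbhs_Cn; exists eps.
move=> /(_ nv); rewrite /nbhs /= /dnbhs /within /= => /near_real [r r0 rP].
exists r => // s sr; have [->|st] := eqVneq s t.
  by rewrite !subrr scale0r subrr enorm0 normr0 mulr0.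
have st0 : s - t != 0 by rewrite subr_eq0.
have := rP (s - t); rewrite subr0 => /(_ sr st0) /ltW.
rewrite /diff_quotient [t + _]addrC subrK -/(rc _) => h.
have -> : e s - e t - rc (s - t) *: v =
   rc (s - t) *: (rc (s - t)^-1 *: (e s - e t) - v).
  by rewrite scalerBr scalerA -rcM divff // rc1 scale1r.
by rewrite enormZ cmod_rc mulrC ler_wpM2r.
Qed.

Lemma diff_quotient_cont e t v : diff_quotient e t @ 0^' --> v ->
  {for t, continuous e}.
Proof.
move=> ev; apply/cont_Cn => eps eps0.
have [del del0 dP] := diff_quotient_approx ev ltr01.
have K0 : 0 < 1 + enorm v by have := enorm_ge0 v; lra.
apply/near_real; exists (Num.min del (eps / (1 + enorm v))).
  by rewrite lt_min del0 divr_gt0.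
move=> s; rewrite lt_min ltr_pdivlMr // => /andP[/dP h st].
rewrite -[e s - e t](subrK (rc (s - t) *: v)).
apply: le_lt_trans (enormD _ _) _; rewrite enormZ cmod_rc.
by move: st; rewrite mulrDr mulr1; lra.
Qed.

Lemma linear_bound (A : V -> C) : (forall k v, A (k *: v) = k * A v) ->
  A 0 = 0 -> {for 0, continuous A} ->
  exists2 M : R, 0 < M & forall w, cmod (A w) <= M * enorm w.
Proof.
move=> AZ A0 /cont_cplx /(_ 1 ltr01) /nbhs_Cn [q q0 qP].
exists (2 / q); first by rewrite divr_gt0.
move=> w; have [->|w0] := eqVneq w 0; first by rewrite A0 cmod0 enorm0 mulr0.
have nw : 0 < enorm w by rewrite enorm_gt0.
have := qP (rc (q / 2 / enorm w) *: w).
rewrite subr0 A0 subr0 enormZ AZ cmodM cmod_rc gtr0_norm ?divr_gt0 //.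
rewrite divfK ?gt_eqF // => /(_ _)/ltW h.
have : q / 2 / enorm w * cmod (A w) <= 1 by apply: h; lra.
rewrite -ler_pdivlMl ?divr_gt0 // => h2; apply: le_trans h2 _.
rewrite le_eqVlt; apply/orP; left; apply/eqP; field.
by rewrite !gt_eqF.
Qed.

Lemma diff_bound f y : differentiable f y ->
  exists2 M : R, 0 < M & forall w, cmod ('d f y w) <= M * enorm w.
Proof.
move=> df; apply: linear_bound; [exact: diffvZ|exact: diffv0|].
exact: (diff_continuous df).
Qed.

(** Chain rule between a real parameter and a complex differential, obtained by composing the two
    first-order expansions. *)
Lemma curve_approx f e t v : differentiable f (e t) ->
  diff_quotient e t @ 0^' --> v ->
  forall eps : R, 0 < eps -> exists2 del : R, 0 < del & forall s, `|s - t| < del ->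
  cmod (f (e s) - f (e t) - 'd f (e t) v * rc (s - t)) <= eps * `|s - t|.
Proof.
move=> df ev eps eps0.
have K0 : 0 < 2 * (1 + enorm v) by have := enorm_ge0 v; lra.
have [d2 d20 d2P] := differentiable_approx df (divr_gt0 eps0 K0).
have [M M0 MP] := diff_bound df.
have M20 : 0 < eps / (2 * M) by rewrite divr_gt0 // mulr_gt0.
have m0 : 0 < Num.min 1 (eps / (2 * M)) by rewrite lt_min ltr01.
have [d3 d30 d3P] := diff_quotient_approx ev m0.
have /cont_Cn /(_ d2 d20) /near_real [d4 d40 d4P] := diff_quotient_cont ev.
exists (Num.min d3 d4); first by rewrite lt_min d30.
move=> s; rewrite lt_min => /andP[/d3P h3 /d4P /d2P h2].
have h3a : enorm (e s - e t - rc (s - t) *: v) <= `|s - t|.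
  by apply: le_trans h3 _; rewrite ler_piMl // ge_min lexx.
have h3b : enorm (e s - e t - rc (s - t) *: v) <= eps / (2 * M) * `|s - t|.
  by apply: le_trans h3 _; rewrite ler_wpM2r // ge_min lexx orbT.
have es : enorm (e s - e t) <= (1 + enorm v) * `|s - t|.
  rewrite -[e s - e t](subrK (rc (s - t) *: v)).
  by apply: le_trans (enormD _ _) _; rewrite enormZ cmod_rc; lra.
have -> : f (e s) - f (e t) - 'd f (e t) v * rc (s - t) =
  (f (e s) - f (e t) - 'd f (e t) (e s - e t)) +
  'd f (e t) (e s - e t - rc (s - t) *: v).
  rewrite (diffvB f (e t) (e s - e t) (rc (s - t) *: v)).
  have tri (a b c d : C) : b = d -> a - d = a - c + (c - b) by move=> ->; ring.
  apply: tri.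
  by rewrite (diffvZ f (e t) (rc (s - t)) v) mulrC.
apply: le_trans (cmodD _ _) _.
have a1 : cmod (f (e s) - f (e t) - 'd f (e t) (e s - e t)) <= eps / 2 * `|s - t|.
  apply: le_trans h2 _; apply: le_trans (ler_wpM2l _ es) _.
    by rewrite divr_ge0 // ltW.
  rewrite le_eqVlt; apply/orP; left; apply/eqP; field.
  by have := enorm_ge0 v; rewrite gt_eqF //; lra.
have a2 : cmod ('d f (e t) (e s - e t - rc (s - t) *: v)) <= eps / 2 * `|s - t|.
  apply: le_trans (MP _) _; apply: le_trans (ler_wpM2l (ltW M0) h3b) _.
  rewrite le_eqVlt; apply/orP; left; apply/eqP; field.
  by rewrite gt_eqF.
by have := lerD a1 a2; lra.
Qed.

Lemma is_derive_Re_curve f e t v : differentiable f (e t) ->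
  diff_quotient e t @ 0^' --> v ->
  is_derive t 1 (fun s => complex.Re (f (e s))) (complex.Re ('d f (e t) v)).
Proof.
move=> df ev; apply: approx_is_derive => eps eps0.
have [del del0 dP] := curve_approx df ev eps0; exists del => // s /dP.
apply: le_trans; have := Re_le_cmod (f (e s) - f (e t) - 'd f (e t) v * rc (s - t)).
by rewrite !ReB ReM /= mulr0 subr0.
Qed.

Lemma is_derive_Im_curve f e t v : differentiable f (e t) ->
  diff_quotient e t @ 0^' --> v ->
  is_derive t 1 (fun s => complex.Im (f (e s))) (complex.Im ('d f (e t) v)).
Proof.
move=> df ev; apply: approx_is_derive => eps eps0.
have [del del0 dP] := curve_approx df ev eps0; exists del => // s /dP.
apply: le_trans; have := Im_le_cmod (f (e s) - f (e t) - 'd f (e t) v * rc (s - t)).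
by rewrite !ImB ImM /= mulr0 add0r.
Qed.

End Curves.

(** * Lower bounds for integrals of possibly nonmeasurable functions *)

Section LowerIntegral.
Context {R : realType}.
Notation mu := (@lebesgue_measure R).
Implicit Types (K M : R -> \bar R) (g : R -> R).

(* [K] is not assumed measurable: the integral of a nonnegative function is a
   supremum over the simple functions below it. *)
Lemma ge0_le_integral_nonmeasurable K M : (forall t, (0 <= M t)%E) ->
  (forall t, (M t <= K t)%E) -> (\int[mu]_t M t <= \int[mu]_t K t)%E.
Proof.
move=> M0 MK; have K0 t : (0 <= K t)%E by exact: le_trans (M0 t) (MK t).
rewrite !ge0_integralTE //; apply: ereal_sup_le => _ [h hM <-] /=.
by exists h => // t; exact: le_trans (hM t) (MK t).
Qed.

(** The minorant is cut off to the open interval because at breakpoints the velocity of a piecewise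
    curve, hence the integrand, is uncontrolled. *)
Lemma derivative_minorant g (a b : R) : a < b ->
  (forall t, a <= t <= b -> derivable g t 1) ->
  (forall t, a <= t <= b -> {for t, continuous (derive1 g)}) ->
  let M : R -> \bar R := (fun t => `|(derive1 g) t|%:E) \_ `]a, b[%classic in
  measurable_fun setT M /\ ((g b - g a)%:E <= \int[mu]_t M t)%E.
Proof.
move=> ab gd gc M.
have mg : measurable_fun `]a, b[ ((derive1 g) : R -> R).
  apply: open_continuous_measurable_fun; first exact: interval_open.
  move=> x; rewrite inE /= in_itv /= => /andP[ax xb].
  by apply: gc; rewrite !ltW.
have mn : measurable_fun `]a, b[ (fun t => `|(derive1 g) t|%:E).
  by apply/measurable_EFinP; exact: measurableT_comp.
split; first exact: ((measurable_restrictT _ (measurable_itv _)).1 mn).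
rewrite /M -integral_mkcond.
have FTC : (\int[mu]_(t in `[a, b]) ((derive1 g) t)%:E = (g b)%:E - (g a)%:E)%E.
  apply: (@continuous_FTC2 _ (derive1 g) g a b) => //.
    by apply: continuous_in_subspaceT => x; rewrite inE /= in_itv /=; exact: gc.
  have gct t : a <= t <= b -> {for t, continuous g}.
    by move=> /gd /derivable1_diffP /differentiable_continuous.
  split.
  - by move=> x; rewrite in_itv /= => /andP[ax xb]; apply: gd; rewrite !ltW.
  - by apply: cvg_at_right_filter; apply: gct; rewrite lexx ltW.
  - by apply: cvg_at_left_filter; apply: gct; rewrite lexx ltW.
rewrite EFinB -FTC integral_itv_bndoo; last exact/measurable_EFinP.
apply: le_trans (lee_abs _) _.
by apply: le_abse_integral => //; exact/measurable_EFinP.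
Qed.

(** Additivity is applied not to [K] but to one measurable minorant assembled from the pieces; only
    at the end is its integral compared with that of [K]. *)
Lemma piecewise_lower_integral K (h : R -> R) (m : nat) (s : nat -> R) :
  (forall t, (0 <= K t)%E) ->
  (forall i, (i < m)%N -> s i < s i.+1) ->
  (forall i, (i < m)%N -> exists g : R -> R,
    [/\ g (s i) = h (s i), g (s i.+1) = h (s i.+1),
        forall t, s i <= t <= s i.+1 -> derivable g t 1,
        forall t, s i <= t <= s i.+1 -> {for t, continuous (derive1 g)} &
        forall t, s i < t < s i.+1 -> (`|(derive1 g) t|%:E <= K t)%E]) ->
  ((h (s m) - h (s 0%N))%:E <= \int[mu]_(t in `[s 0%N, s m]) K t)%E.
Proof.
move=> K0 sS H.
have smono k : (k <= m)%N -> s 0%N <= s k.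
  elim: k => // k IH km; exact: le_trans (IH (ltnW km)) (ltW (sS _ km)).
(* The induction records that [M] vanishes off [[s 0, s m]], so the next summand has disjoint
   support and the sum stays below [K]. *)
have [M [mM M0 MK Ms IM]] : exists M : R -> \bar R,
    [/\ measurable_fun setT M, forall t, (0 <= M t)%E,
        forall t, (M t <= K t)%E,
        forall t, ~ (s 0%N <= t <= s m) -> M t = 0%E &
        ((h (s m) - h (s 0%N))%:E <= \int[mu]_t M t)%E].
  elim: m sS H smono => [|m IH] sS H smono.
    exists (cst 0%E); split=> //; rewrite subrr integral_ge0 //.
  have [i im|i im|k km|M [mM M0 MK Ms IM]] := IH.
  - by apply: sS; apply: ltnW.
  - by apply: H; apply: ltnW.
  - by apply: smono; apply: ltnW.
  have [g [g1 g2 gd gc gK]] := H m (ltnSn m).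
  have [mN IN] := derivative_minorant (sS m (ltnSn m)) gd gc.
  set N : R -> \bar R := (_ \_ _) in mN IN.
  have N0 t : (0 <= N t)%E by rewrite /N patchE; case: ifP.
  have NE t : ~ (s m < t < s m.+1) -> N t = 0%E.
    rewrite /N patchE; case: ifPn => //; rewrite inE /= in_itv /= => h1 h2.
    by case: h2.
  have sm0 := smono m (leqnSn m); have sm1 := sS m (ltnSn m).
  exists (fun t => M t + N t)%E; split.
  - exact: emeasurable_funD.
  - by move=> t; rewrite adde_ge0.
  - move=> t; have [tm|tm] := pselect (s m < t < s m.+1).
      have -> : M t = 0%E by apply: Ms => /andP[_]; case/andP: tm; rewrite ltNge => /negP.
      rewrite add0e /N patchE; case: ifPn => // _; exact: gK.
    by rewrite NE // adde0.
  - move=> t tn; rewrite Ms ?NE ?adde0 // => /andP[h1 h2]; apply: tn.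
      by rewrite (le_trans sm0 (ltW h1)) ltW.
    by rewrite h1 (le_trans h2 (ltW sm1)).
  - rewrite ge0_integralD //.
    have -> : h (s m.+1) - h (s 0%N) = (h (s m) - h (s 0%N)) + (g (s m.+1) - g (s m)).
      by rewrite g1 g2; ring.
    by rewrite EFinD; exact: leeD.
apply: le_trans IM _; rewrite [X in (_ <= X)%E]integral_mkcond.
apply: ge0_le_integral_nonmeasurable => // t; rewrite patchE.
case: ifPn => // tn; rewrite Ms //; apply/negP; move: tn.
by rewrite notin_setE /= in_itv /= => /negP.
Qed.

End LowerIntegral.

(** * Functions whose differential is dominated by the Kobayashi-Royden metric *)

Section Admissible.
Context {R : realType} {n : nat}.
Notation C := (Cplx R).
Notation V := (Cn R n).
Implicit Types (D : set V) (H : V -> R).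

(* [dH] is the differential of [H] near [y], tested along curves only. *)
Definition adm_at D H y := exists (r : R) (dH : V -> V -> R),
  0 < r /\ forall y', enorm (y' - y) < r -> D y' ->
  [/\ forall (e : R -> V) (t : R) (v : V), e t = y' ->
        diff_quotient e t @ 0^' --> v ->
        is_derive t 1 (fun s => H (e s)) (dH y' v),
      forall v : V, {for (y', v), continuous (fun p : V * V => dH p.1 p.2)} &
      forall v, (`|dH y' v|%:E <= kobayashi_royden D y' v)%E].

Definition kob_adm D H := forall y, D y -> adm_at D H y.

Lemma cont_pair_real (F : V * V -> R) y v : {for (y, v), continuous F} ->
  forall eps : R, 0 < eps -> exists2 del : R, 0 < del & forall y' v',
    enorm (y' - y) < del -> enorm (v' - v) < del -> `|F (y', v') - F (y, v)| < eps.
Proof.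
move=> Fc eps eps0; have [[A B] /= [nA nB] AB] := (cont_real _ _).1 Fc eps eps0.
have [r1 r10 r1P] := (nbhs_Cn _ _).1 nA; have [r2 r20 r2P] := (nbhs_Cn _ _).1 nB.
exists (Num.min r1 r2); first by rewrite lt_min r10.
move=> y' v'; rewrite !lt_min => /andP[/r1P Ay _] /andP[_ /r2P Bv].
exact: (AB (y', v')).
Qed.

Lemma kobayashi_royden_ge0 D (y v : V) : (0 <= kobayashi_royden D y v)%E.
Proof.
by apply: le_ereal_inf_tmp => _ [alpha [phi [_ _ _ _ ->]]]; rewrite lee_fin cmod_ge0.
Qed.

Lemma kob_adm_derivative D H (e : R -> V) t : open D -> kob_adm D H ->
  C1_curve e -> D (e t) ->
  [/\ derivable (fun s => H (e s)) t 1,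
      {for t, continuous (derive1 (fun s => H (e s)))} &
      (`|(derive1 (fun s => H (e s))) t|%:E <= kobayashi_royden D (e t) (velocity e t))%E].
Proof.
move=> oD aH [ec vc] Det; have [r [dH [r0 P]]] := aH _ Det.
have evel s : diff_quotient e s @ 0^' --> velocity e s by exact: ec.
have ne : \forall s \near t, enorm (e s - e t) < r /\ D (e s).
  have et := diff_quotient_cont (evel t).
  have [q q0 qP] := (nbhs_Cn _ _).1 (open_nbhs_nbhs (conj oD Det)).
  have := (cont_Cn _ _).1 et (Num.min r q).
  rewrite lt_min r0 q0 => /(_ isT); apply: filterS => s; rewrite lt_min.
  by move=> /andP[? ?]; split => //; exact: qP.
have dE s : enorm (e s - e t) < r -> D (e s) ->
    is_derive s 1 (fun s => H (e s)) (dH (e s) (velocity e s)).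
  by move=> sr Ds; have [A _ _] := P _ sr Ds; exact: A.
have tr : enorm (e t - e t) < r by rewrite subrr enorm0.
have dt := dE t tr Det.
have [_ B Ck] := P _ tr Det.
have g1 s : enorm (e s - e t) < r -> D (e s) ->
    (derive1 (fun s => H (e s))) s = dH (e s) (velocity e s).
  by move=> sr Ds; rewrite derive1E; exact: (@derive_val _ _ _ _ _ _ _ (dE s sr Ds)).
split; first exact: ex_derive.
- apply/cont_real => eps eps0.
  have [del del0 dP] := cont_pair_real (B (velocity e t)) eps0.
  have c1 := (cont_Cn _ _).1 (diff_quotient_cont (evel t)) del del0.
  have c2 := (cont_Cn _ _).1 (vc t) del del0.
  near=> s.
  have [sr Ds] : enorm (e s - e t) < r /\ D (e s) by near: s.
  have h1 : enorm (e s - e t) < del by near: s.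
  have h2 : enorm (velocity e s - velocity e t) < del by near: s.
  by have := dP _ _ h1 h2; rewrite /= -(g1 s sr Ds) -(g1 t tr Det).
- by rewrite g1 //; exact: Ck.
Unshelve. all: by end_near. Qed.

Lemma velocity_near (c e : R -> V) (t : R) : (\forall s \near t, c s = e s) ->
  velocity c t = velocity e t.
Proof.
move=> ce; rewrite /velocity; congr (lim _).
suff E : \forall h \near (0^' : set_system R), diff_quotient c t h = diff_quotient e t h.
  rewrite eqEsubset; split; apply: near_eq_cvg => //.
  by apply: filterS E => h ->.
have ct := nbhs_singleton ce.
have [r r0 rP] := (near_real _ _).1 ce.
apply/near_real; exists r => // h; rewrite subr0 => hr _.
by rewrite /diff_quotient ct rP // addrC addKr.
Qed.

(** Along any competing curve [H] is piecewise C^1 with derivative below the integrand, so its total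
    increment is at most the length. *)
Lemma kobayashi_adm D H (x y : V) : open D -> kob_adm D H ->
  ((H y - H x)%:E <= kobayashi D x y)%E.
Proof.
move=> oD aH; apply: le_ereal_inf_tmp => _ [c [[m [s [s0 s1 sP]]] cx cy cD] <-].
rewrite /kob_length -cx -cy -s0 -{1 2}s1.
have smon k l : (k <= l)%N -> (l <= m)%N -> s k <= s l.
  elim: l => [|l IH]; first by rewrite leqn0 => /eqP ->.
  rewrite leq_eqVlt => /predU1P[-> //|kl] lm.
  have [h _] := sP l lm.
  exact: le_trans (IH kl (ltnW lm)) (ltW h).
apply: (@piecewise_lower_integral R _ (fun t => H (c t))).
- by move=> t; exact: kobayashi_royden_ge0.
- by move=> i /sP [].
move=> i im; have [si [e eC ce]] := sP i im.
have in01 t : s i <= t <= s i.+1 -> D (c t).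
  move=> /andP[h1 h2]; apply: cD; rewrite -s0 -s1.
  by rewrite (le_trans (smon 0%N i _ (ltnW im)) h1) // (le_trans h2) // smon.
have Det t : s i <= t <= s i.+1 -> D (e t) by move=> ti; rewrite -ce //; exact: in01.
exists (fun t => H (e t)); split.
- by rewrite ce // lexx ltW.
- by rewrite ce // lexx ltW.
- by move=> t /Det Dt; have [h _ _] := kob_adm_derivative oD aH eC Dt; exact: h.
- move=> t /Det Dt; have [_ h _] := kob_adm_derivative oD aH eC Dt; exact: h.
(* Strictly inside the piece [c] agrees with its C^1 model [e] near [t], so the velocities agree; at
   the ends they may differ. *)
- move=> t /andP[t1 t2]; have tt : s i <= t <= s i.+1 by rewrite !ltW.
  have [_ _] := kob_adm_derivative oD aH eC (Det t tt).
  rewrite -(ce t tt) (@velocity_near c e t) //.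
  have [A B] : 0 < t - s i /\ 0 < s i.+1 - t by rewrite !subr_gt0.
  apply/near_real; exists (Num.min (t - s i) (s i.+1 - t)); first by rewrite lt_min A.
  move=> u; rewrite lt_min !ltr_norml => /andP[/andP[a1 a2] /andP[a3 a4]].
  by apply: ce; apply/andP; split; lra.
Qed.

End Admissible.

(** * Holomorphic discs, first exit points and disc automorphisms *)

Section Discs.
Context {R : realType} {n : nat}.
Notation C := (Cplx R).
Notation V := (Cn R n).
Implicit Types (D U : set V) (phi : C -> V) (z w : C) (y v a b : V).

Definition disc D phi :=
  forall w, cmod w < 1 -> differentiable phi w /\ D (phi w).

(** Take a point of least modulus in the compact set of bad points of modulus at most [|z|]. The
    whole open disc below it is good, which is more than an exit point along one path would give. *)
Lemma first_exit (N : set C) z :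
  (forall w, cmod w <= cmod z -> N w -> nbhs w N) -> N 0 -> ~ N z ->
  exists z1, [/\ ~ N z1, 0 < cmod z1, cmod z1 <= cmod z &
    forall w, cmod w < cmod z1 -> N w].
Proof.
move=> oN N0 Nz; pose E := [set w | cmod w <= cmod z /\ ~ N w].
have Kc : compact [set w : C | cmod (w - 0) <= cmod z] by exact: closed_disc_compact.
have Ec : compact E.
  apply: (subclosed_compact _ Kc); last by move=> w [h _]; rewrite /= subr0.
  move=> w Ew; have wz : cmod w <= cmod z.
    have := closureS (_ : E `<=` [set w : C | cmod (w - 0) <= cmod z]) Ew.
    have := compact_closed (@norm_hausdorff _ C) Kc.
    rewrite closure_id => <- /(_ _) h; rewrite -[w]subr0; apply: h.
    by move=> u [hu _]; rewrite /= subr0.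
  split=> // Nw; have /Ew [u [[_ nu] Nu]] := oN w wz Nw; exact: nu.
have [z1 /set_mem [h1 h2] z1P] : exists2 z1, z1 \in E &
    forall w, w \in E -> cmod z1 <= cmod w.
  apply: compact_EVT_min => //; first by exists z.
  by apply: continuous_subspaceT; exact: cmod_continuous.
exists z1; split=> //.
  by rewrite cmod_gt0; apply/eqP => z10; apply: h2; rewrite z10.
move=> w wz1; apply: contrapT => nw.
have : cmod z1 <= cmod w by apply: z1P; apply: mem_set; split=> //; lra.
by rewrite leNgt wz1.
Qed.

Lemma closure_radial (F : C -> V) (A : set V) z : {for z, continuous F} ->
  0 < cmod z -> (forall w, cmod w < cmod z -> A (F w)) -> closure A (F z).
Proof.
move=> Fc z0 FA B /nbhs_Cn [e e0 eB].
have /cont_Cn /(_ e e0) /nbhs_cplx [d d0 dP] := Fc.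
pose q := Num.min (1 / 2) (d / (2 * cmod z)).
have q0 : 0 < q by rewrite lt_min divr_gt0 // divr_gt0 // mulr_gt0.
have q1 : q <= 1 / 2 by rewrite ge_min lexx.
have qd : q * cmod z < d.
  have : q * cmod z <= d / (2 * cmod z) * cmod z.
    by rewrite ler_wpM2r ?cmod_ge0 // ge_min lexx orbT.
  have -> : d / (2 * cmod z) * cmod z = d / 2 by field; rewrite gt_eqF.
  lra.
pose w := rc (1 - q) * z.
exists (F w); split.
  apply: FA; rewrite /w cmodM cmod_rc ger0_norm; last lra.
  by rewrite gtr_pMl // gtrBl.
apply/eB/dP; rewrite /w.
have -> : rc (1 - q) * z - z = - (rc q * z).
  have -> : rc (1 - q) = 1 - rc q by apply: cplx_eq => /=; ring.
  by ring.
by rewrite cmodN cmodM cmod_rc gtr0_norm.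
Qed.

(** Disc automorphism taking 0 to [z], with derivative [1 - |z|^2] at 0; it recentres a holomorphic
    disc at any of its points. *)
Definition mobius z w : C := (w + z) / (1 + cj z * w).

Lemma mobius_den z w : cmod z < 1 -> cmod w < 1 -> 1 + cj z * w != 0.
Proof.
move=> z1 w1; apply/eqP => /(congr1 (fun u : C => u - 1)).
rewrite addrC addKr sub0r => /(congr1 (@cmod R)).
rewrite cmodM cmodJ cmodN cmod1 => h.
by have := cmod_ge0 z; have := cmod_ge0 w; nra.
Qed.

Lemma mobius_lt1 z w : cmod z < 1 -> cmod w < 1 -> cmod (mobius z w) < 1.
Proof.
move=> z1 w1; have d0 := mobius_den z1 w1.
rewrite cmodM cmodV ltr_pdivrMr ?cmod_gt0 // mul1r.
rewrite -(@ltr_pXn2r _ 2) ?nnegrE ?cmod_ge0 // -subr_gt0.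
have -> : cmod (1 + cj z * w) ^+ 2 - cmod (w + z) ^+ 2 =
    (1 - cmod w ^+ 2) * (1 - cmod z ^+ 2).
  rewrite !cmod_sqr; clear; case: z => a b; case: w => c d /=; ring.
by rewrite mulr_gt0 // subr_gt0 -(expr1n _ 2) ltr_pXn2r ?nnegrE ?cmod_ge0.
Qed.

Lemma mobius_den_derivable z w : derivable (fun u : C => 1 + cj z * u) w 1.
Proof.
have -> : (fun u : C => 1 + cj z * u) = (fun u => cj z * u + 1).
  by apply/funext => u; rewrite addrC.
exact: (@derivableD_cst _ (fun u : C => cj z * u) _ 1
  (derivableM (derivable_cst (cj z) w 1) (@derivable_id _ _ w 1))).
Qed.

Lemma mobius_derivable z w : cmod z < 1 -> cmod w < 1 ->
  derivable (mobius z) w 1.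
Proof.
move=> z1 w1.
have D2 : derivable (fun w : C => 1 + cj z * w) w 1.
  exact: mobius_den_derivable.
exact: (derivable_div (@derivableD_cst _ _ _ z (@derivable_id _ _ w 1)) D2 (mobius_den z1 w1)).
Qed.

Lemma cdiff_of_slope (F G : C -> C) z d : (\forall w \near z, F w - F z = G w * (w - z)) ->
  {for z, continuous G} -> G z = d -> cdiff F z d.
Proof.
move=> /nbhs_cplx [r r0 rP] /cont_cplx Gc <- e e0.
have /nbhs_cplx [q q0 qP] := Gc e e0.
exists (Num.min r q); first by rewrite lt_min r0.
move=> w; rewrite lt_min => /andP[/rP -> /qP h].
by rewrite -mulrBl cmodM ler_wpM2r ?cmod_ge0 // ltW.
Qed.

Lemma mobius_cdiff z : cmod z < 1 -> cdiff (mobius z) 0 (rc (1 - cmod z ^+ 2)).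
Proof.
move=> z1; have k1 : cmod (0 : C) < 1 by rewrite cmod0.
apply: (@cdiff_of_slope _ (fun w => rc (1 - cmod z ^+ 2) / (1 + cj z * w))).
- apply/nbhs_cplx; exists 1 => // w; rewrite subr0 => w1.
  have d0 := mobius_den z1 w1.
  have E : rc (1 - cmod z ^+ 2) = 1 - z * cj z.
    by rewrite mulcj; apply: cplx_eq => /=; ring.
  rewrite /mobius mulr0 addr0 add0r divr1 E; move: (cj z) d0 => c d0.
  by field.
- apply: derivable_cont.
  have D2 : derivable (fun w : C => 1 + cj z * w) 0 1.
    exact: mobius_den_derivable.
  exact: (@derivable_div _ (fun=> rc (1 - cmod z ^+ 2)) (fun w : C => 1 + cj z * w) 0
    (derivable_cst _ (0 : C) (1 : C)) D2 (mobius_den z1 k1)).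
- by rewrite mulr0 addr0 divr1.
Qed.

Lemma cdiff_comp (f g : C -> C) z d1 d2 : cdiff g z d1 -> cdiff f (g z) d2 ->
  cdiff (fun w => f (g w)) z (d2 * d1).
Proof.
move=> gd fd e e0.
have a1 := cmod_ge0 d1; have a2 := cmod_ge0 d2.
have k1 : 0 < e / 2 / (cmod d1 + 1) by rewrite !divr_gt0 //; lra.
have k2 : 0 < Num.min 1 (e / 2 / (cmod d2 + 1)).
  by rewrite lt_min ltr01 !divr_gt0 //; lra.
have [q1 q10 q1P] := fd _ k1; have [q2 q20 q2P] := gd _ k2.
exists (Num.min q2 (q1 / (cmod d1 + 1))).
  by rewrite lt_min q20 divr_gt0 //; lra.
move=> w; rewrite lt_min => /andP[/q2P h1]; rewrite ltr_pdivlMr; last lra.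
have N0 := cmod_ge0 (w - z); set N := cmod (w - z) in N0 h1 *.
move=> Nq.
have h1a : cmod (g w - g z - d1 * (w - z)) <= N.
  by apply: le_trans h1 _; rewrite ler_piMl // ge_min lexx.
have h1b : cmod (g w - g z - d1 * (w - z)) <= e / 2 / (cmod d2 + 1) * N.
  by apply: le_trans h1 _; rewrite ler_wpM2r // ge_min lexx orbT.
have gN : cmod (g w - g z) <= N * (cmod d1 + 1).
  rewrite -[g w - g z](subrK (d1 * (w - z))); apply: le_trans (cmodD _ _) _.
  by rewrite cmodM -/N; lra.
have h2 := q1P _ (le_lt_trans gN Nq).
have -> : f (g w) - f (g z) - d2 * d1 * (w - z) =
  (f (g w) - f (g z) - d2 * (g w - g z)) + d2 * (g w - g z - d1 * (w - z)) by ring.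
apply: le_trans (cmodD _ _) _; rewrite cmodM.
have b1 : cmod (f (g w) - f (g z) - d2 * (g w - g z)) <= e / 2 * N.
  apply: le_trans h2 _; apply: le_trans (ler_wpM2l (ltW k1) gN) _.
  rewrite le_eqVlt; apply/orP; left; apply/eqP; field.
  by rewrite gt_eqF //; lra.
have b2 : cmod d2 * cmod (g w - g z - d1 * (w - z)) <= e / 2 * N.
  apply: le_trans (ler_wpM2l a2 h1b) _; rewrite mulrA ler_wpM2r //.
  have d2p : 0 < cmod d2 + 1 by lra.
  have -> : cmod d2 * (e / 2 / (cmod d2 + 1)) = e / 2 * (cmod d2 / (cmod d2 + 1)).
    by field; rewrite gt_eqF.
  by rewrite ler_piMr ?divr_ge0 ?(ltW e0) // ler_pdivrMr // mul1r lerDl.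
lra.
Qed.

Lemma disc_mobius D phi z : disc D phi -> cmod z < 1 ->
  disc D (fun w => phi (mobius z w)).
Proof.
move=> dphi z1 w w1; have [d Dw] := dphi _ (mobius_lt1 z1 w1).
have dm : differentiable (mobius z) w.
  by move/derivable1_diffP: (mobius_derivable z1 w1); apply.
split; last exact: Dw.
exact: (@differentiable_comp _ _ _ _ (mobius z) phi w dm d).
Qed.

Lemma disc_cdiff phi (f : V -> C) z : differentiable phi z ->
  differentiable f (phi z) ->
  cdiff (fun w => f (phi w)) z ('d f (phi z) (derive1 phi z)).
Proof.
move=> dphi df; apply/is_derive_cdiff.
have dc : differentiable (f \o phi) z by exact: differentiable_comp.
have h : is_derive z 1 (f \o phi) ('D_1 (f \o phi) z).
  exact/derivableP/diff_derivable.
suff <- : 'D_1 (f \o phi) z = 'd f (phi z) (derive1 phi z) by [].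
rewrite deriveE // diff_comp //= derive1E' //.
Qed.

End Discs.

(** * First localisation: discs stay in the chart on a fixed radius *)

Section Chart.
Context {R : realType} {n : nat}.
Notation C := (Cplx R).
Notation V := (Cn R n).
Implicit Types (phi : C -> V) (z w : C) (y v a b pi : V).

Variables (D U : set V) (Psi : V -> V) (q : V) (rho0 : R).
Hypothesis oU : open U.
Hypothesis Psid : forall y, U y -> differentiable Psi y.
Hypothesis rho00 : 0 < rho0.
(** The chart ball is closed relative to [D]: a disc in [D] can leave it only across the sphere of
    radius [rho0], not through the boundary of [U]. *)
Hypothesis Kcl : forall y, D y ->
  closure [set y | [/\ D y, U y & enorm (Psi y - q) <= rho0]] y ->
  U y /\ enorm (Psi y - q) <= rho0.

Definition support pi a y : C := hdot (Psi y - pi) a.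

Definition supporting pi a :=
  enorm a = 1 /\ forall y, D y -> U y -> 0 < complex.Re (support pi a y).

Lemma support_le pi a y : supporting pi a -> cmod (support pi a y) <= enorm (Psi y - pi).
Proof. by move=> [a1 _]; rewrite -[X in _ <= X]mulr1 -a1 hdot_le. Qed.

Lemma support_differentiable pi a y : U y -> differentiable (support pi a) y.
Proof. by move=> /Psid dP; exact: differentiable_hdot. Qed.

Lemma support_disc_derivable phi pi a z : disc D phi -> cmod z < 1 -> U (phi z) ->
  derivable (fun w => support pi a (phi w)) z 1.
Proof.
move=> dphi z1 Uz; have [d _] := dphi z z1.
apply/derivable_cdiff; exists ('d (support pi a) (phi z) (derive1 phi z)).
by apply: disc_cdiff d _; exact: support_differentiable.
Qed.

Lemma chart_near phi z r b : disc D phi -> cmod z < 1 -> U (phi z) ->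
  enorm (Psi (phi z) - b) < r ->
  \forall w \near z, U (phi w) /\ enorm (Psi (phi w) - b) < r.
Proof.
move=> dphi z1 Uz zr; have [d _] := dphi z z1.
have pc : {for z, continuous phi} := differentiable_continuous d.
have c1 : \forall w \near z, U (phi w) by apply: pc; exact: open_nbhs_nbhs.
have c2 : {for z, continuous (Psi \o phi)}.
  by apply: continuous_comp pc _; exact: differentiable_continuous (Psid Uz).
have e0 : 0 < r - enorm (Psi (phi z) - b) by rewrite subr_gt0.
have c3 := (cont_Cn _ _).1 c2 _ e0.
near=> w; split; first by near: w.
have h : enorm (Psi (phi w) - Psi (phi z)) < r - enorm (Psi (phi z) - b) by near: w.
by apply: le_lt_trans (enorm_triangle (Psi (phi z)) _ _) _; rewrite -ltrBrDr.
Unshelve. all: by end_near. Qed.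

(** A first exit point is a radial limit of points of the chart ball, so [Kcl] keeps it in [U],
    where [Psi] is still continuous. *)
Lemma chart_closed phi z r b : disc D phi -> cmod z < 1 -> 0 < cmod z ->
  (forall y, U y -> enorm (Psi y - b) <= r -> enorm (Psi y - q) <= rho0) ->
  (forall w, cmod w < cmod z -> U (phi w) /\ enorm (Psi (phi w) - b) < r) ->
  U (phi z) /\ enorm (Psi (phi z) - b) <= r.
Proof.
move=> dphi z1 z0 br H; have [d Dz] := dphi z z1.
have pc : {for z, continuous phi} := differentiable_continuous d.
have [Uz _] : U (phi z) /\ enorm (Psi (phi z) - q) <= rho0.
  apply: Kcl => //; apply: (closure_radial pc z0) => w wz.
  have [Uw wr] := H w wz; split=> //; last by apply: br => //; exact: ltW.
  by have [] := dphi w (lt_trans wz z1).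
split=> //.
have c2 : {for z, continuous (Psi \o phi)}.
  by apply: continuous_comp pc _; exact: differentiable_continuous (Psid Uz).
apply: (closed_ball_enorm_closed (z := b)).
apply: (closure_radial c2 z0) => w /H [_ wr] /=; exact: ltW.
Qed.

(* The holomorphic weight [(1 + f)^-M], [f] a supporting functional at a point
   near [q], is close to 1 near [q] and small on the outer shell; this is what
   replaces a plurisubharmonic peak function in the usual localisation. *)
Lemma exit_radius (c r sg : R) (M : nat) pi a phi : disc D phi -> U (phi 0) ->
  supporting pi a -> 0 < r -> 0 < c ->
  (forall y, D y -> U y -> enorm (Psi y - q) = rho0 -> c <= cmod (support pi a y)) ->
  enorm (Psi (phi 0) - q) <= sg -> sg + r < rho0 ->
  enorm (Psi (phi 0) - pi) <= sg ->
  2 * rho0 * (1 + r + sg) ^+ M < r * Num.sqrt (1 + c ^+ 2) ^+ M ->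
  forall z, cmod z < r / (2 * rho0 * (1 + r + sg) ^+ M) ->
    U (phi z) /\ enorm (Psi (phi z) - Psi (phi 0)) < r.
Proof.
move=> dphi U0 sup r0 c0 shell xq sr xpi HM z zr.
set x := Psi (phi 0) in xq xpi *; set bb := 1 + r + sg in HM zr *.
set A := Num.sqrt _ in HM.
have sg0 : 0 <= sg by apply: le_trans xq; exact: enorm_ge0.
have b1 : 1 <= bb by rewrite /bb; lra.
have b0 : 0 < bb by lra.
have bM1 : 1 <= bb ^+ M by rewrite exprn_ege1.
have bM0 : 0 < bb ^+ M by lra.
have A0 : 0 < A by rewrite sqrtr_gt0 ltr_wpDr // sqr_ge0.
have AM0 : 0 < A ^+ M by rewrite exprn_gt0.
have den0 : 0 < 2 * rho0 * bb ^+ M by rewrite !mulr_gt0.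
set R0 := r / _ in zr; have R00 : 0 < R0 by rewrite divr_gt0.
have R01 : R0 < 1.
  rewrite ltr_pdivrMr // mul1r; apply: (@lt_le_trans _ _ (2 * rho0)); first lra.
  by rewrite ler_peMr // mulr_ge0 // ltW.
have z1 : cmod z < 1 by lra.
pose N w := U (phi w) /\ enorm (Psi (phi w) - x) < r.
apply: contrapT => Nz.
have [w wz [Uw wr]||z2 [Nz2 z20 z2z z2P]] := @first_exit R N z _ _ Nz.
- by apply: chart_near => //; lra.
- by split=> //; rewrite subrr enorm0.
have z21 : cmod z2 < 1 by lra.
have in_big y : U y -> enorm (Psi y - x) <= r -> enorm (Psi y - q) <= rho0.
  by move=> _ yx; apply: le_trans (enorm_triangle x _ _) _; lra.
have [Uz2 z2r] := chart_closed dphi z21 z20 in_big z2P.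
have Ez2 : enorm (Psi (phi z2) - x) = r.
  apply/eqP; rewrite eq_le z2r leNgt; apply/negP => lt; exact: Nz2.
(* The unit direction of the exit makes [h] vanish at 0 and equal exactly [r] at [z2]. *)
pose a' := rc r^-1 *: (Psi (phi z2) - x).
have a'1 : enorm a' = 1.
  by rewrite enormZ cmod_rc gtr0_norm ?invr_gt0 // Ez2 mulVf // gt_eqF.
pose f w := support pi a (phi w).
pose h w := support x a' (phi w).
have Rf w : cmod w < 1 -> U (phi w) -> 0 < complex.Re (f w).
  by move=> w1 Uw; apply: sup.2 => //; have [] := dphi w w1.
have f1 w : cmod w < 1 -> U (phi w) -> 1 <= cmod (1 + f w).
  move=> w1 Uw; apply: le_trans (le_trans _ (ler_norm _)) (Re_le_cmod _).
  by rewrite ReD /=; have := Rf w w1 Uw; lra.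
have fn0 w : cmod w < 1 -> U (phi w) -> (1 + f w) ^+ M != 0.
  move=> w1 Uw; rewrite expf_neq0 // -cmod_eq0 gt_eqF //.
  by have := f1 w w1 Uw; lra.
pose F w := h w / (1 + f w) ^+ M.
have Fd w : cmod w < 1 -> U (phi w) -> derivable F w 1.
  move=> w1 Uw.
  have dh : derivable h w 1 by exact: support_disc_derivable.
  have df : derivable (fun w => 1 + f w) w 1.
    have -> : (fun w => 1 + f w) = (fun w => f w + 1).
      by apply/funext => u; rewrite addrC.
    by apply: derivableD_cst; exact: support_disc_derivable.
  have dX : derivable (fun w => (1 + f w) ^+ M) w 1.
    have -> : (fun w => (1 + f w) ^+ M) = (fun w => 1 + f w) ^+ M.
      by apply/funext => u; rewrite exprfctE.
    exact: derivableX.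
  exact: (derivable_div dh dX (fn0 w w1 Uw)).
have k1 : cmod (0 : C) < 1 by rewrite cmod0.
have F0 : F 0 = 0 by rewrite /F /h /support subrr hdot0 mul0r.
have [d dF] := (derivable_cdiff F 0).1 (Fd 0 k1 U0).
(* Midway between [|z| / R0] and 1: the closed disc of radius [s] is inside the unit disc, yet
   [|z| < R0 * s] still holds. *)
pose s := (cmod z / R0 + 1) / 2.
have zR : cmod z / R0 < 1 by rewrite ltr_pdivrMr // mul1r.
have s1 : s < 1 by rewrite /s; lra.
have sz : cmod z < R0 * s.
  by rewrite mulrC -ltr_pdivrMr // /s; lra.
have s0 : 0 < s by have := cmod_ge0 z; nra.
have zs : cmod z < s by nra.
(* [K] need not be connected; the maximum principle for [F w / w] only requires that points of [K]
   off its edge [T] have small discs in [K]. *)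
pose K := [set w | cmod w <= s /\ U (phi w) /\ enorm (Psi (phi w) - q) <= rho0].
pose T := [set w | K w /\ (cmod w = s \/ enorm (Psi (phi w) - q) = rho0)].
have Kc : compact K.
  have Kc := @closed_disc_compact R 0 s.
  apply: (subclosed_compact _ Kc); last by move=> w [? _]; rewrite /= subr0.
  move=> w Kw; have ws : cmod w <= s.
    have := compact_closed (@norm_hausdorff _ C) Kc.
    move=> cl; rewrite -[w]subr0; apply: cl => B /Kw [u [[us _] Bu]].
    by exists u; split=> //; rewrite /= subr0.
  have w1 : cmod w < 1 by exact: le_lt_trans s1.
  have [dw Dw] := dphi w w1; split=> //; apply: Kcl => // B nB.
  have pc : {for w, continuous phi} := differentiable_continuous dw.
  have /Kw [u [[us [Uu ur]] Bu]] := pc B nB.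
  exists (phi u); split=> //; split=> //.
  by have [] := dphi u (le_lt_trans us s1).
have Kz2 : K z2.
  by split; [lra|split=> //; apply: in_big => //; rewrite Ez2].
have [w Kw|w Kw nTw|tau [Ktau Ttau]] := @max_modulus R (slope F 0 d) K T z2 Kc Kz2.
- have [-> |w0] := eqVneq w 0; first exact: slope_continuous.
  apply/derivable_cont/slope_derivable => //; apply: Fd; last exact: Kw.2.1.
  exact: le_lt_trans Kw.1 s1.
- have [ws [Uw wr]] := Kw.
  have ws' : cmod w < s.
    by rewrite lt_neqAle ws andbT; apply/eqP => E; apply: nTw; split=> //; left.
  have wr' : enorm (Psi (phi w) - q) < rho0.
    by rewrite lt_neqAle wr andbT; apply/eqP => E; apply: nTw; split=> //; right.
  have /nbhs_cplx [e e0 eP] := chart_near dphi (lt_trans ws' s1) Uw wr'.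
  pose e1 := if w == 0 then 1 else cmod w.
  have e10 : 0 < e1 by rewrite /e1; case: eqVneq => // wn0; rewrite cmod_gt0.
  exists (Num.min e1 (Num.min e (s - cmod w))).
    by rewrite !lt_min e0 e10 subr_gt0.
  move=> u; rewrite !lt_min => /and3P[ue1 /eP [Uu ur] us].
  have us' : cmod u < s by rewrite -(subrK w u); apply: le_lt_trans (cmodD _ _) _; rewrite -ltrBrDr.
  split; first by split; [exact: ltW|split=> //; exact: ltW].
  move=> uw; have u0 : u != 0.
    apply/eqP => u0; move: ue1 uw; rewrite u0 sub0r cmodN /e1.
    by case: eqVneq => [->|_]; rewrite ?eqxx // ltxx.
  exact: (slope_derivable u0 (Fd u (lt_trans us' s1) Uu)).
have [ts [Ut tr]] := Ktau.
have t1 : cmod tau < 1 by exact: le_lt_trans s1.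
have z2n : z2 != 0 by rewrite -cmod_gt0.
have hz2 : cmod (h z2) = r.
  have -> : h z2 = rc r.
    have Ea : Psi (phi z2) - x = rc r *: a'.
      by rewrite scalerA -rcM divff ?gt_eqF // rc1 scale1r.
    by rewrite /h /support Ea hdotZ hdotzz a'1 expr1n rc1 mulr1.
  by rewrite cmod_rc gtr0_norm.
have fz2 : cmod (1 + f z2) <= bb.
  apply: le_trans (cmodD _ _) _; rewrite cmod1.
  have := support_le (phi z2) sup.
  have := enorm_triangle x (Psi (phi z2)) pi.
  by rewrite Ez2 /bb /f; clear -xpi; lra.
have lower : r / bb ^+ M / cmod z2 <= cmod (slope F 0 d z2).
  rewrite /slope (negbTE z2n) F0 !subr0 cmodM cmodV ler_pM2r ?invr_gt0 //.
  rewrite /F cmodM cmodV cmodX hz2 ler_pM2l // lef_pV2 ?posrE //.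
    by rewrite lerXn2r ?nnegrE ?cmod_ge0 // ltW.
  by rewrite exprn_gt0 //; have := f1 z2 z21 Uz2; lra.
have htau : cmod (h tau) <= 2 * rho0.
  have := hdot_le (Psi (phi tau) - x) a'; rewrite a'1 mulr1 => H.
  apply: le_trans H _; apply: le_trans (enorm_triangle q _ _) _.
  by rewrite (enormBC q); clear -tr xq sr r0; lra.
have upper B : 0 < B -> 0 < cmod tau -> B <= cmod (1 + f tau) ->
    cmod (slope F 0 d tau) <= 2 * rho0 / B ^+ M / cmod tau.
  move=> B0 tau0 fB; rewrite cmod_gt0 in tau0.
  rewrite /slope (negbTE tau0) F0 !subr0 cmodM cmodV.
  rewrite ler_pM2r ?invr_gt0 ?cmod_gt0 // /F cmodM cmodV cmodX.
  apply: ler_pM; rewrite ?invr_ge0 ?exprn_ge0 ?cmod_ge0 //.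
  rewrite lef_pV2 ?posrE ?exprn_gt0 //; last exact: lt_le_trans fB.
  by rewrite lerXn2r ?nnegrE ?cmod_ge0 // ltW.
move=> le; have {}le := le_trans lower le.
(* On the circle the upper bound [2 rho0 / s] would force [|z2| >= R0 * s], contradicting the choice
   of [s]. *)
case: Ttau => [Es|Er].
- have := upper 1 ltr01; rewrite Es expr1n divr1 => /(_ s0 (f1 tau t1 Ut)) u.
  have {u le} := le_trans le u.
  have -> : r / bb ^+ M = 2 * rho0 * R0 by rewrite /R0; field; rewrite !gt_eqF.
  rewrite ler_pdivrMr //.
  have -> : 2 * rho0 / s * cmod z2 = 2 * rho0 * (cmod z2 / s).
    by rewrite mulrAC mulrA.
  rewrite ler_pM2l ?mulr_gt0 // leNgt => /negP; apply.
  by rewrite ltr_pdivrMr //; exact: le_lt_trans z2z sz.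
(* Below [|z2|] the disc stays within [r] of its centre, hence off the shell. Therefore dividing by
   [|tau|] costs no more than dividing by [|z2|]. *)
have tz2 : cmod z2 <= cmod tau.
  rewrite leNgt; apply/negP => /z2P [_ lt].
  have := enorm_triangle x (Psi (phi tau)) q; rewrite Er.
  by clear -lt xq sr; lra.
have t0 : 0 < cmod tau by exact: lt_le_trans tz2.
(* Since [Re f > 0], [|1 + f|^2 >= 1 + |f|^2]; here [|f| >= c] makes the weight small enough for
   [HM] to contradict the lower bound at [z2]. *)
have fA : A <= cmod (1 + f tau).
  have [_ Dt] := dphi tau t1.
  have ct := shell _ Dt Ut Er.
  rewrite -(@ler_pXn2r _ 2) ?nnegrE ?cmod_ge0 ?(ltW A0) // sqr_sqrtr; last first.
    by rewrite addr_ge0 // sqr_ge0.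
  have := Rf tau t1 Ut; have : c ^+ 2 <= cmod (f tau) ^+ 2.
    by rewrite lerXn2r ?nnegrE ?cmod_ge0 // ltW.
  by rewrite !cmod_sqr ReD ImD /=; nra.
have u := upper A A0 t0 fA; have {u le} := le_trans le u.
apply/negP; rewrite -ltNge.
apply: (@le_lt_trans _ _ (2 * rho0 / A ^+ M / cmod z2)).
  rewrite ler_wpM2l ?divr_ge0 ?mulr_ge0 ?(ltW rho00) ?(ltW AM0) //.
  by rewrite lef_pV2 ?posrE.
rewrite ltr_pM2r ?invr_gt0 // ltr_pdivrMr // mulrAC ltr_pdivlMr //.
Qed.

End Chart.

(** * Derivative of the logarithm of a modulus along a line *)

Section RealLogarithm.
Context {R : realType}.
Notation C := (Cplx R).
Implicit Types (u v : R -> R) (t : R).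

Lemma is_derive_ln_sqr u v t du dv : is_derive t 1 u du -> is_derive t 1 v dv ->
  0 < u t ^+ 2 + v t ^+ 2 ->
  is_derive t 1 (fun s => 2^-1 * ln (u s ^+ 2 + v s ^+ 2))
    ((u t * du + v t * dv) / (u t ^+ 2 + v t ^+ 2)).
Proof.
move=> hu hv p0.
have hs : is_derive t 1 (fun s => u s ^+ 2 + v s ^+ 2) (2 * (u t * du + v t * dv)).
  have -> : (fun s => u s ^+ 2 + v s ^+ 2) = u * u + v * v.
    by apply/funext => s; rewrite !expr2.
  have h := is_deriveD (is_deriveM hu hu) (is_deriveM hv hv).
  have E : (u t *: du + u t *: du) + (v t *: dv + v t *: dv) = 2 * (u t * du + v t * dv).
    rewrite -![_ *: _]/(_ * _); move: (u t * du) (v t * dv) => x y; ring.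
  by rewrite -E.
have hl := is_derive1_ln p0.
have hc := @is_derive1_comp R (@ln R) (fun s => u s ^+ 2 + v s ^+ 2) t _ _ hl hs.
have -> : (fun s => 2^-1 * ln (u s ^+ 2 + v s ^+ 2)) =
   2^-1 \*: (@ln R \o (fun s => u s ^+ 2 + v s ^+ 2)) by [].
apply: is_derive_eq; rewrite /GRing.scale /=; field.
by rewrite gt_eqF.
Qed.

Lemma is_derive_line (G : C -> C) t (om d : C) : cmod om = 1 ->
  cdiff G (rc t * om) d ->
  is_derive t 1 (fun s => complex.Re (G (rc s * om))) (complex.Re (d * om)) /\
  is_derive t 1 (fun s => complex.Im (G (rc s * om))) (complex.Im (d * om)).
Proof.
move=> om1 Gd.
have H e : 0 < e -> exists2 del : R, 0 < del & forall s, `|s - t| < del ->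
    cmod (G (rc s * om) - G (rc t * om) - d * om * rc (s - t)) <= e * `|s - t|.
  move=> e0; have [del del0 dP] := Gd e e0; exists del => // s st.
  have E : rc s * om - rc t * om = om * rc (s - t).
    have -> : rc (s - t) = rc s - rc t by apply: cplx_eq => /=; ring.
    by ring.
  have N : cmod (rc s * om - rc t * om) = `|s - t|.
    by rewrite E cmodM om1 mul1r cmod_rc.
  by have := dP (rc s * om); rewrite N E mulrA => /(_ st).
split; apply: approx_is_derive => e e0; have [del del0 dP] := H e e0;
  exists del => // s /dP; apply: le_trans;
  set X := d * om.
  have := Re_le_cmod (G (rc s * om) - G (rc t * om) - X * rc (s - t)).
  by rewrite !ReB ReM /= mulr0 subr0.
have := Im_le_cmod (G (rc s * om) - G (rc t * om) - X * rc (s - t)).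
by rewrite !ImB ImM /= mulr0 add0r.
Qed.

(** Valid at [z = 0] as well, because [ln 0 = 0] by convention. *)
Lemma ln_cmod (z : C) : 2^-1 * ln (complex.Re z ^+ 2 + complex.Im z ^+ 2) = ln (cmod z).
Proof.
have [->|z0] := eqVneq z 0.
  by rewrite cmod0 /= !expr0n /= addr0 ln0 // mulr0.
have z1 : 0 < cmod z by rewrite cmod_gt0.
by rewrite -cmod_sqr lnXn // [ln _ *+ 2]mulr2n; lra.
Qed.

End RealLogarithm.

(** * Second localisation and the lower bound for the metric *)

Section HyperbolicChart.
Context {R : realType} {n : nat}.
Notation C := (Cplx R).
Notation V := (Cn R n).
Implicit Types (phi : C -> V) (z w : C) (y v a b pi : V).

Variables (D U : set V) (Psi : V -> V) (q : V) (rho0 sg R0 : R).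
Hypothesis oU : open U.
Hypothesis Psid : forall y, U y -> differentiable Psi y.
Hypothesis Kcl : forall y, D y ->
  closure [set y | [/\ D y, U y & enorm (Psi y - q) <= rho0]] y ->
  U y /\ enorm (Psi y - q) <= rho0.
Hypothesis sg_rho0 : sg <= rho0.
Hypothesis R00 : 0 < R0.
Hypothesis R01 : R0 <= 1.
Hypothesis hyp : forall phi, disc D phi -> U (phi 0) ->
  enorm (Psi (phi 0) - q) < sg -> forall z, cmod z < R0 -> U (phi z).

(** After recentring at [z], the disc stays in [U] on the radius [R0], where the half-plane Schwarz
    lemma applies; [1 - |z|^2] is the derivative of the automorphism. *)
Lemma disc_derivative_bound phi pi a z d : disc D phi ->
  supporting D U Psi pi a -> cmod z < 1 -> U (phi z) ->
  enorm (Psi (phi z) - q) < sg ->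
  cdiff (fun w => support Psi pi a (phi w)) z d ->
  R0 * ((1 - cmod z ^+ 2) * cmod d) <= 2 * complex.Re (support Psi pi a (phi z)).
Proof.
move=> dphi sup z1 Uz zq dd.
have mz : mobius z 0 = z by rewrite /mobius mulr0 addr0 add0r divr1.
have dm := disc_mobius dphi z1.
have Um w : cmod w < R0 -> U (phi (mobius z w)).
  by have := hyp dm; rewrite mz => h; exact: h.
have c1 : cdiff (fun w => support Psi pi a (phi (mobius z w))) 0
    (d * rc (1 - cmod z ^+ 2)).
  apply: (@cdiff_comp R (fun w => support Psi pi a (phi w)) (mobius z) 0 _ _ (mobius_cdiff z1)).
  by rewrite mz.
have d1 w : cmod (w - 0) < R0 ->
    derivable (fun w => support Psi pi a (phi (mobius z w))) w 1.
  rewrite subr0 => wR; apply: (support_disc_derivable Psid (a := a) dm).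
    by apply: lt_le_trans wR _.
  exact: Um.
have p1 w : cmod (w - 0) < R0 -> 0 < complex.Re (support Psi pi a (phi (mobius z w))).
  rewrite subr0 => wR; apply: sup.2; last exact: Um.
  by have [] := dm w (lt_le_trans wR R01).
have := half_plane_schwarz R00 d1 p1 c1; rewrite mz cmodM cmod_rc.
rewrite ger0_norm ?[cmod d * _]mulrC // subr_ge0 expr_le1 ?cmod_ge0 //.
exact: ltW.
Qed.

(** Harnack by hand: up to the first exit [|f|] has grown by at most [((1 + t) / (1 - t))^m], too
    little to reach the value [c] required on the sphere of radius [sg]. *)
Lemma disc_stays (m : nat) (c t : R) pi a phi : disc D phi ->
  supporting D U Psi pi a -> 1 <= m%:R * R0 ->
  (forall y, D y -> U y -> enorm (Psi y - q) = sg -> c <= cmod (support Psi pi a y)) ->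
  U (phi 0) -> enorm (Psi (phi 0) - q) < sg -> 0 <= t < 1 ->
  cmod (support Psi pi a (phi 0)) * ((1 + t) / (1 - t)) ^+ m < c ->
  forall z, cmod z <= t -> U (phi z) /\ enorm (Psi (phi z) - q) < sg.
Proof.
move=> dphi sup mR shell U0 q0 /andP[t0 t1] tc z zt.
pose N w := U (phi w) /\ enorm (Psi (phi w) - q) < sg.
apply: contrapT => Nz.
have [w wz [Uw wr]||z2 [Nz2 z20 z2z z2P]] := @first_exit R N z _ _ Nz.
- exact: (chart_near oU Psid dphi (le_lt_trans (le_trans wz zt) t1) Uw wr).
- by [].
have z2t : cmod z2 <= t by exact: le_trans zt.
have z21 : cmod z2 < 1 by exact: le_lt_trans t1.
have in_big y : U y -> enorm (Psi y - q) <= sg -> enorm (Psi y - q) <= rho0.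
  by move=> _ h; exact: le_trans h sg_rho0.
have [Uz2 z2r] := chart_closed Psid Kcl dphi z21 z20 in_big z2P.
have Ez2 : enorm (Psi (phi z2) - q) = sg.
  apply/eqP; rewrite eq_le z2r leNgt; apply/negP => lt; exact: Nz2.
have [_ Dz2] := dphi z2 z21.
have cz2 := shell _ Dz2 Uz2 Ez2.
set l := cmod z2 in z20 z2z z2t z21 z2P.
pose om := rc l^-1 * z2.
have om1 : cmod om = 1.
  by rewrite cmodM cmod_rc gtr0_norm ?invr_gt0 // mulVf // gt_eqF.
have z2E : z2 = rc l * om.
  by rewrite mulrA -rcM divff ?gt_eqF // rc1 mul1r.
pose G w := support Psi pi a (phi w).
have lom s : 0 <= s -> cmod (rc s * om) = s.
  by move=> s0; rewrite cmodM om1 mulr1 cmod_rc ger0_norm.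
have Us s : 0 <= s <= l -> U (phi (rc s * om)).
  case/andP => s0; rewrite le_eqVlt => /predU1P[->|sl]; first by rewrite -z2E.
  by apply: (z2P _ _).1; rewrite lom.
have Gs s : 0 <= s <= l -> 0 < complex.Re (G (rc s * om)).
  move=> /[dup] /andP[s0 sl] /Us; apply: sup.2.
  by have [] := dphi (rc s * om); rewrite ?lom //; exact: le_lt_trans z21.
have Gd s : 0 <= s <= l -> exists d, cdiff G (rc s * om) d.
  move=> /[dup] /andP[s0 sl] /Us Uo; apply/derivable_cdiff.
  by apply: (support_disc_derivable Psid dphi) => //; rewrite lom //; exact: le_lt_trans z21.
pose u s := complex.Re (G (rc s * om)); pose v s := complex.Im (G (rc s * om)).
(* [ln |f|] on the radius towards the exit point, minus the primitive of [2 m / (1 - s^2)]; the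
   derivative bound says that [L] is nonincreasing. *)
pose L s := 2^-1 * ln (u s ^+ 2 + v s ^+ 2) - m%:R * (ln (1 + s) - ln (1 - s)).
have p0 s : 0 <= s <= l -> 0 < u s ^+ 2 + v s ^+ 2.
  by move=> /Gs h; rewrite ltr_wpDr ?sqr_ge0 // exprn_gt0.
have Ld s d : 0 <= s <= l -> cdiff G (rc s * om) d -> is_derive s 1 L
    ((u s * complex.Re (d * om) + v s * complex.Im (d * om)) / (u s ^+ 2 + v s ^+ 2)
     - m%:R * (2 / (1 - s ^+ 2))).
  move=> /[dup] /andP[s0 sl] sl' Gds.
  have [du dv] := is_derive_line om1 Gds.
  have i1 := is_derive_ln_sqr du dv (p0 s sl').
  have s1 : s < 1 by exact: le_lt_trans z21.
  have a1 : 0 < 1 + s by lra.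
  have a2 : 0 < 1 - s by lra.
  have j1 : is_derive s 1 (fun s => 1 + s) 1.
    by have := is_deriveD (is_derive_cst (1 : R) s 1) (is_derive_id s (1 : R)); rewrite add0r.
  have j2 : is_derive s 1 (fun s => 1 - s) (-1).
    by have := is_deriveB (is_derive_cst (1 : R) s 1) (is_derive_id s (1 : R)); rewrite sub0r.
  have i2 := @is_derive1_comp R (@ln R) (fun s => 1 + s) s _ _ (is_derive1_ln a1) j1.
  have i3 := @is_derive1_comp R (@ln R) (fun s => 1 - s) s _ _ (is_derive1_ln a2) j2.
  have h := is_deriveB i1 (is_deriveZ m%:R (is_deriveB i2 i3)).
  have <- : m%:R *: ((1 + s)^-1 * 1 - (1 - s)^-1 * -1) = m%:R * (2 / (1 - s ^+ 2)) :> R.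
    rewrite -[_ *: _]/(_ * _); congr (_ * _); field.
    by rewrite !gt_eqF //; nra.
  exact: h.
have Lle s d : 0 < s < l -> cdiff G (rc s * om) d ->
  (u s * complex.Re (d * om) + v s * complex.Im (d * om)) / (u s ^+ 2 + v s ^+ 2)
     - m%:R * (2 / (1 - s ^+ 2)) <= 0.
  move=> /andP[s0 sl] Gds.
  have ss : 0 <= s <= l by rewrite !ltW.
  have [Uo oq] : N (rc s * om) by apply: z2P; rewrite (lom s (ltW s0)).
  have s1 : s < 1 by exact: lt_trans z21.
  have := @disc_derivative_bound phi pi a (rc s * om) d dphi sup.
  rewrite (lom s (ltW s0)) => /(_ s1 Uo oq Gds) B.
  have q0' := p0 s ss.
  have E : u s ^+ 2 + v s ^+ 2 = cmod (G (rc s * om)) ^+ 2 by rewrite cmod_sqr.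
  set g := cmod (G (rc s * om)) in E.
  have g0 : 0 < g.
    rewrite lt_neqAle cmod_ge0 andbT; apply/eqP => g0.
    by move: q0'; rewrite E -g0 expr0n ltxx.
  have Rg : complex.Re (G (rc s * om)) <= g.
    by apply: le_trans (ler_norm _) (Re_le_cmod _).
  have num : u s * complex.Re (d * om) + v s * complex.Im (d * om) <= g * cmod d.
    have -> : u s * complex.Re (d * om) + v s * complex.Im (d * om) =
        complex.Re (cj (G (rc s * om)) * (d * om)).
      rewrite /u /v; move: (G (rc s * om)) (d * om) => x e.
      by rewrite ReM; case: x => x1 x2; case: e => e1 e2 /=; ring.
    apply: le_trans (ler_norm _) _; apply: le_trans (Re_le_cmod _) _.
    by rewrite cmodM cmodJ (cmodM d om) om1 mulr1.
  have D0 : 0 < 1 - s ^+ 2 by rewrite subr_gt0 expr_lt1 // ltW.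
  rewrite subr_le0 E ler_pdivrMr ?exprn_gt0 //; apply: le_trans num _.
  have B' : R0 * ((1 - s ^+ 2) * cmod d) <= 2 * g.
    by apply: le_trans B _; rewrite ler_pM2l.
  have d0 := cmod_ge0 d.
  (* The integer [m >= 1 / R0] replaces [1 / R0], so that the growth bound is an ordinary power. *)
  have B2 : (1 - s ^+ 2) * cmod d <= m%:R * (2 * g).
    apply: (@le_trans _ _ (m%:R * R0 * ((1 - s ^+ 2) * cmod d))).
      by rewrite ler_peMl // mulr_ge0 // ltW.
    by rewrite -mulrA ler_wpM2l.
  have -> : m%:R * (2 / (1 - s ^+ 2)) * g ^+ 2 =
      g * (m%:R * (2 * g) / (1 - s ^+ 2)) by field; rewrite gt_eqF.
  by rewrite ler_pM2l // ler_pdivlMr // mulrC.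
have Lmono : L l <= L 0.
  have dL s : 0 <= s <= l -> derivable L s 1.
    by move=> ss; have [d /(Ld s d ss) h] := Gd s ss; exact: ex_derive.
  have ll : 0 <= l <= l by rewrite lexx ltW.
  have l0 : 0 <= (0 : R) <= l by rewrite lexx ltW.
  apply: (@ler0_derive1_le_cc R L 0 l) => //.
  - by move=> s; rewrite in_itv /= => /andP[h1 h2]; apply: dL; rewrite !ltW.
  - move=> s; rewrite in_itv /= => /andP[h1 h2].
    have ss : 0 <= s <= l by rewrite !ltW.
    have [d Gds] := Gd s ss; rewrite derive1E (@derive_val _ _ _ _ _ _ _ (Ld s d ss Gds)).
    by apply: Lle => //; rewrite h1.
  - apply: continuous_in_subspaceT => s; rewrite inE /= in_itv /= => /dL.
    by move=> /derivable1_diffP /differentiable_continuous.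
  - exact: ltW.
have ld : 0 < 1 - l by lra.
have td : 0 < 1 - t by lra.
have Ll : L l = ln (cmod (G z2)) - m%:R * (ln (1 + l) - ln (1 - l)).
  by rewrite /L /u /v ln_cmod -z2E.
have L0 : L 0 = ln (cmod (G 0)).
  by rewrite /L /u /v ln_cmod rc0 mul0r addr0 subr0 subrr mulr0 subr0.
have G0p : 0 < cmod (G 0).
  have := Gs 0; rewrite rc0 mul0r lexx ltW // => /(_ isT) h.
  by apply: lt_le_trans h (le_trans (ler_norm _) (Re_le_cmod _)).
have Gzp : 0 < cmod (G z2).
  have := Gs l; rewrite -z2E lexx ltW // => /(_ isT) h.
  by apply: lt_le_trans h (le_trans (ler_norm _) (Re_le_cmod _)).
have key : cmod (G z2) <= cmod (G 0) * ((1 + l) / (1 - l)) ^+ m.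
  have k0 : 0 < (1 + l) / (1 - l) by rewrite divr_gt0 //; lra.
  rewrite -ler_ln ?posrE //; last by rewrite mulr_gt0 // exprn_gt0.
  rewrite lnM ?posrE ?exprn_gt0 // lnXn // -mulr_natl ln_div ?posrE //; last lra.
  by move: Lmono; rewrite Ll L0; lra.
have : cmod (G 0) * ((1 + l) / (1 - l)) ^+ m <= cmod (G 0) * ((1 + t) / (1 - t)) ^+ m.
  have l0 := ltW z20; rewrite ler_pM2l // lerXn2r ?nnegrE.
  - done.
  - by apply: divr_ge0; [rewrite addr_ge0|exact: ltW].
  - by apply: divr_ge0; [rewrite addr_ge0|exact: ltW].
  by rewrite ler_pdivrMr // mulrAC ler_pdivlMr //; nra.
by move: tc cz2 key; rewrite /G; lra.
Qed.

(** Any disc through [y] stays in the small chart ball up to every radius below [T], and there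
    half-plane Schwarz bounds its derivative. The loss [k = (u / c)^(1/m)] is written with [expR]
    and [ln] so that it is a function of [ln u], ready for integration. *)
Lemma kobayashi_royden_lower (m : nat) (c : R) pi a y v :
  supporting D U Psi pi a -> (0 < m)%N -> 1 <= m%:R * R0 -> 0 < c ->
  (forall y, D y -> U y -> enorm (Psi y - q) = sg -> c <= cmod (support Psi pi a y)) ->
  U y -> enorm (Psi y - q) < sg ->
  let u := cmod (support Psi pi a y) in
  0 < u -> u < c ->
  (((1 - 2 * expR ((ln u - ln c) / m%:R)) * cmod ('d (support Psi pi a) y v) / (2 * u))%:E
    <= kobayashi_royden D y v)%E.
Proof.
move=> sup m0 mR c0 shell Uy yq u u0 uc.
have mR0 : 0 < (m%:R : R) by rewrite ltr0n.
set k := expR _.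
have k0 : 0 < k by exact: expR_gt0.
have k1 : k < 1.
  by rewrite expR_lt1 // pmulr_llt0 ?invr_gt0 // subr_lt0 ltr_ln ?posrE.
have kE : k ^+ m = u / c.
  rewrite -expRM_natl mulrC divfK ?gt_eqF // expRB !lnK ?posrE //.
apply: le_ereal_inf_tmp => _ [alpha [phi [pd pD p0 pv ->]]]; rewrite lee_fin.
have dphi : disc D phi by move=> w w1; split; [exact: pd|exact: pD].
have k01 : cmod (0 : C) < 1 by rewrite cmod0.
have U0 : U (phi 0) by rewrite p0.
have q0 : enorm (Psi (phi 0) - q) < sg by rewrite p0.
have [d0 _] := dphi 0 k01.
set d := 'd (support Psi pi a) y (derive1 phi 0).
have cd : cdiff (fun w => support Psi pi a (phi w)) 0 d.
  have := @disc_cdiff R n phi (support Psi pi a) 0 d0; rewrite p0; apply.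
  exact: (support_differentiable Psid).
have dv : 'd (support Psi pi a) y v = alpha * d.
  by rewrite -pv; exact: diffvZ.
(* Solution of [(1 + T) / (1 - T) = 1 / k], the radius at which the growth bound reaches [c]. *)
pose T := (1 - k) / (1 + k).
have T0 : 0 < T by rewrite divr_gt0 //; lra.
have B t : 0 < t < T -> t * cmod d <= 2 * u.
  move=> /andP[t0 tT].
  have t1 : t < 1 by apply: lt_trans tT _; rewrite ltr_pdivrMr; lra.
  have st : forall w, cmod w <= t -> U (phi w) /\ enorm (Psi (phi w) - q) < sg.
    apply: (disc_stays dphi sup mR shell U0 q0); first by rewrite (ltW t0).
    rewrite p0 -/u.
    have h : (1 + t) / (1 - t) < k^-1.
      rewrite ltr_pdivrMr; last lra.
      rewrite mulrC ltr_pdivlMr //.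
      by move: tT; rewrite ltr_pdivlMr; lra.
    have h2 : ((1 + t) / (1 - t)) ^+ m < c / u.
      have -> : c / u = k^-1 ^+ m by rewrite exprVn kE invf_div.
      rewrite ltr_pXn2r ?nnegrE ?invr_ge0 ?(ltW k0) //.
      by rewrite divr_ge0 //; lra.
    by rewrite mulrC -ltr_pdivlMr.
  have Re_le : complex.Re (support Psi pi a y) <= u.
    by apply: le_trans (ler_norm _) (Re_le_cmod _).
  apply: (@le_trans _ _ (2 * complex.Re (support Psi pi a (phi 0)))); last first.
    by rewrite p0 ler_pM2l.
  apply: (half_plane_schwarz t0 _ _ cd) => w; rewrite subr0 => wt.
    apply: (support_disc_derivable Psid dphi) => //; first exact: lt_trans t1.
    by have [] := st w (ltW wt).
  apply: sup.2; last by have [] := st w (ltW wt).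
  by have [] := dphi w (lt_trans wt t1).
have := ler_open_limit T0 (cmod_ge0 d) B => BT.
have kT : 1 - 2 * k <= T by rewrite ler_pdivlMr; nra.
have B2 : (1 - 2 * k) * cmod d <= 2 * u.
  by apply: le_trans BT; rewrite ler_wpM2r ?cmod_ge0.
rewrite dv cmodM ler_pdivrMr ?mulr_gt0 // mulrCA ler_wpM2l ?cmod_ge0 //.
Qed.

End HyperbolicChart.

(** * Locality and symmetry of admissibility *)

Section AdmissibleAlgebra.
Context {R : realType} {n : nat}.
Notation C := (Cplx R).
Notation V := (Cn R n).
Implicit Types (D : set V) (H : V -> R) (y : V).

(** Additive constants are allowed because both gluing and subtracting barriers produce, near each
    point, one admissible function plus a constant. *)
Lemma adm_at_ext D H H' y (k : R) : open D -> D y ->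
  (exists2 r : R, 0 < r & forall y', enorm (y' - y) < r -> D y' -> H' y' = H y' + k) ->
  adm_at D H y -> adm_at D H' y.
Proof.
move=> oD Dy [r1 r10 HH] [r2 [dH [r20 P]]].
exists (Num.min r1 r2), dH; rewrite lt_min r10; split=> // y'.
rewrite lt_min => /andP[y1 y2] Dy'; have [A B Ck] := P y' y2 Dy'; split=> //.
move=> e t v ey ev; have h := A e t v ey ev.
have near_eq : \forall s \near t, H (e s) + k = H' (e s).
  have et := diff_quotient_cont ev.
  have [q q0 qP] := (nbhs_Cn _ _).1 (open_nbhs_nbhs (conj oD Dy')).
  have := (cont_Cn _ _).1 et (Num.min (r1 - enorm (y' - y)) q).
  rewrite lt_min subr_gt0 y1 q0 ey => /(_ isT); apply: filterS => s.
  rewrite lt_min => /andP[s1 s2]; rewrite HH //; last exact: qP.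
  by apply: le_lt_trans (enorm_triangle y' _ _) _; rewrite -ltrBrDr.
apply: (near_eq_is_derive near_eq).
by have := is_deriveD h (is_derive_cst k t 1); rewrite addr0.
Qed.

Lemma adm_at_cst D y (k : R) : adm_at D (cst k) y.
Proof.
exists 1, (fun _ _ => 0); split=> // y' _ _; split.
- by move=> e t v _ _; exact: is_derive_cst.
- by move=> v; exact: cst_continuous.
- by move=> v; rewrite normr0 kobayashi_royden_ge0.
Qed.

Lemma adm_at_opp D H y : adm_at D H y -> adm_at D (fun y => - H y) y.
Proof.
move=> [r [dH [r0 P]]]; exists r, (fun y v => - dH y v); split=> // y' yr Dy'.
have [A B Ck] := P y' yr Dy'; split.
- by move=> e t v ey ev; exact: (is_deriveN (A e t v ey ev)).
- by move=> v; apply: continuousN; exact: B.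
- by move=> v; rewrite normrN.
Qed.

End AdmissibleAlgebra.

(** * The one-variable primitive of the metric bound *)

Section Profile.
Context {R : realType}.
Implicit Types l : R.

Variables (m : nat) (c : R).
Hypothesis m0 : (0 < m)%N.

(** The value of [l = ln |f|] at which [(|f| / c)^(1/m) = 1/2], where the factor
    [1 - 2 (|f| / c)^(1/m)] vanishes. *)
Definition profile_top : R := ln c - m%:R * ln 2.
Definition profile0 l : R := l - 2 * m%:R * expR ((l - ln c) / m%:R).
Definition profile0_deriv l : R := 1 - 2 * expR ((l - ln c) / m%:R).

(* [profile0] is truncated exactly where its derivative vanishes, so that
   [profile] is of class C^1. *)
Definition profile l : R := profile0 (Num.min l profile_top).
Definition profile_deriv l : R := profile0_deriv (Num.min l profile_top).

Let mR : 0 < (m%:R : R). Proof. by rewrite ltr0n. Qed.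

Lemma profile0_deriv_top : profile0_deriv profile_top = 0.
Proof.
rewrite /profile0_deriv /profile_top.
have -> : (ln c - m%:R * ln 2 - ln c) / m%:R = - ln (2 : R).
  by field; rewrite gt_eqF.
by rewrite expRN lnK ?posrE // divff // subrr.
Qed.

Let is_derive_exponential l :
  is_derive l 1 (fun l => expR ((l - ln c) / m%:R))
    (expR ((l - ln c) / m%:R) * m%:R^-1).
Proof.
have h1 : is_derive l 1 (fun l => (l - ln c) / m%:R) (m%:R^-1).
  have -> : (fun l : R => (l - ln c) / m%:R) = (fun l => m%:R^-1 * (l - ln c)).
    by apply/funext => s; rewrite mulrC.
  have := is_deriveZ (m%:R^-1 : R)
    (is_deriveB (is_derive_id l (1 : R)) (is_derive_cst (ln c) l (1 : R))).
  by rewrite subr0 -[_ *: 1]/(_ * 1) mulr1.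
exact: (@is_derive1_comp R expR (fun l => (l - ln c) / m%:R) l _ _
  (is_derive_expR ((l - ln c) / m%:R)) h1).
Qed.

Lemma is_derive_profile0 l : is_derive l 1 profile0 (profile0_deriv l).
Proof.
have h := is_deriveB (is_derive_id l (1 : R))
  (is_deriveZ (2 * m%:R : R) (is_derive_exponential l)).
have <- : 1 - (2 * m%:R) *: (expR ((l - ln c) / m%:R) * m%:R^-1) = profile0_deriv l.
  rewrite /profile0_deriv -[_ *: _]/(_ * _); congr (_ - _); field.
  by rewrite gt_eqF.
exact: h.
Qed.

Lemma is_derive_profile l : is_derive l 1 profile (profile_deriv l).
Proof.
apply: approx_is_derive => e e0; rewrite /profile /profile_deriv.
set T := profile_top.
have [del del0 dP] := is_derive_approx (is_derive_profile0 (Num.min l T)) e0.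
exists (if l < T then Num.min del (T - l) else if T < l then l - T else del).
  by case: (ltP l T) => lT; [rewrite lt_min del0 subr_gt0|
    case: (ltP T l) => // Tl; rewrite subr_gt0].
move=> y; case: (ltP l T) => lT.
  rewrite lt_min => /andP[yl yT].
  have yT' : y < T by move: yT; rewrite ltr_norml; lra.
  have := dP y; rewrite (min_l (ltW lT)) (min_l (ltW yT')) => h; exact: h.
case: (ltP T l) => Tl yl.
  have Ty : T <= y by move: yl; rewrite ltr_norml; lra.
  rewrite ?(min_r lT) (min_r Ty) subrr profile0_deriv_top mul0r subrr normr0.
  by rewrite mulr_ge0 // ltW.
(* At the corner the derivative is 0 and truncation only brings [y] closer to [T], so the expansion
   of [profile0] suffices. *)
have lE : l = T by apply/eqP; rewrite eq_le lT Tl.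
have := dP (Num.min y T); rewrite lE minxx profile0_deriv_top !mul0r !subr0.
rewrite lE in yl.
have mle : `|Num.min y T - T| <= `|y - T|.
  by case: (leP y T) => h //; rewrite subrr normr0.
move=> h; apply: le_trans (h (le_lt_trans mle yl)) _.
by rewrite ler_pM2l.
Qed.

Lemma profile_deriv_continuous : continuous profile_deriv.
Proof.
move=> l; rewrite /profile_deriv.
have c1 : {for l, continuous (fun l : R => Num.min l profile_top)}.
  apply: continuous_min; [exact: cvg_id|exact: cvg_cst].
have c2 : continuous profile0_deriv.
  move=> x; have h := is_deriveB (is_derive_cst (1 : R) x (1 : R))
    (is_deriveZ (2 : R) (is_derive_exponential x)).
  have : derivable profile0_deriv x 1 by exact: (@ex_derive _ _ _ _ _ _ _ h).
  by move=> /derivable1_diffP /differentiable_continuous.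
exact: (continuous_comp c1 (c2 _)).
Qed.

Lemma profile_deriv_ge0 l : 0 <= profile_deriv l.
Proof.
rewrite -profile0_deriv_top /profile_deriv /profile0_deriv lerD2l lerN2.
rewrite ler_pM2l // ler_expR ler_pM2r ?invr_gt0 // lerD2r.
by rewrite ge_min lexx orbT.
Qed.

Lemma profile_le l : profile l <= l.
Proof.
apply: (@le_trans _ _ (Num.min l profile_top)); last by rewrite ge_min lexx.
rewrite /profile /profile0 gerBl !mulr_ge0 ?expR_ge0 // ltW //.
Qed.

Lemma profile_ge l : profile_top <= l -> profile l = profile0 profile_top.
Proof. by move=> h; rewrite /profile min_r. Qed.

End Profile.

(** * The admissible function attached to one supporting functional *)

Section ChartFunction.
Context {R : realType} {n : nat}.
Notation C := (Cplx R).
Notation V := (Cn R n).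
Implicit Types (y v : V).

Variables (D U : set V) (Psi : V -> V) (q : V) (rho0 sg c : R) (m : nat) (pi a : V).
Hypothesis oD : open D.
Hypothesis oU : open U.
Hypothesis Psid : forall y, U y -> differentiable Psi y.
Hypothesis Kcl : forall y, D y ->
  closure [set y | [/\ D y, U y & enorm (Psi y - q) <= rho0]] y ->
  U y /\ enorm (Psi y - q) <= rho0.
Hypothesis sg_rho0 : sg < rho0.
Hypothesis m0 : (0 < m)%N.
Hypothesis c0 : 0 < c.
Hypothesis sup : supporting D U Psi pi a.

Let f := support Psi pi a.

Hypothesis shell : forall y, D y -> U y -> sg <= enorm (Psi y - q) ->
  enorm (Psi y - q) <= rho0 -> c <= cmod (f y).
Hypothesis royden : forall y v, D y -> U y -> enorm (Psi y - q) < sg ->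
  cmod (f y) < c ->
  (((1 - 2 * expR ((ln (cmod (f y)) - ln c) / m%:R)) * cmod ('d f y v)
     / (2 * cmod (f y)))%:E <= kobayashi_royden D y v)%E.

Let top := profile_top m c.

(** The branches agree on the shell between [sg] and [rho0]: there [|f| >= c] and the profile is
    already at its constant value. The factor 1/2 is that of the bound [|df| / (2 |f|)]. *)
Definition chart_fun y : R :=
  if `[< U y /\ enorm (Psi y - q) < rho0 >]
  then 2^-1 * profile m c (ln (cmod (f y)))
  else 2^-1 * profile0 m c top.

Let top_le : top <= ln c.
Proof. by rewrite gerBl mulr_ge0 // ln_ge0 // ler1n. Qed.

(** The ball of radius [sg] is closed in [D] by [Kcl], so nearby points avoid it too; each is either
    in the shell or outside the chart ball, and both give the same constant. *)
Lemma chart_fun_far y : D y -> ~ (U y /\ enorm (Psi y - q) <= sg) ->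
  exists2 r : R, 0 < r & forall y', enorm (y' - y) < r -> D y' ->
    chart_fun y' = 2^-1 * profile0 m c top.
Proof.
move=> Dy nK.
have [r r0 rP] : exists2 r : R, 0 < r & forall y', enorm (y' - y) < r -> D y' ->
    ~ (U y' /\ enorm (Psi y' - q) <= sg).
  apply: contrapT => nr.
  have cl : closure [set y | [/\ D y, U y & enorm (Psi y - q) <= sg]] y.
    move=> B /nbhs_Cn [r r0 rB]; apply: contrapT => nB; apply: nr.
    exists r => // y' yr Dy' [Uy' sy']; apply: nB; exists y'; split; last exact: rB.
    by split.
  have [Uy _] : U y /\ enorm (Psi y - q) <= rho0.
    apply: Kcl => //; apply: closureS cl => w [Dw Uw sw]; split=> //.
    exact: le_trans sw (ltW sg_rho0).
  apply: nK; split=> //; rewrite leNgt; apply/negP => lt.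
  have c2 : {for y, continuous (fun w => enorm (Psi w - q))}.
    apply: continuous_comp; last exact: enorm_continuous.
    apply/cont_Cn => e e0; have pc := differentiable_continuous (Psid Uy).
    have := (cont_Cn _ _).1 pc e e0; apply: filterS => w.
    by rewrite opprB addrA subrK.
  have [w [[_ _ sw]]] := cl _ (cvgr_gt _ c2 _ lt).
  by rewrite /= ltNge sw.
exists r => // y' yr Dy'; rewrite /chart_fun; case: asboolP => // -[Uy' ry'].
have nK' := rP y' yr Dy'.
rewrite profile_ge //; apply: le_trans top_le _.
have sy' : sg <= enorm (Psi y' - q).
  by rewrite leNgt; apply/negP => lt; apply: nK'; split=> //; exact: ltW.
have cf := shell Dy' Uy' sy' (ltW ry').
by rewrite ler_ln ?posrE // (lt_le_trans c0).
Qed.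

Let fpos y : D y -> U y -> 0 < cmod (f y).
Proof.
move=> Dy Uy; apply: lt_le_trans (sup.2 y Dy Uy) _.
exact: le_trans (ler_norm _) (Re_le_cmod _).
Qed.

(** The real differential of [ln |f|]. *)
Let dlog y v : R := complex.Re (cj (f y) * 'd f y v) / cmod (f y) ^+ 2.
Let dH y v : R := 2^-1 * (profile_deriv m c (ln (cmod (f y))) * dlog y v).

Let fd y : U y -> differentiable f y.
Proof. exact: support_differentiable. Qed.

Let dH_is_derive (e : R -> V) t v : D (e t) -> U (e t) ->
  diff_quotient e t @ 0^' --> v ->
  is_derive t 1 (fun s => 2^-1 * profile m c (ln (cmod (f (e s))))) (dH (e t) v).
Proof.
move=> De Ue ev; have df := fd Ue.
have d1 := is_derive_Re_curve df ev; have d2 := is_derive_Im_curve df ev.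
have p0 : 0 < complex.Re (f (e t)) ^+ 2 + complex.Im (f (e t)) ^+ 2.
  by rewrite -cmod_sqr exprn_gt0 // fpos.
have d3 := is_derive_ln_sqr d1 d2 p0.
pose g s := 2^-1 * ln (complex.Re (f (e s)) ^+ 2 + complex.Im (f (e s)) ^+ 2).
have d4 := is_derive_profile c m0 (g t).
have d5 := @is_derive1_comp R (profile m c) g t _ _ d4 d3.
have d6 := is_deriveZ (2^-1 : R) d5.
have -> : (fun s => 2^-1 * profile m c (ln (cmod (f (e s))))) =
  (fun s => 2^-1 * profile m c (g s)).
  by apply/funext => s; rewrite /g ln_cmod.
have -> : dH (e t) v = 2^-1 * (profile_deriv m c (g t) *
    ((complex.Re (f (e t)) * complex.Re ('d f (e t) v) +
      complex.Im (f (e t)) * complex.Im ('d f (e t) v)) /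
     (complex.Re (f (e t)) ^+ 2 + complex.Im (f (e t)) ^+ 2))).
  rewrite /g ln_cmod /dH /dlog -cmod_sqr; congr (_ * (_ * (_ / _))).
  move: (f (e t)) ('d f (e t) v) => x z.
  by rewrite ReM; case: x => x1 x2; case: z => z1 z2 /=; ring.
exact: d6.
Qed.

Let dH_continuous y v : D y -> U y ->
  {for (y, v), continuous (fun p : V * V => dH p.1 p.2)}.
Proof.
move=> Dy Uy.
have fc : {for (y, v), continuous (fun p : V * V => f p.1)}.
  apply: (@continuous_comp _ _ _ fst f (y, v)); first exact: cvg_fst.
  exact: differentiable_continuous (fd Uy).
have dfc : {for (y, v), continuous (fun p : V * V => 'd f (p.1) p.2)}.
  apply/cont_cplx => e e0.
  have nd : \forall y' \near y, differentiable f y'.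
    by apply: filterS (open_nbhs_nbhs (conj oU Uy)) => y' Uy'; exact: fd.
  have [del del0 dP] := differential_continuous v nd e0.
  exists ([set y' | enorm (y' - y) < del], [set v' | enorm (v' - v) < del]).
    by split; apply/nbhs_Cn; exists del.
  by move=> [y' v'] /= [h1 h2]; exact: dP.
have cjc : continuous (@cj R).
  move=> z; apply/cont_cplx => e e0; apply/nbhs_cplx; exists e => // w.
  by rewrite -cjB cmodJ.
have mc : {for (y, v), continuous (fun p : V * V => cmod (f p.1))}.
  exact: (continuous_comp fc (@cmod_continuous R _)).
have f0 := fpos Dy Uy.
have lc : {for (y, v), continuous (fun p : V * V => ln (cmod (f p.1)))}.
  exact: (continuous_comp mc (continuous_ln f0)).
have pc : {for (y, v), continuous (fun p : V * V => profile_deriv m c (ln (cmod (f p.1))))}.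
  exact: (continuous_comp lc (@profile_deriv_continuous R m c _)).
have nc : {for (y, v), continuous (fun p : V * V => complex.Re (cj (f p.1) * 'd f (p.1) p.2))}.
  have h1 : {for (y, v), continuous (fun p : V * V => cj (f p.1))}.
    exact: (continuous_comp fc (cjc _)).
  have h2 := continuousM h1 dfc.
  exact: (continuous_comp h2 (@Re_continuous R _)).
have ic : {for (y, v), continuous (fun p : V * V => (cmod (f p.1) ^+ 2)^-1)}.
  have h := continuousM mc mc.
  have E : (fun p : V * V => (cmod (f p.1) ^+ 2)^-1) =
    (fun p : V * V => (cmod (f p.1) * cmod (f p.1))^-1).
    by apply/funext => p; rewrite expr2.
  rewrite E; apply: (continuousV _ h); rewrite mulf_neq0 // gt_eqF //.
have := continuousM (@cst_continuous _ _ (2^-1 : R) (y, v)) (continuousM pc (continuousM nc ic)).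
exact.
Qed.

(** Above [top] the differential is zero. Below it [|f| < c], which excludes the shell, so [y] is in
    the ball where the metric bound [royden] holds. *)
Let dH_royden y v : D y -> U y -> enorm (Psi y - q) <= rho0 ->
  (`|dH y v|%:E <= kobayashi_royden D y v)%E.
Proof.
move=> Dy Uy yr; have f0 := fpos Dy Uy.
set l := ln (cmod (f y)).
have pd0 := profile_deriv_ge0 c m0 l.
have [lt|ge] := ltP l top; last first.
  rewrite /dH -/l /profile_deriv min_r // profile0_deriv_top // mul0r mulr0 normr0.
  exact: kobayashi_royden_ge0.
have fc : cmod (f y) < c.
  by rewrite -ltr_ln ?posrE //; exact: lt_le_trans lt top_le.
have ys : enorm (Psi y - q) < sg.
  by rewrite ltNge; apply/negP => /(shell Dy Uy) /(_ yr); rewrite leNgt fc.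
apply: le_trans (royden v Dy Uy ys fc); rewrite lee_fin -/l.
have E : profile_deriv m c l = 1 - 2 * expR ((l - ln c) / m%:R).
  by rewrite /profile_deriv min_l // ltW.
rewrite -E /dH -/l normrM normrM (ger0_norm pd0).
have dl : `|dlog y v| <= cmod ('d f y v) / cmod (f y).
  rewrite /dlog normrM normfV (ger0_norm (sqr_ge0 _)).
  have -> : cmod ('d f y v) / cmod (f y) = cmod (f y) * cmod ('d f y v) / cmod (f y) ^+ 2.
    by field; rewrite gt_eqF.
  rewrite ler_pM2r ?invr_gt0 ?exprn_gt0 //; apply: le_trans (Re_le_cmod _) _.
  by rewrite cmodM cmodJ.
rewrite (ger0_norm (_ : 0 <= 2^-1)) //.
have -> : profile_deriv m c l * cmod ('d f y v) / (2 * cmod (f y)) =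
   2^-1 * (profile_deriv m c l * (cmod ('d f y v) / cmod (f y))).
  by field; rewrite gt_eqF.
by rewrite ler_pM2l ?invr_gt0 // ler_wpM2l.
Qed.

Lemma chart_fun_adm : kob_adm D chart_fun.
Proof.
move=> y Dy; have [[Uy ys]|nK] := pselect (U y /\ enorm (Psi y - q) <= sg); last first.
  have [r r0 rP] := chart_fun_far Dy nK.
  apply: (@adm_at_ext R n D (cst 0) _ y (2^-1 * profile0 m c top)) => //.
    by exists r => // y' yr Dy'; rewrite add0r; exact: rP.
  exact: adm_at_cst.
have yr : enorm (Psi y - q) < rho0 by exact: le_lt_trans ys sg_rho0.
have c2 : {for y, continuous Psi} := differentiable_continuous (Psid Uy).
have e0 : 0 < rho0 - enorm (Psi y - q) by rewrite subr_gt0.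
have [r1 r10 r1P] := (nbhs_Cn _ _).1 ((cont_Cn _ _).1 c2 _ e0).
have [r2 r20 r2P] := (nbhs_Cn _ _).1 (open_nbhs_nbhs (conj oU Uy)).
have inN y' : enorm (y' - y) < Num.min r1 r2 -> U y' /\ enorm (Psi y' - q) < rho0.
  rewrite lt_min => /andP[h1 h2]; split; first exact: r2P.
  apply: le_lt_trans (enorm_triangle (Psi y) _ _) _.
  by rewrite -ltrBrDr; exact: r1P.
exists (Num.min r1 r2), dH; rewrite lt_min r10; split=> // y' yy' Dy'.
have [Uy' ry'] := inN y' yy'; split.
- move=> e t v ey ev.
  have et := diff_quotient_cont ev.
  have De : D (e t) by rewrite ey.
  have Ue : U (e t) by rewrite ey.
  have := dH_is_derive De Ue ev; rewrite ey; apply: near_eq_is_derive.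
  have d0 : 0 < Num.min r1 r2 - enorm (y' - y) by rewrite subr_gt0.
  have := (cont_Cn _ _).1 et _ d0; rewrite ey; apply: filterS => s ss.
  rewrite /chart_fun; case: asboolP => // nn; exfalso; apply/nn/inN.
  by apply: le_lt_trans (enorm_triangle y' _ _) _; rewrite -ltrBrDr.
- by move=> v; exact: dH_continuous.
- by move=> v; apply: dH_royden => //; exact: ltW.
Qed.

End ChartFunction.

(** * Supporting functionals of convex sets and a uniform bound on the shell *)

Section ConvexGeometry.
Context {R : realType} {n : nat}.
Notation C := (Cplx R).
Notation V := (Cn R n).
Implicit Types (G : set V) (x y w a b pi q : V) (t : R).

Lemma convex_segment G x y t : convex_set (G : set (convex_lmodType V)) ->
  G x -> G y -> 0 <= t <= 1 -> G (rc t *: x + rc (1 - t) *: y).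
Proof.
move=> cG Gx Gy /andP[t0 t1].
have h0 : (0 : C) <= rc t by rewrite -rc0 rc_le.
have h1 : rc t <= (1 : C) by rewrite -rc1 rc_le.
have := cG x y (Itv01 h0 h1) (mem_set Gx) (mem_set Gy) => /set_mem.
have -> : rc (1 - t) = 1 - rc t by apply: cplx_eq => /=; ring.
exact.
Qed.

Lemma Re_hdotC x y : complex.Re (hdot x y) = complex.Re (hdot y x).
Proof. by rewrite -(hdot_cj x y); case: (hdot x y). Qed.

Lemma hdotNN x y : hdot (- x) (- y) = hdot x y.
Proof.
rewrite hdotN -[- y]scaleN1r hdotZr.
have -> : cj (-1 : C) = -1 by apply: cplx_eq => /=; rewrite ?oppr0 ?opprK.
by rewrite mulN1r opprK.
Qed.

Lemma open_push G x a : open G -> G x ->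
  exists2 e : R, 0 < e & G (x - rc e *: a).
Proof.
move=> oG Gx; have [r r0 rG] := (nbhs_Cn _ _).1 (open_nbhs_nbhs (conj oG Gx)).
have a1 : 0 < enorm a + 1 by have := enorm_ge0 a; lra.
exists (r / 2 / (enorm a + 1)); first by rewrite !divr_gt0.
apply: rG; rewrite addrC addKr enormN enormZ cmod_rc gtr0_norm ?divr_gt0 //.
have : enorm a / (enorm a + 1) <= 1 by rewrite ler_pdivrMr // mul1r lerDl.
have -> : r / 2 / (enorm a + 1) * enorm a = r / 2 * (enorm a / (enorm a + 1)) by ring.
by have := enorm_ge0 a; nra.
Qed.

(** An interior point can be pushed along [-a] without leaving [G], so its value cannot be 0. *)
Lemma half_space_open G pi a : open G -> a != 0 ->
  (forall w, G w -> 0 <= complex.Re (hdot (w - pi) a)) ->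
  forall w, G w -> 0 < complex.Re (hdot (w - pi) a).
Proof.
move=> oG a0 H w Gw; have [e e0 /H] := open_push a oG Gw.
have -> : w - rc e *: a - pi = (w - pi) - rc e *: a by rewrite addrAC.
rewrite [hdot (_ - rc e *: a) a]hdotB hdotZ hdotzz -rcM ReB Re_rc subr_ge0.
by apply: lt_le_trans; rewrite mulr_gt0 // exprn_gt0 // enorm_gt0.
Qed.

(* The normal to the ball around [x] at the nearest point [pi] of the
   complement supports the convex set there. *)
Lemma nearest_supports G x pi : open G -> convex_set (G : set (convex_lmodType V)) ->
  G x -> ~ G pi -> (forall w, ~ G w -> enorm (x - pi) <= enorm (x - w)) ->
  forall w, G w -> 0 < complex.Re (hdot (w - pi) (x - pi)).
Proof.
move=> oG cG Gx nGpi near_pi.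
have xpi : x - pi != 0 by rewrite subr_eq0; apply/eqP => E; apply: nGpi; rewrite -E.
apply: half_space_open => // w Gw; rewrite leNgt; apply/negP => neg.
set s := - complex.Re (hdot (w - pi) (x - pi)).
have s0 : 0 < s by rewrite oppr_gt0.
set N := enorm (pi - w) ^+ 2.
have N0 : 0 <= N by rewrite sqr_ge0.
(* Step length with [tau * N < s]: the point [b], beyond [pi] as seen from [w], is then closer to
   [x] than [pi], hence in [G]. Convexity would put [pi], between [b] and [w], in [G]. *)
pose tau := s / (N + 1).
have N1 : 0 < N + 1 by lra.
have tau0 : 0 < tau by rewrite divr_gt0.
pose b := pi + rc tau *: (pi - w).
have bx : enorm (b - x) ^+ 2 < enorm (x - pi) ^+ 2.
  have -> : b - x = (pi - x) + rc tau *: (pi - w) by rewrite /b addrAC.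
  have E : complex.Re (hdot (pi - x) (rc tau *: (pi - w))) = - (tau * s).
    rewrite hdotZr cjrc ReM Re_rc Im_rc mul0r subr0 Re_hdotC.
    by rewrite -(opprB w pi) -(opprB x pi) hdotNN /s mulrN opprK.
  rewrite enormD_sqr E enormZ cmod_rc gtr0_norm // exprMn -/N (enormBC pi x).
  have h : tau * N < s by rewrite mulrAC ltr_pdivrMr //; nra.
  nra.
have Gb : G b.
  apply: contrapT => /near_pi; rewrite leNgt => /negP; apply.
  by rewrite -(@ltr_pXn2r _ 2) ?nnegrE ?enorm_ge0 // (enormBC x b).
apply: nGpi; have T1 : 0 < 1 + tau by lra.
have := convex_segment (t := (1 + tau)^-1) cG Gb Gw.
have t01 : 0 <= (1 + tau)^-1 <= 1 by rewrite invr_ge0 ltW //= invf_le1 // lerDl ltW.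
move=> /(_ t01).
have -> // : rc (1 + tau)^-1 *: b + rc (1 - (1 + tau)^-1) *: w = pi.
have -> : 1 - (1 + tau)^-1 = (1 + tau)^-1 * tau by field; rewrite gt_eqF.
have kE : rc (1 + tau)^-1 * (1 + rc tau) = 1.
  by rewrite -[X in X + rc tau]rc1 -rcD -rcM mulVf ?gt_eqF.
rewrite /b (rcM (1 + tau)^-1 tau); apply/rowP => j; rewrite !mxE.
move: (rc (1 + tau)^-1) (rc tau) (pi ord0 j) (w ord0 j) kE => k u z1 z2 kE.
by rewrite -[RHS]mul1r -kE; ring.
Qed.

Lemma nearest_exists G x q : open G -> ~ G q -> exists pi, ~ G pi /\
  forall w, ~ G w -> enorm (x - pi) <= enorm (x - w).
Proof.
move=> oG nGq.
have Kc := @closed_ball_enorm_compact R n x (enorm (q - x)).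
have Ec : compact ((~` G) `&` [set w : V | enorm (w - x) <= enorm (q - x)]).
  apply: (subclosed_compact _ Kc); last by move=> w [].
  apply: closedI; [exact: open_closedC|exact: closed_ball_enorm_closed].
have [pi /set_mem [nG pix] piP] : exists2 w,
    w \in (~` G) `&` [set w : V | enorm (w - x) <= enorm (q - x)] &
    forall v, v \in (~` G) `&` [set w : V | enorm (w - x) <= enorm (q - x)] ->
    enorm (w - x) <= enorm (v - x).
  apply: compact_EVT_min => //; first by exists q; split=> //=.
  apply: continuous_subspaceT => w; apply/cont_real => e e0; apply/nbhs_Cn.
  exists e => // v vw; apply: le_lt_trans (enormBB _ _) _.
  by rewrite opprB addrA subrK.
exists pi; split=> // w nGw; rewrite ![enorm (x - _)]enormBC.
have [wq|/ltW wq] := leP (enorm (w - x)) (enorm (q - x)); last exact: le_trans wq.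
by apply: piP; apply: mem_set.
Qed.

Lemma hdot_approx z a z0 a0 : cmod (hdot z a - hdot z0 a0 : C) <=
  enorm (z - z0 : V) * enorm a + enorm z0 * enorm (a - a0).
Proof.
have -> : hdot z a - hdot z0 a0 = hdot (z - z0) a + hdot z0 (a - a0).
  by rewrite hdotB hdotBr; ring.
by apply: le_trans (cmodD _ _) _; apply: lerD; exact: hdot_le.
Qed.

Lemma hdot_continuous : continuous (fun p : V * V => hdot p.1 p.2).
Proof.
move=> [z0 a0]; apply/cont_cplx => e e0.
have a0p : 0 < enorm a0 + 1 by have := enorm_ge0 a0; lra.
have z0p : 0 < enorm z0 + 1 by have := enorm_ge0 z0; lra.
have k1 : 0 < Num.min 1 (e / 2 / (enorm z0 + 1)) by rewrite lt_min ltr01 !divr_gt0.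
have k2 : 0 < e / 2 / (enorm a0 + 1) by rewrite !divr_gt0.
exists ([set z | enorm (z - z0) < e / 2 / (enorm a0 + 1)],
        [set a | enorm (a - a0) < Num.min 1 (e / 2 / (enorm z0 + 1))]).
  by split; apply/nbhs_Cn; [exists (e / 2 / (enorm a0 + 1))|
    exists (Num.min 1 (e / 2 / (enorm z0 + 1)))].
move=> [z a] /= [hz]; rewrite lt_min => /andP[ha1 ha2].
apply: le_lt_trans (hdot_approx _ _ _ _) _.
have an : enorm a <= enorm a0 + 1.
  by have := enormD (a - a0) a0; rewrite subrK; lra.
have h1 : enorm (z - z0) * enorm a <= enorm (z - z0) * (enorm a0 + 1).
  by rewrite ler_wpM2l ?enorm_ge0.
have h2 : enorm z0 * enorm (a - a0) <= enorm (a - a0) * (enorm z0 + 1).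
  by have := enorm_ge0 (a - a0); nra.
rewrite ltr_pdivlMr // in hz; rewrite ltr_pdivlMr // in ha2; lra.
Qed.

(** The triples (base point, unit normal, point of the shell) form a compact set, the support
    condition being closed because its inequality is not strict. The hypothesis treats only the base
    point [q]; compactness extends it to base points near [q]. *)
Lemma shell_bound G q (r1 r2 : R) :
  (forall y a, closure G y -> r1 <= enorm (y - q) -> enorm a = 1 ->
     (forall w, G w -> 0 <= complex.Re (hdot (w - q) a)) -> hdot (y - q) a != 0) ->
  exists2 c : R, 0 < c & forall pi a y, enorm (pi - q) <= c -> enorm a = 1 ->
    (forall w, G w -> 0 <= complex.Re (hdot (w - pi) a)) ->
    closure G y -> r1 <= enorm (y - q) <= r2 -> c <= cmod (hdot (y - pi) a).
Proof.
move=> H.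
pose X := [set p : V * (V * V) | enorm (p.1 - q) <= 1 /\
   (enorm (p.2.1 - 0) <= 1 /\ enorm (p.2.2 - q) <= r2)].
have Xc : compact X.
  apply: (compact_setX (P := [set p : V | enorm (p - q) <= 1])
    (Q := [set p : V * V | enorm (p.1 - 0) <= 1 /\ enorm (p.2 - q) <= r2])).
    exact: closed_ball_enorm_compact.
  by apply: (compact_setX (P := [set p : V | enorm (p - 0) <= 1])
    (Q := [set p : V | enorm (p - q) <= r2])); exact: closed_ball_enorm_compact.
pose piC (p : V * (V * V)) := p.1.
pose aC (p : V * (V * V)) := p.2.1.
pose yC (p : V * (V * V)) := p.2.2.
have piCc : continuous piC by move=> p; exact: cvg_fst.
have aCc : continuous aC.
  by move=> p; apply: (@continuous_comp _ _ _ snd fst); [exact: cvg_snd|exact: cvg_fst].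
have yCc : continuous yC.
  by move=> p; apply: (@continuous_comp _ _ _ snd snd); exact: cvg_snd.
have subc (F : V * (V * V) -> V) w : continuous F -> continuous (fun p => F p - w).
  move=> Fc p; apply/cont_Cn => e e0; have := (cont_Cn _ _).1 (Fc p) e e0.
  by apply: filterS => p'; rewrite opprB addrA subrK.
have enc (F : V * (V * V) -> V) : continuous F -> continuous (fun p => enorm (F p)).
  move=> Fc p; apply/cont_real => e e0; have := (cont_Cn _ _).1 (Fc p) e e0.
  by apply: filterS => p'; exact/le_lt_trans/enormBB.
have hdc (F1 F2 : V * (V * V) -> V) : continuous F1 -> continuous F2 ->
    continuous (fun p => hdot (F1 p) (F2 p)).
  move=> F1c F2c p.
  apply: (@continuous_comp _ _ _ (fun p => (F1 p, F2 p)) (fun p : V * V => hdot p.1 p.2)).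
    exact: (cvg_pair (F1c p) (F2c p)).
  exact: hdot_continuous.
pose T := X `&` ([set p | enorm (aC p) = 1] `&`
  ((\bigcap_(w in G) [set p | 0 <= complex.Re (hdot (w - piC p) (aC p))]) `&`
  ([set p | closure G (yC p)] `&` [set p | r1 <= enorm (yC p - q)]))).
have Tc : compact T.
  apply: compact_closedI => //; apply: closedI; last apply: closedI; last apply: closedI.
  - exact: ((continuous_closedP _).1 (enc _ aCc) _ (@closed_eq _ 1)).
  - apply: closed_bigI => w _.
    have c1 : continuous (fun p => w - piC p).
      move=> p; apply/cont_Cn => e e0; have := (cont_Cn _ _).1 (piCc p) e e0.
      apply: filterS => p'.
      have -> : w - piC p' - (w - piC p) = piC p - piC p'.
        by apply/rowP => j; rewrite !mxE; ring.
      by rewrite enormBC.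
    have c2 : continuous (fun p => complex.Re (hdot (w - piC p) (aC p))).
      by move=> p; exact: (continuous_comp (hdc _ _ c1 aCc p) (@Re_continuous R _)).
    exact: ((continuous_closedP _).1 c2 _ (@closed_ge _ 0)).
  - exact: ((continuous_closedP _).1 yCc _ (@closed_closure _ G)).
  - exact: ((continuous_closedP _).1 (enc _ (subc _ q yCc)) _ (@closed_ge _ r1)).
have Tin pi a y : enorm (pi - q) <= 1 -> enorm a = 1 ->
    (forall w, G w -> 0 <= complex.Re (hdot (w - pi) a)) ->
    closure G y -> r1 <= enorm (y - q) <= r2 -> T (pi, (a, y)).
  move=> h1 h2 h3 h4 /andP[h5 h6]; split; first by split=> //=; rewrite subr0 h2.
  by split=> //; split.
have [T0|T0] := pselect (T !=set0); last first.
  exists 1 => // pi a y h1 h2 h3 h4 h5; exfalso; apply: T0.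
  by exists (pi, (a, y)); exact: Tin.
(* The second term makes [F] positive on all of [T], as a zero forces the base point to be [q]. If
   it is at most half the minimum, the first term is at least the other half. *)
pose F p := cmod (hdot (yC p - piC p) (aC p)) + enorm (piC p - q).
have Fc : continuous F.
  have c1 : continuous (fun p => yC p - piC p).
    by move=> p; apply: cvgB; [exact: yCc|exact: piCc].
  have c2 : continuous (fun p => cmod (hdot (yC p - piC p) (aC p))).
    by move=> p; exact: (continuous_comp (hdc _ _ c1 aCc p) (@cmod_continuous R _)).
  by move=> p; apply: cvgD; [exact: c2|exact: (enc _ (subc _ q piCc))].
have [p /set_mem Tp pP] : exists2 p, p \in T & forall p', p' \in T -> F p <= F p'.
  by apply: compact_EVT_min => //; exact: continuous_subspaceT.
have Fp : 0 < F p.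
  have n1 := cmod_ge0 (hdot (yC p - piC p) (aC p)).
  have n2 := enorm_ge0 (piC p - q).
  rewrite lt_neqAle addr_ge0 // andbT eq_sym; apply/eqP => F0.
  have /eqP e1 : cmod (hdot (yC p - piC p) (aC p)) = 0 by move: F0; rewrite /F; lra.
  have /eqP e2 : enorm (piC p - q) = 0 by move: F0; rewrite /F; lra.
  move: e2; rewrite enorm_eq0 subr_eq0 => /eqP e2.
  move: Tp => [_ [a1 [sup [cy ry]]]].
  have := H (yC p) (aC p) cy ry a1; rewrite -e2.
  have h : forall w, G w -> 0 <= complex.Re (hdot (w - piC p) (aC p)) by move=> w /sup.
  by move=> /(_ h); rewrite -cmod_eq0 e1.
exists (Num.min 1 (F p / 2)); first by rewrite lt_min ltr01 divr_gt0.
move=> pi a y; rewrite le_min => /andP[h1 h1'] h2 h3 h4 h5.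
have := pP _ (mem_set (Tin _ _ _ h1 h2 h3 h4 h5)); rewrite {2}/F /piC /aC /yC /= => h.
by rewrite ge_min; apply/orP; right; lra.
Qed.

End ConvexGeometry.

(** * Barriers at a locally C-strictly convex point *)

Section Barrier.
Context {R : realType} {n : nat}.
Notation C := (Cplx R).
Notation V := (Cn R n).
Implicit Types (y z w a b pi : V).

(** Off [W], [H] equals [A1] on a whole neighbourhood, which is what makes a difference of two
    barriers admissible. [A0] and [A1] are parameters so that they can be uniform in [z]. *)
Definition barrier_at (D W : set V) (A0 A1 : R) z :=
  0 < bdist D z /\ exists H : V -> R,
    [/\ kob_adm D H, H z <= 2^-1 * ln (bdist D z) + A0 &
        forall y, D y -> ~ W y -> exists2 r : R, 0 < r & forall y',
          enorm (y' - y) < r -> D y' -> H y' = A1].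

(** Bernoulli's inequality; it supplies the exponent of the weight in [exit_radius]. *)
Lemma power_gap (A B k : R) : 0 < B -> B < A -> exists M : nat, k * B ^+ M < A ^+ M.
Proof.
move=> B0 BA; have A0 : 0 < A by exact: lt_trans BA.
pose x := A / B - 1; have x0 : 0 < x by rewrite subr_gt0 ltr_pdivlMr // mul1r.
have [M kM] : exists M : nat, k < M%:R * x.
  have [k0|k0] := ltP k 0; first by exists 0%N; rewrite mul0r.
  exists (Num.bound (k / x)); rewrite -ltr_pdivrMr //.
  by apply: archi_boundP; rewrite divr_ge0 // ltW.
exists M; have BM : 0 < B ^+ M by rewrite exprn_gt0.
have -> : A = B * (1 + x) by rewrite /x addrC subrK mulrC divfK ?gt_eqF.
rewrite exprMn mulrC ltr_pM2l //; apply: lt_le_trans kM _.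
have bern (j : nat) : 1 + j%:R * x <= (1 + x) ^+ j.
  elim: j => [|j IH]; first by rewrite mul0r addr0 expr0.
  rewrite exprS; apply: le_trans (ler_wpM2l _ IH); last by rewrite addr_ge0 // ltW.
  have -> : (j.+1%:R : R) = 1 + j%:R by rewrite -natr1 addrC.
  have : 0 <= j%:R * x * x by rewrite !mulr_ge0 // ltW.
  lra.
by apply: le_trans (bern M); rewrite lerDr.
Qed.

(** The scalar estimate is applied to the component of [Psi] along [Psi w - Psi y], which depends on
    the pair of points, while the constant does not. *)
Lemma chart_lipschitz (U : set V) (Psi : V -> V) p : open U -> U p ->
  (forall y, U y -> differentiable Psi y) ->
  exists r L : R, [/\ 0 < r, 0 < L, forall y, enorm (y - p) < r -> U y &
    forall y w, enorm (y - p) < r / 2 -> enorm (w - y) < r / 2 ->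
      enorm (Psi w - Psi y) <= L * enorm (w - y)].
Proof.
move=> oU Up Pd.
have [r1 r10 r1P] := (nbhs_Cn _ _).1 (open_nbhs_nbhs (conj oU Up)).
have pc : {for p, continuous Psi} := differentiable_continuous (Pd p Up).
have [r2 r20 r2P] := (nbhs_Cn _ _).1 ((cont_Cn _ _).1 pc 1 ltr01).
pose r := Num.min r1 r2; have r0 : 0 < r by rewrite lt_min r10.
exists r, (4 * 1 / r); split=> //; first by rewrite divr_gt0 // mulr_gt0.
  by move=> y; rewrite lt_min => /andP[+ _]; exact: r1P.
move=> y w yr wr; have [->|wy] := eqVneq (Psi w) (Psi y).
  by rewrite subrr enorm0 mulr_ge0 ?enorm_ge0 // divr_ge0 // ltW // mulr_gt0.
have N0 : 0 < enorm (Psi w - Psi y) by rewrite enorm_gt0 subr_eq0.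
pose b := rc (enorm (Psi w - Psi y))^-1 *: (Psi w - Psi y).
have b1 : enorm b = 1.
  by rewrite enormZ cmod_rc gtr0_norm ?invr_gt0 // mulVf // gt_eqF.
have := @bounded_lipschitz R n (fun y => hdot (Psi y - Psi p) b) p r 1 r0 _ _ y w yr wr.
have -> : hdot (Psi w - Psi p) b - hdot (Psi y - Psi p) b = rc (enorm (Psi w - Psi y)).
  rewrite -hdotB opprB addrA subrK {1}(_ : Psi w - Psi y = rc (enorm (Psi w - Psi y)) *: b).
    by rewrite hdotZ hdotzz b1 expr1n rc1 mulr1.
  by rewrite /b scalerA -rcM divff ?gt_eqF // rc1 scale1r.
rewrite cmod_rc ger0_norm ?enorm_ge0 //; apply.
  move=> u; rewrite lt_min => /andP[ur _].
  by apply: differentiable_hdot; apply: Pd; exact: r1P.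
move=> u; rewrite lt_min => /andP[_ ur].
by apply: le_trans (hdot_le _ _) _; rewrite b1 mulr1 ltW // r2P.
Qed.

Variables (D U : set V) (p : V) (Psi Phi : V -> V).
Hypothesis oD : open D.
Hypothesis oU : open U.
Hypothesis Up : U p.
Hypothesis Psid : forall y, U y -> differentiable Psi y.
Hypothesis oPU : open (Psi @` U).
Hypothesis Phid : forall y, (Psi @` U) y -> differentiable Phi y.
Hypothesis PhiK : forall y, U y -> Phi (Psi y) = y.

Let G := Psi @` (D `&` U).
Let q := Psi p.

Hypothesis cG : convex_set (G : set (convex_lmodType V)).
Hypothesis mG : multiface G q = [set q].

Let G_in y : U y -> G (Psi y) -> D y.
Proof. by move=> Uy [w [Dw Uw] E]; rewrite -(PhiK Uy) -E PhiK. Qed.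

Lemma chart_image_open : open G.
Proof.
rewrite openE => _ [y [Dy Uy] <-].
have n1 : nbhs (Psi y) (Psi @` U) by apply: open_nbhs_nbhs; split=> //; exists y.
have pc : {for Psi y, continuous Phi}.
  by apply/differentiable_continuous/Phid; exists y.
have n2 : nbhs (Psi y) (Phi @^-1` D).
  by apply: pc; rewrite PhiK //; exact: open_nbhs_nbhs.
rewrite /interior; apply: filterS (filterI n1 n2) => w [[u Uu <-]].
by rewrite /= PhiK // => Du; exists u.
Qed.

Let oG := chart_image_open.

(** That [q] belongs to its own multiface already places it on the frontier of the open set [G]. *)
Let qG : closure G q /\ ~ G q.
Proof.
have : multiface G q q by rewrite mG.
move=> [F [[L [_ _ _ ->]] [_ [cq iq]]] _]; split=> //.
by move=> Gq; apply: iq; move/interior_id: oG => ->.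
Qed.

(** Strict C-convexity enters here. If the functional vanished at [y], the complex line through [q]
    and [y] would lie in its zero set, miss [G], and cut out a face containing both points. *)
Let only_q y a : closure G y -> y != q -> enorm a = 1 ->
  (forall w, G w -> 0 <= complex.Re (hdot (w - q) a)) -> hdot (y - q) a != 0.
Proof.
move=> cy yq a1 sup; apply/eqP => ya0.
have a0 : a != 0 by rewrite -enorm_gt0 a1.
have supp := half_space_open oG a0 sup.
pose L := [set q + zeta *: (y - q) | zeta in [set: C]].
have LG : L `&` G = set0.
  rewrite -subset0 => _ [[zeta _ <-]] /supp.
  by rewrite addrC addKr hdotZ ya0 mulr0 ltxx.
have Lq : L q by exists 0 => //; rewrite scale0r addr0.
have Ly : L y by exists 1 => //; rewrite scale1r addrC subrK.
have fy : frontier G y.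
  split=> // iy; have Gy : G y by exact: interior_subset iy.
  by have : (L `&` G) y by []; rewrite LG.
have fq : frontier G q by split; [exact: qG.1|move=> /interior_subset; exact: qG.2].
have : multiface G q y.
  exists (L `&` frontier G) => //; split; last by split.
  exists L; split=> //; last by exists q.
  by exists q, (y - q); rewrite subr_eq0.
by rewrite mG => /eqP; rewrite (negbTE yq).
Qed.

Let chart_ball : exists2 rho0 : R, 0 < rho0 & forall w, enorm (w - q) <= rho0 -> (Psi @` U) w.
Proof.
have nq : nbhs q (Psi @` U) by apply: open_nbhs_nbhs; split=> //; exists p.
have [r r0 rP] := (nbhs_Cn _ _).1 nq.
by exists (r / 2) => [|w wr]; [rewrite divr_gt0|apply: rP; lra].
Qed.

(** The chart ball lies in the image under [Phi] of a closed ball, which is compact, hence closed in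
    C^n. *)
Let chart_Kcl (rho0 : R) : (forall w, enorm (w - q) <= rho0 -> (Psi @` U) w) ->
  forall y, D y -> closure [set y | [/\ D y, U y & enorm (Psi y - q) <= rho0]] y ->
  U y /\ enorm (Psi y - q) <= rho0.
Proof.
move=> rP y Dy cy.
have Kc : compact (Phi @` [set w | enorm (w - q) <= rho0]).
  apply: continuous_compact; last exact: closed_ball_enorm_compact.
  apply: continuous_in_subspaceT => w /set_mem /rP /Phid.
  exact: differentiable_continuous.
have Kcl := compact_closed (@norm_hausdorff _ V) Kc.
have : closure (Phi @` [set w | enorm (w - q) <= rho0]) y.
  apply: closureS cy => w [Dw Uw wr]; exists (Psi w) => //; exact: PhiK.
move=> /Kcl [w /= wr <-]; have [u Uu E] := rP w wr.
by move: wr; rewrite -E PhiK.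
Qed.

(** The normal at the nearest point is normalised so that at [y] itself the functional is real and
    equals the distance from [Psi y] to the complement of [G]. *)
Let supporting_near y : D y -> U y -> exists pi a,
  [/\ supporting D U Psi pi a, ~ G pi, (forall w, ~ G w -> enorm (Psi y - pi) <= enorm (Psi y - w)),
   (forall w, G w -> 0 <= complex.Re (hdot (w - pi) a)) &
   support Psi pi a y = rc (enorm (Psi y - pi))].
Proof.
move=> Dy Uy; have Gx : G (Psi y) by exists y.
have [pi [nG piP]] := nearest_exists (Psi y) oG qG.2.
have d0 : 0 < enorm (Psi y - pi).
  by rewrite enorm_gt0 subr_eq0; apply/eqP => E; apply: nG; rewrite -E.
have sup := nearest_supports oG cG Gx nG piP.
pose a := rc (enorm (Psi y - pi))^-1 *: (Psi y - pi).
have sup' w : G w -> 0 < complex.Re (hdot (w - pi) a).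
  move=> /sup h; rewrite hdotZr cjrc ReM Re_rc Im_rc mul0r subr0.
  by rewrite mulr_gt0 // invr_gt0.
exists pi, a; split=> //.
- split.
    by rewrite enormZ cmod_rc gtr0_norm ?invr_gt0 // mulVf // gt_eqF.
  by move=> w Dw Uw; apply: sup'; exists w.
- by move=> w /sup' /ltW.
- rewrite /support hdotZr cjrc hdotzz -rcM; congr (rc _).
  by rewrite expr2 mulrA mulVf ?mul1r // gt_eqF.
Qed.

Let shell_at (rho0 r1 : R) : 0 < r1 -> exists2 c : R, 0 < c & forall pi a y,
  enorm (pi - q) <= c -> supporting D U Psi pi a ->
  (forall w, G w -> 0 <= complex.Re (hdot (w - pi) a)) ->
  D y -> U y -> r1 <= enorm (Psi y - q) <= rho0 -> c <= cmod (support Psi pi a y).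
Proof.
move=> r10; have [|c c0 cP] := @shell_bound R n G q r1 rho0.
  move=> y a cy ry a1 sup; apply: only_q => //.
  by apply/eqP => E; move: ry; rewrite E subrr enorm0 leNgt r10.
exists c => // pi a y piq sup supG Dy Uy yr; apply: (cP pi a) => //.
- exact: sup.1.
- by apply: subset_closure; exists y.
Qed.

Let hyperbolic (rho0 : R) : 0 < rho0 ->
  (forall w, enorm (w - q) <= rho0 -> (Psi @` U) w) ->
  exists sg R0 : R, [/\ 0 < sg, 0 < R0, R0 <= 1 &
    forall phi : C -> V, disc D phi -> U (phi 0) -> enorm (Psi (phi 0) - q) < sg ->
    forall z : C, cmod z < R0 -> U (phi z)].
Proof.
move=> rho00 rP; have Kcl := chart_Kcl rP.
have [c c0 cP] := @shell_at rho0 rho0 rho00.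
set A := Num.sqrt (1 + c ^+ 2).
have A1 : 1 < A.
  rewrite -{1}sqrtr1 ltr_sqrt; last by rewrite ltr_wpDr // sqr_ge0.
  by rewrite ltrDl exprn_gt0.
(* Ensures [1 + 2 r < A], so the weight gains on the shell, and [2 r < rho0], so the exit ball lies
   inside it. *)
pose r := Num.min (A - 1) rho0 / 4.
have mn0 : 0 < Num.min (A - 1) rho0 by rewrite lt_min subr_gt0 A1.
have r0 : 0 < r by rewrite divr_gt0.
have rA : r <= (A - 1) / 4 by rewrite ler_pM2r ?invr_gt0 // ge_min lexx.
have rr : r <= rho0 / 4 by rewrite ler_pM2r ?invr_gt0 // ge_min lexx orbT.
pose B := 1 + r + r.
have B0 : 0 < B by rewrite /B; lra.
have BA : B < A by rewrite /B; lra.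
have [M MP] := power_gap (2 * rho0 / r) B0 BA.
have HM : 2 * rho0 * B ^+ M < r * A ^+ M.
  rewrite -ltr_pdivrMl //; apply: le_lt_trans MP.
  by rewrite mulrC mulrAC.
have BM0 : 0 < B ^+ M by rewrite exprn_gt0.
(* As [q] is not in [G], the nearest point [pi] satisfies [|pi - q| <= 2 |x - q|] with
   [x = Psi (phi 0)], which is below [c] as [shell_at] requires. *)
pose sg := Num.min r (c / 2).
have sg0 : 0 < sg by rewrite lt_min r0 divr_gt0.
exists sg, (Num.min 1 (r / (2 * rho0 * B ^+ M))); split=> //.
- by rewrite lt_min ltr01 divr_gt0 // !mulr_gt0.
- by rewrite ge_min lexx.
move=> phi dphi U0 q0 z; rewrite lt_min => /andP[_ zr].
have c01 : cmod (0 : C) < 1 by rewrite cmod0.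
have [_ D0] := dphi 0 c01.
have [pi [a [sup nG piP supG _]]] := supporting_near D0 U0.
have xpi : enorm (Psi (phi 0) - pi) <= enorm (Psi (phi 0) - q) by apply: piP; exact: qG.2.
have [q1 q2] : enorm (Psi (phi 0) - q) < r /\ enorm (Psi (phi 0) - q) < c / 2.
  by move: q0; rewrite lt_min => /andP.
have piq : enorm (pi - q) <= c.
  apply: le_trans (enorm_triangle (Psi (phi 0)) _ _) _.
  by rewrite (enormBC pi); lra.
have sh y : D y -> U y -> enorm (Psi y - q) = rho0 -> c <= cmod (support Psi pi a y).
  by move=> Dy Uy E; apply: (cP pi a) => //; rewrite E lexx.
have h1 : enorm (Psi (phi 0) - q) <= r by exact: ltW.
have h2 : r + r < rho0 by lra.
have h3 : enorm (Psi (phi 0) - pi) <= r by exact: le_trans xpi h1.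
have [Uz _] := exit_radius oU Psid rho00 Kcl dphi U0 sup r0 c0 sh h1 h2 h3 HM zr.
exact: Uz.
Qed.

(* The admissible function depends on [z], but its value away from [p] does not. *)
Lemma barrier (W : set V) : nbhs p W -> exists A0 A1 : R,
  \forall z \near p, D z -> barrier_at D W A0 A1 z.
Proof.
move=> nW.
have [rho0 rho00 rP] := chart_ball; have Kcl := chart_Kcl rP.
have [sg1 [R0 [sg10 R00 R01 hyp1]]] := hyperbolic rho00 rP.
have Phic : {for q, continuous Phi}.
  by apply/differentiable_continuous/Phid; exists p.
have nPW : nbhs q (Phi @^-1` W) by apply: Phic; rewrite PhiK.
have [dW dW0 dWP] := (nbhs_Cn _ _).1 nPW.
(* Below [dW], so that the barrier varies only over points of [W]. *)
pose sg := Num.min sg1 (Num.min rho0 dW) / 2.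
have mn0 : 0 < Num.min sg1 (Num.min rho0 dW) by rewrite !lt_min sg10 rho00.
have sg0 : 0 < sg by rewrite divr_gt0.
have [sgs1 sgr sgd] : [/\ sg < sg1, sg < rho0 & sg < dW].
  have : sg < Num.min sg1 (Num.min rho0 dW) by rewrite /sg; lra.
  by rewrite !lt_min => /and3P[].
have hyp (phi : C -> V) : disc D phi -> U (phi 0) -> enorm (Psi (phi 0) - q) < sg ->
    forall z : C, cmod z < R0 -> U (phi z).
  by move=> dphi U0 h; apply: hyp1 => //; exact: lt_trans sgs1.
have [c c0 cP] := @shell_at rho0 sg sg0.
have [m m0 mR] : exists2 m : nat, (0 < m)%N & 1 <= m%:R * R0.
  exists (Num.bound R0^-1).+1 => //; rewrite -ler_pdivrMr // div1r.
  apply: le_trans (ltW (archi_boundP _)) _; first by rewrite invr_ge0 ltW.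
  by rewrite ler_nat.
have [r [L [r0 L0 rU lip]]] := chart_lipschitz oU Up Psid.
(* [A0] comes from comparing distances through the Lipschitz chart, [A1] is the plateau of the
   profile; neither involves [z]. *)
exists (2^-1 * ln L), (2^-1 * profile0 m c (profile_top m c)).
have pc : {for p, continuous Psi} := differentiable_continuous (Psid Up).
have c20 : 0 < c / 2 by rewrite divr_gt0.
have near_q := (cont_Cn _ _).1 pc _ c20.
have near_q2 := (cont_Cn _ _).1 pc _ rho00.
near=> z.
move=> Dz.
have zr : enorm (z - p) < r / 4.
  by near: z; apply/nbhs_Cn; exists (r / 4) => //; rewrite divr_gt0.
have zq : enorm (Psi z - q) < c / 2 by near: z.
have Uz : U z by apply: rU; lra.
have [pi [a [sup nG piP supG fz]]] := supporting_near Dz Uz.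
have xpi : enorm (Psi z - pi) <= enorm (Psi z - q) by apply: piP; exact: qG.2.
have piq : enorm (pi - q) <= c.
  apply: le_trans (enorm_triangle (Psi z) _ _) _.
  by rewrite (enormBC pi); lra.
set d := enorm (Psi z - pi) in fz xpi.
have d0 : 0 < d.
  by rewrite enorm_gt0 subr_eq0; apply/eqP => E; apply: nG; rewrite -E; exists z.
(* For [w] near [z] the chart applies to [w]. For [w] at distance at least [r / 4], compare with [p]
   instead, since [p] is closer to [z] and [q] is not in [G]. *)
have dle w : ~ D w -> d <= L * enorm (z - w).
  move=> nDw; have pzr : enorm (p - z) < r / 2 by rewrite enormBC; lra.
  have zr2 : enorm (z - p) < r / 2 by lra.
  have [wz|wz] := ltP (enorm (w - z)) (r / 4); last first.
    apply: le_trans xpi _; rewrite enormBC.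
    apply: le_trans (lip z p zr2 pzr) _.
    by rewrite ler_pM2l // (enormBC p) (enormBC z w); lra.
  have Uw : U w.
    by apply: rU; apply: le_lt_trans (enorm_triangle z _ _) _; lra.
  have nGw : ~ G (Psi w) by move=> /(G_in Uw).
  apply: le_trans (piP _ nGw) _; rewrite (enormBC (Psi z)) (enormBC z).
  by apply: lip => //; lra.
have bd : d <= L * bdist D z.
  rewrite -ler_pdivrMl //; apply: lb_le_inf.
    by exists (enorm (z - p)), p => // Dp; apply: qG.2; exists p.
  by move=> _ [w nDw <-]; rewrite ler_pdivrMl //; exact: dle.
have b0 : 0 < bdist D z.
  by have := lt_le_trans d0 bd; rewrite pmulr_rgt0.
split=> //.
have sh1 y : D y -> U y -> sg <= enorm (Psi y - q) -> enorm (Psi y - q) <= rho0 ->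
    c <= cmod (support Psi pi a y).
  by move=> Dy Uy h1 h2; apply: (cP pi a) => //; rewrite h1.
have sh2 y : D y -> U y -> enorm (Psi y - q) = sg -> c <= cmod (support Psi pi a y).
  by move=> Dy Uy E; apply: sh1 => //; rewrite E // ltW.
have roy y v : D y -> U y -> enorm (Psi y - q) < sg -> cmod (support Psi pi a y) < c ->
    (((1 - 2 * expR ((ln (cmod (support Psi pi a y)) - ln c) / m%:R)) *
      cmod ('d (support Psi pi a) y v) / (2 * cmod (support Psi pi a y)))%:E
      <= kobayashi_royden D y v)%E.
  move=> Dy Uy yq fc.
  apply: (kobayashi_royden_lower oU Psid Kcl (ltW sgr) R00 R01 hyp v sup m0 mR c0 sh2 Uy yq) => //.
  apply: lt_le_trans (sup.2 y Dy Uy) _; exact: le_trans (ler_norm _) (Re_le_cmod _).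
exists (chart_fun U Psi q rho0 c m pi a); split.
- exact: (chart_fun_adm oD oU Psid Kcl sgr m0 c0 sup sh1 roy).
- rewrite /chart_fun; case: asboolP => [_|nn]; last first.
    by exfalso; apply: nn; split=> //; near: z.
  rewrite fz cmod_rc ger0_norm ?(ltW d0) // -mulrDr ler_pM2l ?invr_gt0 //.
  apply: le_trans (profile_le _ _ _) _.
  by rewrite addrC -lnM ?posrE // ler_ln ?posrE // mulr_gt0.
- move=> y Dy nWy; apply: (chart_fun_far m Psid Kcl sgr c0 sh1 Dy).
  move=> [Uy ysg]; apply: nWy; rewrite -(PhiK Uy).
  by apply: (dWP (Psi y)); exact: le_lt_trans sgd.
Unshelve. all: by end_near. Qed.

End Barrier.

(** * From barriers to the k-point property and the log-estimate *)

Section Estimates.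
Context {R : realType} {n : nat}.
Notation V := (Cn R n).
Implicit Types (D W : set V) (p q : V).

Lemma local_barrier D p W : open D -> locally_C_strictly_convex D p -> nbhs p W ->
  exists A0 A1 : R, \forall z \near p, D z -> barrier_at D W A0 A1 z.
Proof.
move=> oD [_ [U [Psi [[oU Up] _ [hPsi oPU [Phi hPhi PhiK]] cG mG]]]] nW.
exact: (barrier oD oU Up hPsi oPU hPhi PhiK cG mG nW).
Qed.

Lemma k_point_of_convex D p : open D -> locally_C_strictly_convex D p -> k_point D p.
Proof.
move=> oD lp; split=> [|W nW]; first by case: lp.
have [A0 [A1 nB]] := local_barrier oD lp nW.
rewrite limf_einfE; apply: (@lt_le_trans _ _ (A1 - A0)%:E); first exact: ltNyr.
apply: le_ereal_sup_tmp.
exists (ereal_inf ((fun z => kobayashi_compl D z W + (2^-1 * ln (bdist D z))%:E)%E @`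
   [set z | D z /\ barrier_at D W A0 A1 z])).
  eexists; last by [].
  by rewrite /within /=; apply: filterS nB => z h Dz; split=> //; exact: h.
apply: le_ereal_inf_tmp => _ [z [Dz [b0 [H [aH Hz HA]]]] <-].
have -> : (A1 - A0)%:E = ((A1 - A0 - 2^-1 * ln (bdist D z))%:E + (2^-1 * ln (bdist D z))%:E)%E.
  by rewrite -EFinD subrK.
rewrite leeD2r //; apply: le_ereal_inf_tmp => _ [w [Dw nWw] <-].
apply: le_trans (kobayashi_adm z w oD aH); rewrite lee_fin.
have [r r0 rP] := HA w Dw nWw.
by rewrite rP // ?subrr ?enorm0 //; lra.
Qed.

Lemma log_estimate_of_convex D p q : open D -> locally_C_strictly_convex D p ->
  locally_C_strictly_convex D q -> p <> q -> log_estimate D p q.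
Proof.
move=> oD lp lq pq; pose d := enorm (p - q) / 2.
have d0 : 0 < d by rewrite divr_gt0 // enorm_gt0 subr_eq0; apply/eqP.
pose B (x : V) := [set y : V | enorm (y - x) < d].
have nB x : nbhs x (B x) by apply/nbhs_Cn; exists d.
have disj y : ~ B p y \/ ~ B q y.
  have [h1|] := pselect (B p y); last by left.
  right=> h2; have := enorm_triangle y p q; rewrite (enormBC p y).
  by move: h1 h2; rewrite /B /= /d; lra.
have [A0 [A1 n1]] := local_barrier oD lp (nB p).
have [B0 [B1 n2]] := local_barrier oD lq (nB q).
(* Plateau values [A1] and [B1] enter with a minus sign: each barrier is on its plateau near the
   other point. *)
apply: (@le_lt_trans _ _ (A0 + B0 - A1 - B1)%:E); last exact: ltry.
pose good x (c0 c1 : R) z := B x z /\ (D z -> barrier_at D (B x) c0 c1 z).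
pose S := [set xy : V * V |
  D xy.1 /\ D xy.2 /\ good p A0 A1 xy.1 /\ good q B0 B1 xy.2].
apply: ge_ereal_inf; eexists.
  exists S; last by [].
  rewrite /within /=.
  exists ([set z | good p A0 A1 z], [set z | good q B0 B1 z]).
    by split; [apply: filterS2 (nB p) n1|apply: filterS2 (nB q) n2] => z; split.
  by move=> [x y] /= [g1 g2] [Dx Dy].
apply: ge_ereal_sup => _ [[x y] [/= Dx [Dy [[Bx g1] [By g2]]]] <-] /=.
have [bx [H1 [a1 H1x far1]]] := g1 Dx; have [by_ [H2 [a2 H2y far2]]] := g2 Dy.
(* The balls are disjoint, so near each point one barrier is constant and the difference obeys the
   metric bound without a factor 2. *)
have aH : kob_adm D (fun z => H1 z - H2 z).
  move=> z Dz; have [nz|nz] := disj z.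
    have [r r0 rP] := far1 z Dz nz.
    apply: (@adm_at_ext R n D (fun z => - H2 z) _ z A1) => //; last exact/adm_at_opp/a2.
    by exists r => // z' zr Dz'; rewrite rP // addrC.
  have [r r0 rP] := far2 z Dz nz.
  apply: (@adm_at_ext R n D H1 _ z (- B1)) => //; last exact: a1.
  by exists r => // z' zr Dz'; rewrite rP.
have nBpy : ~ B p y by case: (disj y).
have nBqx : ~ B q x by case: (disj x).
have [r1 r10 e1] := far1 y Dy nBpy; have [r2 r20 e2] := far2 x Dx nBqx.
have := kobayashi_adm x y oD aH.
rewrite (e1 y) ?subrr ?enorm0 // (e2 x) ?subrr ?enorm0 // => K.
apply: le_trans (leeB (lexx _) K) _; rewrite -EFinB lee_fin !lnV ?posrE //.
by clear -H1x H2y; lra.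
Qed.

End Estimates.

Theorem theorem6p13 (R : realType) (n : nat) (D : set 'rV[Cplx R]_n)
    (hD : domain D) :
  (forall p : 'rV[Cplx R]_n, locally_C_strictly_convex D p -> k_point D p) /\
  (forall p q : 'rV[Cplx R]_n,
     locally_C_strictly_convex D p -> locally_C_strictly_convex D q ->
     p <> q -> log_estimate D p q).
Proof.
have [_ oD _] := hD; split=> [p lp|p q lp lq pq].
  exact: k_point_of_convex.
exact: log_estimate_of_convex.
Qed.
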